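(* Let $n>m\ge1$, $R>0$, and let $F:C_{R+1}\to\mathbb{R}^m$ be a continuous Gaussian random field satisfying the $(R;M,k_1)$-assumptions on $C_{R+1}$. Then there is a constant $D_1=D_1(n,m,M,k_1)>0$ such that $\mathcal{E}(N(R;F))\le D_1\cdot|C_R|$.
   Context: $C_R=(-R,R)^n$, $|C_R|$ its volume. Write $F=(f_1,\dots,f_m)$, $K_{i_1i_2}(x,y)=\mathcal{E}(f_{i_1}(x)f_{i_2}(y))$. The $(R;M,k_1)$-assumptions are: (A1) $F$ is centered and for all $x\in C_{R+1}$ and all $\eta\in\mathbb{R}^m$, $\xi=(\xi_{ij})\in\mathbb{R}^{nm}$ with $\|\eta\|^2+\|\xi\|^2=1$, $\mathcal{E}|\sum_i\eta_if_i(x)+\sum_{i,j}\xi_{ij}\partial_jf_i(x)|^2\ge k_1>0$; (A2) $F$ is a.s. $C^{3-}=\bigcap_{0<\beta<1}C^{2+\beta}$ on $C_{R+1}$ and $\max_{0\le|\alpha|\le3}\sup_{x\in C_{R+1}}|D_x^\alpha D_y^\alpha K_{i_1i_2}(x,y)|_{y=x}|\le M$ for all $i_1,i_2$. $N(R;F)$ is the number of connected components of $F^{-1}(0)$ fully contained in $C_R$. *)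

(* Defs.v *)
From HB Require Import structures.
From mathcomp Require Import all_boot all_order all_algebra.
From mathcomp Require Import all_classical all_reals all_analysis.
Set Implicit Arguments. Unset Strict Implicit. Unset Printing Implicit Defensive.
Import Order.TTheory GRing.Theory Num.Theory.
Import numFieldNormedType.Exports.
Local Open Scope classical_set_scope.
Local Open Scope ring_scope.

Section defs.
Context {R : realType}.

Definition cube (n : nat) (r : R) : set 'rV[R]_n :=
  [set x | forall j : 'I_n, - r < x ord0 j < r].

Definition cube_vol (n : nat) (r : R) : R := (r *+ 2) ^+ n.

Definition evec (n : nat) (j : 'I_n) : 'rV[R]_n := delta_mx ord0 j.

Definition pd (n : nat) (j : 'I_n) (g : 'rV[R]_n -> R) : 'rV[R]_n -> R :=
  fun x => 'D_(evec j) g x.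

Definition iterD (n : nat) (s : seq 'I_n) (g : 'rV[R]_n -> R) : 'rV[R]_n -> R :=
  foldr (@pd n) g s.

Fixpoint derivable_seq (n : nat) (U : set 'rV[R]_n) (s : seq 'I_n)
    (g : 'rV[R]_n -> R) : Prop :=
  match s with
  | [::] => True
  | j :: s' => derivable_seq U s' g /\
               forall x, U x -> derivable (iterD s' g) x (evec j)
  end.

(* multi-index alpha : 'I_n -> nat, |alpha| = sum, D^alpha = d_1^a1 ... d_n^an *)
Definition mi_order (n : nat) (alpha : 'I_n -> nat) : nat := (\sum_(j < n) alpha j)%N.
Definition mi_dirs (n : nat) (alpha : 'I_n -> nat) : seq 'I_n :=
  flatten [seq nseq (alpha j) j | j <- enum 'I_n].

Definition C3minus (n : nat) (U : set 'rV[R]_n) (g : 'rV[R]_n -> R) : Prop :=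
  [/\ (forall x, U x -> differentiable g x),
      (forall (j : 'I_n) x, U x -> differentiable (pd j g) x),
      (forall (j k : 'I_n) x, U x -> {for x, continuous (pd j (pd k g))}) &
      (forall beta : R, 0 < beta < 1 -> forall (j k : 'I_n) x, U x ->
         exists2 r : R, 0 < r & exists C : R, forall y z, U y -> U z ->
           ball x r y -> ball x r z ->
           `|pd j (pd k g) y - pd j (pd k g) z| <= C * powR `|y - z| beta)].

End defs.
Arguments cube {R} n r.
Arguments evec {R n}.
Arguments pd {R n}.
Arguments iterD {R n}.
Arguments derivable_seq {R n}.
Arguments mi_order {n}.
Arguments mi_dirs {n}.
Arguments C3minus {R n}.



Section prob_defs.
Context {d : measure_display} {T : measurableType d} {R : realType}.
Variable P : probability T R.

Definition centered_gaussian (X : T -> R) : Prop :=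
  measurable_fun setT X /\
  ((forall A : set R, measurable A -> P (X @^-1` A) = \d_(0:R) A) \/
   exists2 s : R, 0 < s & forall A : set R, measurable A ->
       P (X @^-1` A) = normal_prob 0 s A).

Definition centered_gaussian_field (n m : nat) (U : set 'rV[R]_n)
    (F : T -> 'rV[R]_n -> 'rV[R]_m) : Prop :=
  forall (k : nat) (xs : 'I_k -> 'rV[R]_n) (idx : 'I_k -> 'I_m) (c : 'I_k -> R),
    (forall l, U (xs l)) ->
    centered_gaussian (fun w => \sum_(l < k) c l * F w (xs l) ord0 (idx l)).

Definition fcomp (n m : nat) (F : T -> 'rV[R]_n -> 'rV[R]_m) (i : 'I_m) (w : T) :
  'rV[R]_n -> R := fun x => F w x ord0 i.

Definition covK (n m : nat) (F : T -> 'rV[R]_n -> 'rV[R]_m) (i1 i2 : 'I_m)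
    (x y : 'rV[R]_n) : R :=
  fine ('E_P[fun w => (fcomp F i1 w x * fcomp F i2 w y)%R]).

Definition assumption_A1 (n m : nat) (r k1 : R) (F : T -> 'rV[R]_n -> 'rV[R]_m) :=
  0 < k1 /\
  forall (x : 'rV[R]_n), cube n (r + 1) x ->
  forall (eta : 'rV[R]_m) (xi : 'M[R]_(m, n)),
    \sum_(i < m) eta ord0 i ^+ 2 + \sum_(i < m) \sum_(j < n) xi i j ^+ 2 = 1 ->
    (k1%:E <= 'E_P[fun w => ((\sum_(i < m) eta ord0 i * fcomp F i w x
                  + \sum_(i < m) \sum_(j < n) xi i j * pd j (fcomp F i w) x) ^+ 2)%R])%E.

Definition assumption_A2 (n m : nat) (r M : R) (F : T -> 'rV[R]_n -> 'rV[R]_m) :=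
  (forall i : 'I_m, {ae P, forall w, C3minus (cube n (r + 1)) (fcomp F i w)}) /\
  forall (i1 i2 : 'I_m) (alpha : 'I_n -> nat), (mi_order alpha <= 3)%N ->
    [/\ (forall x, cube n (r + 1) x ->
           derivable_seq (cube n (r + 1)) (mi_dirs alpha) (covK F i1 i2 x)),
        (forall y, cube n (r + 1) y ->
           derivable_seq (cube n (r + 1)) (mi_dirs alpha)
             (fun x => iterD (mi_dirs alpha) (covK F i1 i2 x) y)) &
        (forall x, cube n (r + 1) x ->
           `| iterD (mi_dirs alpha)
                (fun x' => iterD (mi_dirs alpha) (covK F i1 i2 x') x) x | <= M)].

End prob_defs.

Section count.
Context {R : realType}.

Definition zero_set (n m : nat) (r : R) (G : 'rV[R]_n -> 'rV[R]_m) : set 'rV[R]_n :=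
  [set x | cube n (r + 1) x /\ G x = 0].

Definition inner_components (n m : nat) (r : R) (G : 'rV[R]_n -> 'rV[R]_m)
  : set (set 'rV[R]_n) :=
  [set S | exists2 x, zero_set r G x &
     S = connected_component (zero_set r G) x /\ S `<=` cube n r].

Definition Ncomp (n m : nat) (r : R) (G : 'rV[R]_n -> 'rV[R]_m) : \bar R :=
  (\esum_(S in inner_components r G) 1)%E.

End count.

(* Main.v *)
Require Import Defs.
From HB Require Import structures.
From mathcomp Require Import all_boot all_order all_algebra.
From mathcomp Require Import all_classical all_reals all_analysis.
From mathcomp Require Import measurable_realfun ring lra.
Import Order.TTheory GRing.Theory Num.Theory.
Import numFieldNormedType.Exports.
Set Implicit Arguments. Unset Strict Implicit. Unset Printing Implicit Defensive.
Local Open Scope classical_set_scope.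
Local Open Scope ring_scope.

(* A connected component of the zero set that lies inside the cube is compact; at a point x of it where a fixed coordinate j0 is maximal, the implicit function theorem forces the Jacobian without column j0 to have rank below m, so that some lam with sup norm 1 satisfies F(x) = 0 and sum_i lam_i d_j f_i(x) = 0 for all j <> j0. These are n + m - 1 conditions.
   Cut the cube into k^n cells of side e = 2r/k, with a grid of about e^-(m-1) values of lam. If a cell contains such an x, then at its center c the n + m - 1 Gaussian variables f_i(c) and sum_i lam_i D_j f_i(c), where D_j is a difference quotient of tiny step, are all of size O(e (1 + N)), N being the sum of the norms of first and second difference quotients at c (Taylor). (A1) makes these variables nondegenerate and (A2) bounds the variances entering N, so a small ball estimate gives probability O(e^(n+m-1)). Summing over cells yields O(r^n); distinct components eventually occupy distinct cells, and Fatou's lemma lets k tend to infinity.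
   Difference quotients replace derivatives of the field throughout, so that all the random variables are finite linear combinations of values of F, hence jointly Gaussian. *)

(** * Gaussian variables *)

(** The exponents balance exactly: (2r/e)^n cells, e^-(m-1) forms and a probability e^(n+m-1) leave
    a multiple of r^n, so no power of e may be lost. The obstacle is the random radius, since [N] is
    correlated with the constraints. Regression splits each variable of [N] into a part orthogonal
    to the constraints and a part that the constraints themselves keep small. Orthogonality means
    independence; this is derived from characteristic functions of single variables, with weights
    exp(-a^2 u^2 / 2) in place of indicators of small balls and 1 - exp(-b^2 V^2 / 2) in place of
    indicators of tails. A second obstacle is that (A2) speaks of derivatives of the covariance and
    (A1) of almost sure derivatives of the field, neither of difference quotients. For Gaussian
    variables almost sure convergence forces L^2 convergence, and this transfers both. The step of
    the quotients may vary with the centre and be as small as desired: only its nondegeneracy and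
    variance bounds, which are uniform, enter the constant. *)

Section normal_density.
Context {R : realType}.
Notation mu := (@lebesgue_measure R).
Implicit Types (s t x : R) (q : nat).

Lemma normal_pdf0E s x : s != 0 ->
  normal_pdf 0 s x = normal_peak s * expR (- (x ^+ 2 / (s ^+ 2 *+ 2))).
Proof. by move=> s0; rewrite normal_pdfE// /normal_fun subr0 mulNr. Qed.

Lemma expr_div_fact_le_expR q x : 0 <= x -> x ^+ q / q`!%:R <= expR x.
Proof.
case: q => [|q] x0; first by rewrite expr0 fact0 divr1 -expR0 ler_expR.
by apply: le_trans (expR_ge1Dxn q x0); rewrite lerDr.
Qed.

Lemma normal_peak_sqrt2 s : 0 < s ->
  normal_peak s = Num.sqrt 2 * normal_peak (Num.sqrt 2 * s).
Proof.
move=> s0; rewrite /normal_peak exprMn sqr_sqrtr//.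
rewrite (_ : 2 * s ^+ 2 * pi *+ 2 = 2 * (s ^+ 2 * pi *+ 2)); last by rewrite -!mulrA mulrnAr.
by rewrite (@sqrtrM _ 2)// invfM mulrA mulfV ?mul1r// gt_eqF// sqrtr_gt0.
Qed.

(* [x ^ 2q] is absorbed by doubling the variance. *)
Lemma moment_normal_pdf_le q s x : 0 < s ->
  (x ^+ 2) ^+ q * normal_pdf 0 s x <=
  q`!%:R * (4 * s ^+ 2) ^+ q * Num.sqrt 2 * normal_pdf 0 (Num.sqrt 2 * s) x.
Proof.
move=> s0.
have s2 : Num.sqrt 2 * s != 0 by rewrite gt_eqF// mulr_gt0// sqrtr_gt0.
rewrite (normal_pdf0E x s2) normal_pdf0E ?gt_eqF// (normal_peak_sqrt2 s0).
rewrite [(Num.sqrt 2 * s) ^+ 2]exprMn sqr_sqrtr//.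
set y := x ^+ 2 / (4 * s ^+ 2).
have sn0 : s != 0 by rewrite gt_eqF.
have -> : x ^+ 2 / (s ^+ 2 *+ 2) = y + y by rewrite /y; field; rewrite ?sn0.
have -> : x ^+ 2 / (2 * s ^+ 2 *+ 2) = y by rewrite /y; field; rewrite ?sn0.
have -> : x ^+ 2 = 4 * s ^+ 2 * y by rewrite /y; field; rewrite ?sn0.
have y0 : 0 <= y by rewrite divr_ge0 ?sqr_ge0// mulr_ge0// sqr_ge0.
have := expr_div_fact_le_expR q y0.
rewrite ler_pdivrMr ?ltr0n ?fact_gt0// => yq.
rewrite opprD expRD exprMn.
set p := normal_peak _; set e := expR (- y).
have e0 : 0 < e by exact: expR_gt0.
have p0 : 0 <= p by exact: normal_peak_ge0.
have eE : expR y * e = 1 by rewrite -expRD subrr expR0.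
rewrite (_ : _ * _ * (_ * _ * (e * e)) =
  ((4 * s ^+ 2) ^+ q * Num.sqrt 2 * p * e) * (y ^+ q * e)); last by ring.
rewrite (_ : _ * _ * _ * (p * e) =
  ((4 * s ^+ 2) ^+ q * Num.sqrt 2 * p * e) * (q`!)%:R); last by ring.
apply: ler_wpM2l.
  apply: mulr_ge0; last exact: ltW.
  apply: mulr_ge0 => //; apply: mulr_ge0; last exact: sqrtr_ge0.
  by apply: exprn_ge0; rewrite mulr_ge0// sqr_ge0.
apply: le_trans (_ : expR y * q`!%:R * e <= _).
  by rewrite ler_wpM2r// ltW.
by rewrite mulrAC eE mul1r.
Qed.

Lemma measurable_expr_normal_pdf q s :
  measurable_fun [set: R] (fun x => (x ^+ 2) ^+ q * normal_pdf 0 s x).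
Proof.
apply: measurable_funM; last exact: measurable_normal_pdf.
by apply: measurable_funX => //; exact: measurable_funX.
Qed.

Lemma expr_normal_pdf_ge0 q s x : 0 <= (x ^+ 2) ^+ q * normal_pdf 0 s x.
Proof. by rewrite mulr_ge0 ?normal_pdf_ge0// exprn_ge0// sqr_ge0. Qed.

Lemma integral_moment_normal_pdf_le q s : 0 < s ->
  (\int[mu]_x ((x ^+ 2) ^+ q * normal_pdf 0 s x)%:E <=
   (q`!%:R * (4 * s ^+ 2) ^+ q * Num.sqrt 2)%:E)%E.
Proof.
move=> s0; set C := _ * Num.sqrt 2.
apply: (@le_trans _ _ (\int[mu]_x (C * normal_pdf 0 (Num.sqrt 2 * s) x)%:E)%E).
  apply: ge0_le_integral => //=.
  - by move=> x _; rewrite lee_fin; exact: expr_normal_pdf_ge0.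
  - by apply/measurable_EFinP; exact: measurable_expr_normal_pdf.
  - apply/measurable_EFinP; apply: measurable_funM => //; exact: measurable_normal_pdf.
  - by move=> x _; rewrite lee_fin; exact: moment_normal_pdf_le.
under eq_integral do rewrite EFinM.
rewrite integralZl//; last exact: integrable_normal_pdf.
by rewrite integral_normal_pdf mule1.
Qed.

Lemma integrable_moment_normal_pdf q s : 0 < s ->
  mu.-integrable setT (fun x => ((x ^+ 2) ^+ q * normal_pdf 0 s x)%:E).
Proof.
move=> s0; apply/integrableP; split.
  by apply/measurable_EFinP; exact: measurable_expr_normal_pdf.
under eq_integral.
  move=> x _; rewrite gee0_abs; last first.
    by rewrite lee_fin; exact: expr_normal_pdf_ge0.
  over.
by apply: le_lt_trans (integral_moment_normal_pdf_le q s0) _; rewrite ltry.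
Qed.

Lemma is_derive_normal_pdf s x : s != 0 ->
  is_derive x 1 (normal_pdf 0 s) (- (x / s ^+ 2) * normal_pdf 0 s x).
Proof.
move=> s0.
have -> : normal_pdf 0 s = fun x => normal_peak s * expR (- (x ^+ 2 / (s ^+ 2 *+ 2))).
  by apply/funext => y; rewrite normal_pdf0E.
apply: is_derive_eq; rewrite !scaler0 ?addr0 ?add0r /= /GRing.scale/=.
field.
by rewrite s0.
Qed.

(** Integration by parts on the whole line: the integral over a symmetric interval is a difference
    of boundary values, O(1/n) by the decay of [B], and dominated convergence removes the
    truncation. *)
Lemma Rintegral_derive_eq0 (B D : R -> R) (C : R) :
  (forall x, is_derive x 1 B (D x)) -> continuous D ->
  mu.-integrable setT (EFin \o D) -> (forall x, `|x| * `|B x| <= C) ->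
  \int[mu]_x D x = 0.
Proof.
move=> dB cD iD BC.
pose f n x := (D \_ (`[(- n.+1%:R)%R, n.+1%:R]%classic : set R)) x.
have fE n : \int[mu]_x f n x = B n.+1%:R - B (- n.+1%:R).
  rewrite /Rintegral.
  have -> : (\int[mu]_x (f n x)%:E = \int[mu]_(x in `[(- n.+1%:R)%R, n.+1%:R]) (D x)%:E)%E.
    rewrite [RHS]integral_mkcond; apply: eq_integral => x _.
    by rewrite /f !patchE; case: ifPn.
  rewrite (@continuous_FTC2 _ D B)//=.
  - by rewrite (@lt_trans _ _ 0)// oppr_lt0.
  - by apply: continuous_subspaceT.
  - have cB : continuous B.
      move=> x; apply/differentiable_continuous/derivable1_diffP.
      exact: ex_derive.
    split => [x _||]; first exact: ex_derive.
    + by apply: cvg_at_right_filter; exact: cB.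
    + by apply: cvg_at_left_filter; exact: cB.
  - by move=> x _; rewrite derive1E; exact: derive_val.
have lim1 : (\int[mu]_x (f n x)%:E)%E @[n --> \oo] --> (\int[mu]_x (D x)%:E)%E.
  apply: (@dominated_cvg _ _ _ mu setT _ _ _ (fun x => `|D x|%:E)) => //.
  - move=> n; apply/measurable_EFinP.
    apply: (iffLR (measurable_restrictT D _)) => //.
    by apply: measurable_funTS; exact: continuous_measurable_fun.
  - move=> x _; apply: cvg_near_cst.
    near=> n; rewrite /f patchE ifT// inE/= in_itv/= -ler_norml.
    near: n; exists (Num.truncn `|x|) => // n /= xn.
    by rewrite ltW// (lt_le_trans (truncnS_gt _))// ler_nat ltnS.
  - by have := integrable_abse iD.
  - move=> n x _; rewrite /f patchE lee_fin; case: ifPn => //.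
    by rewrite normr0.
have lim2 : (fun n => \int[mu]_x f n x) @ \oo --> (0 : R).
  apply: cvg_trans (_ : (fun n : nat => B n.+1%:R - B (- n.+1%:R)) @ \oo --> (0 : R)).
    by apply: near_eq_cvg; near=> n; rewrite fE.
  have Bn (y : R) n : `|y| = n.+1%:R -> `|B y| <= C / n.+1%:R.
    by move=> yn; rewrite ler_pdivlMr// mulrC -yn BC.
  have C0 : 0 <= C by apply: le_trans (BC 0); rewrite mulr_ge0.
  apply/cvgrPdist_le => e e0; near=> n.
  rewrite sub0r normrN (le_trans (ler_normB _ _))//.
  have h1 : `|B n.+1%:R| <= C / n.+1%:R by apply: Bn; rewrite ger0_norm.
  have h2 : `|B (- n.+1%:R)| <= C / n.+1%:R by apply: Bn; rewrite normrN ger0_norm.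
  apply: le_trans (lerD h1 h2) _.
  rewrite -mulrDl ler_pdivrMr// mulrC -ler_pdivrMr//.
  near: n; exists (Num.truncn ((C + C) / e)) => // n /= xn.
  by rewrite ltW// (lt_le_trans (truncnS_gt _))// ler_nat ltnS.
have Dfin : (\int[mu]_x (D x)%:E)%E \is a fin_num by exact: integrable_fin_num.
have lim3 : (fun n => \int[mu]_x f n x) @ \oo --> \int[mu]_x D x.
  by apply: fine_cvg; rewrite fineK.
exact: (cvg_unique _ lim3 lim2).
Unshelve. all: end_near. Qed.

Lemma continuous_normal_pdf0 s : s != 0 -> continuous (normal_pdf 0 s : R -> R).
Proof. exact: continuous_normal_pdf. Qed.

(** Both 1 and y = x^2 / (2 s^2) are at most e^y. This provides the decay hypothesis of
    [Rintegral_derive_eq0]. *)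
Lemma normal_pdf_decay s x : 0 < s ->
  (1 + x ^+ 2) * normal_pdf 0 s x <= (1 + 2 * s ^+ 2) * normal_peak s.
Proof.
move=> s0; rewrite normal_pdf0E ?gt_eqF//.
have p0 := normal_peak_ge0 s; set p := normal_peak s in p0 *.
have sn0 : s != 0 by rewrite gt_eqF.
set y := x ^+ 2 / _.
have y0 : 0 <= y by rewrite divr_ge0 ?sqr_ge0// mulrn_wge0// sqr_ge0.
have -> : x ^+ 2 = 2 * s ^+ 2 * y by rewrite /y; field.
rewrite mulrCA [leRHS]mulrC; apply: ler_wpM2l => //.
rewrite mulrDl mul1r lerD//.
  by rewrite -[leRHS]expR0 ler_expR oppr_le0.
rewrite -[leLHS]mulrA; apply: ler_piMr; first by rewrite mulr_ge0// sqr_ge0.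
rewrite expRN ler_pdivrMr ?expR_gt0// mul1r.
by apply: le_trans (expR_ge1Dx y); rewrite lerDr.
Qed.

Lemma integrable_bounded_normal_pdf s (f : R -> R) : 0 < s ->
  measurable_fun setT f -> (forall x, `|f x| <= 1 + x ^+ 2) ->
  mu.-integrable setT (fun x => (f x * normal_pdf 0 s x)%:E).
Proof.
move=> s0 mf fb.
apply: (@le_integrable _ _ _ mu _ _ _
  (fun x => ((x ^+ 2) ^+ 0 * normal_pdf 0 s x + (x ^+ 2) ^+ 1 * normal_pdf 0 s x)%:E)) => //.
- apply/measurable_EFinP; apply: measurable_funM => //; exact: measurable_normal_pdf.
- move=> x _; rewrite !abse_EFin lee_fin normrM.
  rewrite -mulrDl expr0 expr1 [leRHS]ger0_norm; last first.
    by rewrite mulr_ge0 ?normal_pdf_ge0// addr_ge0// sqr_ge0.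
  by rewrite (ger0_norm (normal_pdf_ge0 _ _ _)) ler_wpM2r// normal_pdf_ge0.
- have := integrableD measurableT (integrable_moment_normal_pdf 0 s0)
    (integrable_moment_normal_pdf 1 s0).
  by apply: eq_integrable => // x _; rewrite EFinD.
Qed.

Lemma variance_normal_pdf s : 0 < s ->
  \int[mu]_x (x ^+ 2 * normal_pdf 0 s x) = s ^+ 2.
Proof.
move=> s0; have sn0 : s != 0 by rewrite gt_eqF.
have i2 : mu.-integrable setT (EFin \o (fun x => x ^+ 2 * normal_pdf 0 s x)).
  apply: integrable_bounded_normal_pdf => // x.
  by rewrite ger0_norm ?sqr_ge0// lerDr.
have i0 : mu.-integrable setT (EFin \o normal_pdf 0 s) by exact: integrable_normal_pdf.
(* [D] is the derivative of [x * normal_pdf 0 s x], so its integral vanishes. *)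
pose D x := normal_pdf 0 s x - s ^- 2 * (x ^+ 2 * normal_pdf 0 s x).
have : \int[mu]_x D x = 0.
  apply: (@Rintegral_derive_eq0 (fun x => x * normal_pdf 0 s x) _
    ((1 + 2 * s ^+ 2) * normal_peak s)).
  - move=> x.
    have dp := is_derive_normal_pdf x sn0.
    apply: is_derive_eq; rewrite /D /GRing.scale/=.
    by field.
  - have cp := continuous_normal_pdf0 sn0.
    move=> x; rewrite /D; apply: cvgB; first exact: cp.
    apply: cvgM; first exact: cvg_cst.
    apply: cvgM; last exact: cp.
    exact: exprn_continuous.
  - have := integrableB measurableT i0 (integrableZl measurableT (s ^- 2) i2).
    by apply: eq_integrable => // x _; rewrite /D/= EFinB EFinM.
  - move=> x; rewrite normrM mulrA -expr2 real_normK ?num_real//.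
    rewrite ger0_norm ?normal_pdf_ge0//.
    apply: le_trans (normal_pdf_decay x s0).
    by rewrite ler_wpM2r ?normal_pdf_ge0// lerDr.
rewrite /D RintegralB//; last first.
  by have := integrableZl measurableT (s ^- 2) i2; apply: eq_integrable => // x _; rewrite /= EFinM.
rewrite RintegralZl//.
rewrite {1}/Rintegral integral_normal_pdf/= => /eqP.
rewrite subr_eq0 => /eqP h.
by rewrite -[RHS]mulr1 h mulrA mulfV ?mul1r// expf_neq0.
Qed.

(** The law is symmetric, so its characteristic function is real and equals its cosine integral. *)
Definition normal_cf s t := \int[mu]_x (cos (t * x) * normal_pdf 0 s x).

Lemma measurable_cos_scale t : measurable_fun [set: R] (fun x => cos (t * x)).
Proof.
apply: continuous_measurable_fun => x; apply: continuous_comp; last exact: continuous_cos.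
by apply: cvgM; [exact: cvg_cst|exact: cvg_id].
Qed.

Lemma measurable_sin_scale t : measurable_fun [set: R] (fun x => sin (t * x)).
Proof.
apply: continuous_measurable_fun => x; apply: continuous_comp; last exact: continuous_sin.
by apply: cvgM; [exact: cvg_cst|exact: cvg_id].
Qed.

Lemma normr_le_1Dsqr x : `|x| <= 1 + x ^+ 2.
Proof.
rewrite -[x ^+ 2]real_normK ?num_real//; have := sqr_ge0 (`|x| - 1); nra.
Qed.

Lemma normr_sin_le1 x : `|sin x| <= 1.
Proof. by rewrite ler_norml sin_geN1 sin_le1. Qed.

Lemma normr_cos_le1 x : `|cos x| <= 1.
Proof. by rewrite ler_norml cos_geN1 cos_le1. Qed.

Lemma integrable_cos_normal_pdf s t : 0 < s ->
  mu.-integrable setT (EFin \o (fun x => cos (t * x) * normal_pdf 0 s x)).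
Proof.
move=> s0; apply: integrable_bounded_normal_pdf => // [|x].
  exact: measurable_cos_scale.
by apply: le_trans (normr_cos_le1 _) _; rewrite lerDl sqr_ge0.
Qed.

Lemma integrable_xsin_normal_pdf s t : 0 < s ->
  mu.-integrable setT (EFin \o (fun x => (x * sin (t * x)) * normal_pdf 0 s x)).
Proof.
move=> s0; apply: integrable_bounded_normal_pdf => // [|x].
  by apply: measurable_funM => //; exact: measurable_sin_scale.
apply: le_trans (normr_le_1Dsqr _); rewrite normrM ler_piMr//.
exact: normr_sin_le1.
Qed.

(** Stein's identity for the test function sin(t x), by integrating the derivative of
    [sin (t * x) * normal_pdf 0 s x]. *)
Lemma stein_normal_pdf s t : 0 < s ->
  \int[mu]_x ((x * sin (t * x)) * normal_pdf 0 s x) = s ^+ 2 * t * normal_cf s t.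
Proof.
move=> s0; have sn0 : s != 0 by rewrite gt_eqF.
have ic := integrable_cos_normal_pdf t s0.
have iS0 := integrable_xsin_normal_pdf t s0.
pose D x := t * (cos (t * x) * normal_pdf 0 s x) -
  s ^- 2 * ((x * sin (t * x)) * normal_pdf 0 s x).
have iC : mu.-integrable setT (EFin \o (fun x => t * (cos (t * x) * normal_pdf 0 s x))).
  by have := integrableZl measurableT t ic; apply: eq_integrable => // x _; rewrite /= EFinM.
have iS : mu.-integrable setT (EFin \o (fun x => s ^- 2 * ((x * sin (t * x)) * normal_pdf 0 s x))).
  by have := integrableZl measurableT (s ^- 2) iS0; apply: eq_integrable => // x _; rewrite /= EFinM.
have : \int[mu]_x D x = 0.
  apply: (@Rintegral_derive_eq0 (fun x => sin (t * x) * normal_pdf 0 s x) _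
    ((1 + 2 * s ^+ 2) * normal_peak s)).
  - move=> x.
    have dp := is_derive_normal_pdf x sn0.
    have dt : is_derive x 1 (fun x : R => t * x) t.
      by apply: is_derive_eq; rewrite /GRing.scale/= ?mulr0 ?addr0 ?mulr1.
    have ds : is_derive x 1 (fun x : R => sin (t * x)) (cos (t * x) * t).
      exact: (is_derive1_comp (is_derive_sin _) dt).
    apply: is_derive_eq; rewrite /D /GRing.scale/=.
    by field.
  - have cp := continuous_normal_pdf0 sn0.
    have ct x : {for x, continuous (fun x : R => t * x)}.
      by apply: cvgM; [exact: cvg_cst|exact: cvg_id].
    have cc x : {for x, continuous (fun x : R => cos (t * x))}.
      by apply: continuous_comp; [exact: ct|exact: continuous_cos].
    have cs x : {for x, continuous (fun x : R => sin (t * x))}.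
      by apply: continuous_comp; [exact: ct|exact: continuous_sin].
    move=> x; rewrite /D; apply: cvgB.
      by apply: cvgM; [exact: cvg_cst|apply: cvgM; [exact: cc|exact: cp]].
    apply: cvgM; first exact: cvg_cst.
    apply: cvgM; last exact: cp.
    by apply: cvgM; [exact: cvg_id|exact: cs].
  - have := integrableB measurableT iC iS.
    by apply: eq_integrable => // x _; rewrite /D/= EFinB.
  - move=> x; rewrite normrM mulrA.
    rewrite (ger0_norm (normal_pdf_ge0 _ _ _)).
    apply: le_trans (normal_pdf_decay x s0).
    rewrite ler_wpM2r ?normal_pdf_ge0//.
    apply: le_trans (normr_le_1Dsqr _); rewrite ler_piMr//.
    exact: normr_sin_le1.
rewrite /D RintegralB// !RintegralZl// => /eqP; rewrite subr_eq0 => /eqP h.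
rewrite -mulrA /normal_cf h mulrA mulfV ?mul1r//.
by rewrite expf_neq0.
Qed.

(** Differentiation under the integral and Stein's identity give the equation phi' = - s^2 t phi;
    with phi(0) = 1 it determines the characteristic function. *)
Lemma is_derive_normal_cf s t : 0 < s ->
  is_derive t 1 (normal_cf s) (- (s ^+ 2 * t * normal_cf s t)).
Proof.
move=> s0.
pose f (t : R) (x : R) := cos (t * x) * normal_pdf 0 s x.
have df t' x : is_derive t' 1 (f ^~ x) (- ((x * sin (t' * x)) * normal_pdf 0 s x)).
  have dt : is_derive t' 1 (fun t : R => t * x) x.
    by apply: is_derive_eq; rewrite /GRing.scale/= ?mulr0 ?addr0 ?add0r ?mulr1.
  have dc : is_derive t' 1 (fun t : R => cos (t * x)) (- sin (t' * x) * x).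
    exact: (is_derive1_comp (is_derive_cos _) dt).
  by apply: is_derive_eq; rewrite /GRing.scale/=; ring.
have pf t' x : partial1of2 f t' x = - ((x * sin (t' * x)) * normal_pdf 0 s x).
  by rewrite partial1of2E; exact: derive_val.
have := @cvg_differentiation_under_integral R _ _ mu f setT measurableT t (t - 1) (t + 1)
  _ _ _ (fun x => (1 + x ^+ 2) * normal_pdf 0 s x) _ _ _.
rewrite (_ : \int[mu]_y partial1of2 f t y = - (s ^+ 2 * t * normal_cf s t)); last first.
  rewrite -stein_normal_pdf//.
  under eq_Rintegral do rewrite pf -mulN1r.
  by rewrite RintegralZl ?mulN1r//; exact: integrable_xsin_normal_pdf.
have -> : (fun h : R => h^-1 *: (\int[mu]_y f (h + t) y - \int[mu]_y f t y)) =
   (fun h : R => h^-1 *: (normal_cf s (h + t) - normal_cf s t)) by [].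
move=> H.
have {H} : h^-1 *: (normal_cf s (h + t) - normal_cf s t) @[h --> 0^'] -->
    - (s ^+ 2 * t * normal_cf s t).
  apply: H.
  - by rewrite /= in_itv/=; apply/andP; split; lra.
  - by move=> x _; exact: integrable_cos_normal_pdf.
  - by move=> x y _ _; have := df x y; case.
  - by move=> y; rewrite mulr_ge0 ?normal_pdf_ge0// addr_ge0 ?sqr_ge0.
  - apply: integrable_bounded_normal_pdf => // [|x].
      by apply: measurable_funD => //; exact: measurable_funX.
    by rewrite ger0_norm// addr_ge0 ?sqr_ge0.
  - move=> x y _ _; rewrite pf normrN normrM (ger0_norm (normal_pdf_ge0 _ _ _)).
    rewrite ler_wpM2r ?normal_pdf_ge0//.
    apply: le_trans (normr_le_1Dsqr _); rewrite normrM ler_piMr//.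
    exact: normr_sin_le1.
move=> H; apply: DeriveDef; last first.
  by rewrite /derive; under eq_fun do rewrite scaler1; exact/cvg_lim.
by apply/cvg_ex; eexists; under eq_fun do rewrite scaler1; exact: H.
Qed.

Lemma normal_cfE s t : 0 < s -> normal_cf s t = expR (- (s ^+ 2 * t ^+ 2 / 2)).
Proof.
move=> s0.
pose h t := normal_cf s t * expR (s ^+ 2 * t ^+ 2 / 2).
have dh (x : R) : is_derive x 1 h 0.
  have d1 := is_derive_normal_cf x s0.
  have d2 : is_derive x 1 (fun t : R => s ^+ 2 * t ^+ 2 / 2) (s ^+ 2 * x).
    by apply: is_derive_eq; rewrite /GRing.scale/=; field.
  have d3 := @is_derive1_comp _ expR (fun t : R => s ^+ 2 * t ^+ 2 / 2) _ _ _ (is_derive_expR _) d2.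
  rewrite (_ : h = normal_cf s * (expR \o (fun t : R => s ^+ 2 * t ^+ 2 / 2)))//.
  by apply: is_derive_eq; rewrite /GRing.scale/=; ring.
have : h t = h 0 by apply: is_derive_0_is_cst.
rewrite {2}/h expr0n/= mulr0 mul0r expR0 mulr1 => ht.
have n0 : normal_cf s 0 = 1.
  rewrite /normal_cf; under eq_Rintegral do rewrite mul0r cos0 mul1r.
  by rewrite /Rintegral integral_normal_pdf.
have e0 : expR (s ^+ 2 * t ^+ 2 / 2) != 0 by rewrite gt_eqF// expR_gt0.
by apply: (mulIf e0); rewrite expRN mulVf//; exact: etrans ht n0.
Qed.

(** The Radon-Nikodym derivative agrees almost everywhere with the explicit density, because both
    have the same integral over every measurable set. *)
Lemma ge0_integral_normal_prob s (f : R -> \bar R) : s != 0 ->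
  measurable_fun setT f -> (forall x, (0 <= f x)%E) ->
  (\int[normal_prob 0 s]_x f x = \int[mu]_x (f x * (normal_pdf 0 s x)%:E))%E.
Proof.
move=> s0 mf f0.
have dom := normal_prob_dominates (0 : R) s.
rewrite -(Radon_Nikodym_SigmaFinite.change_of_variables dom)//.
apply: ge0_ae_eq_integral => //.
- apply: emeasurable_funM => //.
  exact: measurable_int (Radon_Nikodym_SigmaFinite.f_integrable dom).
- apply: emeasurable_funM => //; apply/measurable_EFinP; exact: measurable_normal_pdf.
- by move=> x _; rewrite mule_ge0// Radon_Nikodym_SigmaFinite.f_ge0.
- by move=> x _; rewrite mule_ge0// lee_fin normal_pdf_ge0.
- apply: ae_eqe_mul2l.
  apply: integral_ae_eq => //.
  + exact: Radon_Nikodym_SigmaFinite.f_integrable.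
  + apply/measurable_EFinP; exact: measurable_normal_pdf.
  + by move=> E _ mE; rewrite -Radon_Nikodym_SigmaFinite.f_integral.
Qed.

End normal_density.

Section gaussian_variable.
Context {d : measure_display} {T : measurableType d} {R : realType}.
Variable P : probability T R.
Notation mu := (@lebesgue_measure R).
Implicit Types (X Y L U V : T -> R) (f : R -> R) (s a q : R).

Definition ex X : R := \int[P]_w X w.

(** For centered variables this is the covariance, and [ip X X] is the variance. *)
Definition ip X Y : R := ex (fun w => X w * Y w).

Lemma ge0_integral_law (nu : {measure set (g_sigma_algebraType (R.-ocitv.-measurable)) -> \bar R}) X (f : R -> \bar R) :
  measurable_fun setT X -> (forall A, measurable A -> P (X @^-1` A) = nu A) ->
  measurable_fun setT f -> (forall x, (0 <= f x)%E) ->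
  (\int[P]_w f (X w) = \int[nu]_x f x)%E.
Proof.
move=> mX lX mf f0.
pose gR := g_sigma_algebraType (R.-ocitv.-measurable).
have mX' : measurable_fun setT (X : T -> gR) := mX.
pose X0 := isMeasurableFun.Build _ _ _ _ (X : T -> gR) mX'.
pose X' : {mfun T >-> gR} := HB.pack (X : T -> gR) X0.
have /= := @ge0_integral_pushforward _ _ T gR R X mX' P setT f measurableT mf (fun x _ => f0 x).
rewrite preimage_setT => <-.
apply: (@eq_measure_integral _ gR R _ nu (distribution P X')) => A mA _.
exact: lX.
Qed.

Lemma ge0_integral_dirac_law X f : measurable_fun setT X ->
  (forall A, measurable A -> P (X @^-1` A) = \d_(0 : R) A) ->
  measurable_fun setT f -> (forall x, 0 <= f x) ->
  (\int[P]_w (f (X w))%:E = (f 0)%:E)%E.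
Proof.
move=> mX lX mf f0.
rewrite (@ge0_integral_law (\d_(0 : g_sigma_algebraType (R.-ocitv.-measurable))) X (EFin \o f))//.
- rewrite integral_dirac//=; first by rewrite diracE in_setT mul1e.
  exact/measurable_EFinP.
exact/measurable_EFinP.
Qed.

Lemma ge0_integral_normal_law X s f : 0 < s -> measurable_fun setT X ->
  (forall A, measurable A -> P (X @^-1` A) = normal_prob 0 s A) ->
  measurable_fun setT f -> (forall x, 0 <= f x) ->
  (\int[P]_w (f (X w))%:E = \int[mu]_x (f x * normal_pdf 0 s x)%:E)%E.
Proof.
move=> s0 mX lX mf f0.
rewrite (@ge0_integral_law (normal_prob 0 s) X (EFin \o f))//.
  rewrite ge0_integral_normal_prob ?gt_eqF//.
  exact/measurable_EFinP.
exact/measurable_EFinP.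
Qed.

Lemma bounded_integrable X (B : R) : measurable_fun setT X ->
  (forall w, `|X w| <= B) -> P.-integrable setT (EFin \o X).
Proof.
move=> mX bX; apply: measurable_bounded_integrable => //.
  exact: le_lt_trans (probability_le1 P measurableT) (ltry _).
exists B; split; first exact: num_real.
by move=> x Bx w _ /=; apply: le_trans (bX w) (ltW Bx).
Qed.

Lemma centered_gaussian_measurable X : centered_gaussian P X -> measurable_fun setT X.
Proof. by case. Qed.

(** Not the exact Gaussian moment: it is the constant obtained by absorbing x^2k into a density of
    doubled variance. *)
Definition moment_cst (k : nat) : R := k`!%:R * 4 ^+ k * Num.sqrt 2.

Lemma centered_gaussian_moment_lt X k : centered_gaussian P X ->
  P.-integrable setT (EFin \o (fun w => (X w ^+ 2) ^+ k)).
Proof.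
move=> [mX lX]; apply/integrableP; split.
  by apply/measurable_EFinP; apply: measurable_funX; exact: measurable_funX.
have h0 (x : R) : 0 <= (x ^+ 2) ^+ k by rewrite exprn_ge0 ?sqr_ge0.
under eq_integral do rewrite /= ger0_norm//.
have mf : measurable_fun setT (fun x : R => (x ^+ 2) ^+ k).
  by apply: measurable_funX; exact: measurable_funX.
case: lX => [lX|[s s0 lX]].
  by rewrite (ge0_integral_dirac_law mX lX mf)// ltry.
rewrite (ge0_integral_normal_law s0 mX lX mf)//.
by apply: le_lt_trans (integral_moment_normal_pdf_le k s0) _; rewrite ltry.
Qed.

Lemma centered_gaussian_sqr X : centered_gaussian P X ->
  P.-integrable setT (EFin \o (fun w => X w ^+ 2)).
Proof. exact: (@centered_gaussian_moment_lt X 1). Qed.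

Lemma ipXX_dirac X : measurable_fun setT X ->
  (forall A, measurable A -> P (X @^-1` A) = \d_(0 : R) A) -> ip X X = 0.
Proof.
move=> mX lX; rewrite /ip /ex /Rintegral.
under eq_integral do rewrite -expr2.
rewrite (ge0_integral_dirac_law (f := fun x => x ^+ 2) mX lX)//=; first by rewrite expr0n.
by move=> x; rewrite sqr_ge0.
Qed.

Lemma ipXX_normal X s : 0 < s -> measurable_fun setT X ->
  (forall A, measurable A -> P (X @^-1` A) = normal_prob 0 s A) -> ip X X = s ^+ 2.
Proof.
move=> s0 mX lX; rewrite /ip /ex /Rintegral.
under eq_integral do rewrite -expr2.
rewrite (ge0_integral_normal_law (f := fun x => x ^+ 2) s0 mX lX)//=.
  exact: variance_normal_pdf.
by move=> x; rewrite sqr_ge0.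
Qed.

Lemma ipXX_ge0 X : 0 <= ip X X.
Proof. by apply: Rintegral_ge0 => w _; rewrite -expr2 sqr_ge0. Qed.

Lemma centered_gaussian_moment_le X k : centered_gaussian P X ->
  ex (fun w => (X w ^+ 2) ^+ k) <= moment_cst k * ip X X ^+ k.
Proof.
move=> [mX lX].
have h0 (x : R) : 0 <= (x ^+ 2) ^+ k by rewrite exprn_ge0 ?sqr_ge0.
have mf : measurable_fun setT (fun x : R => (x ^+ 2) ^+ k).
  by apply: measurable_funX; exact: measurable_funX.
case: lX => [lX|[s s0 lX]].
  rewrite (ipXX_dirac mX lX) /ex /Rintegral (ge0_integral_dirac_law mX lX mf)//=.
  (* For [k = 0] both powers of 0 equal 1, so the degenerate law requires [moment_cst] to be at
     least 1. *)
  rewrite expr0n/= ler_peMl ?exprn_ge0// /moment_cst.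
  have h1 : (1 : R) <= k`!%:R by rewrite ler1n fact_gt0.
  have h2 : (1 : R) <= 4 ^+ k by rewrite exprn_ege1// ler1n.
  have h3 : (1 : R) <= Num.sqrt 2 by rewrite -[leLHS]sqrtr1 ler_sqrt// ler1n.
  rewrite -[leLHS]mulr1 ler_pM//.
  by rewrite -[leLHS]mulr1 ler_pM.
rewrite (ipXX_normal s0 mX lX) /ex /Rintegral (ge0_integral_normal_law s0 mX lX mf)//.
have := integral_moment_normal_pdf_le k s0.
rewrite exprMn mulrA /moment_cst -!mulrA (mulrC (Num.sqrt 2)) => h.
rewrite -lee_fin fineK//.
rewrite ge0_fin_numE; first by apply: le_lt_trans h _; rewrite ltry.
by apply: integral_ge0 => x _; rewrite lee_fin expr_normal_pdf_ge0.
Qed.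

Lemma centered_gaussian_cf X : centered_gaussian P X ->
  ex (fun w => cos (X w)) = expR (- (ip X X / 2)).
Proof.
move=> [mX lX].
have mc : measurable_fun setT (cos : R -> R).
  by apply: continuous_measurable_fun; exact: continuous_cos.
(* Integrals are transported to the law for nonnegative functions, hence the shift of the cosine by
   1. *)
have h0 (x : R) : 0 <= 1 + cos x by have := cos_geN1 x; lra.
have mf : measurable_fun setT (fun x : R => 1 + cos x) by exact: measurable_funD.
have iC : P.-integrable setT (EFin \o (fun w => cos (X w))).
  apply: (@bounded_integrable _ 1) => [|w]; last exact: normr_cos_le1.
  exact: measurableT_comp.
have i1 : P.-integrable setT (EFin \o (fun=> 1 : R)).
  by apply: (@bounded_integrable _ 1) => // w; rewrite normr1.
have e1 : \int[P]_w (1 + cos (X w)) = 1 + ex (fun w => cos (X w)).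
  rewrite RintegralD//; congr (_ + _).
  rewrite /Rintegral integral_cst//= mul1e -[RHS]/(fine 1%E); congr fine.
  exact: probability_setT.
apply: (addrI 1); rewrite -e1 /Rintegral.
case: lX => [lX|[s s0 lX]].
  rewrite (ipXX_dirac mX lX) (ge0_integral_dirac_law mX lX mf)//=.
  by rewrite cos0 mul0r oppr0 expR0.
rewrite (ipXX_normal s0 mX lX) (ge0_integral_normal_law s0 mX lX mf)//.
rewrite -/(Rintegral mu setT (fun x => (1 + cos x) * normal_pdf 0 s x)).
under eq_Rintegral do rewrite mulrDl mul1r.
rewrite RintegralD//; last 2 first.
- exact: integrable_normal_pdf.
- have := integrable_cos_normal_pdf 1 s0; apply: eq_integrable => // x _ /=.
  by rewrite mul1r.
congr (_ + _); first by rewrite /Rintegral integral_normal_pdf.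
have := normal_cfE 1 s0; rewrite expr1n mulr1 => <-.
by apply: eq_Rintegral => x _; rewrite mul1r.
Qed.

Lemma normal_peak_le s : 0 < s -> normal_peak s <= s^-1.
Proof.
move=> s0; rewrite /normal_peak lef_pV2 ?posrE//; last first.
  by rewrite sqrtr_gt0 mulrn_wgt0// mulr_gt0 ?exprn_gt0 ?pi_gt0.
rewrite -[leLHS](ger0_norm (ltW s0)) -sqrtr_sqr ler_wsqrtr//.
have := @pi_ge2 R => pi2.
rewrite -mulrnAr ler_peMr ?sqr_ge0//.
by rewrite -mulr_natr; lra.
Qed.

(** The density is at most 1/s, so [-a, a] has probability at most 2a/s; if this is at least 1/2
    then s <= 4a. *)
Lemma centered_gaussian_anticoncentration X a : centered_gaussian P X -> 0 <= a ->
  (2^-1%:E <= P [set w | (`|X w| <= a)%R])%E -> ip X X <= 16 * a ^+ 2.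
Proof.
move=> [mX lX] a0.
have seta : [set w | `|X w| <= a] = X @^-1` `[- a, a]%classic.
  by apply/seteqP; split => w /=; rewrite in_itv/= ler_norml.
rewrite seta; case: lX => [lX|[s s0 lX]] h.
  by rewrite (ipXX_dirac mX lX) mulr_ge0// sqr_ge0.
rewrite (ipXX_normal s0 mX lX).
have : (normal_prob 0 s `[(- a)%R, a]%classic <= (s^-1 * (a *+ 2))%:E)%E.
  apply: (@le_trans _ _ (\int[mu]_(x in `[(- a)%R, a]%classic) (s^-1)%:E)%E).
    apply: ge0_le_integral => //=.
    - by move=> x _; rewrite lee_fin normal_pdf_ge0.
    - apply/measurable_EFinP; apply: measurable_funTS; exact: measurable_normal_pdf.
    - move=> x _; rewrite lee_fin; apply: le_trans (normal_peak_le s0).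
      by rewrite normal_pdf_ub// gt_eqF.
  rewrite integral_cst//= lebesgue_measure_itv/= lte_fin.
  case: ifPn => _; last first.
    by rewrite mule0 lee_fin; apply: mulr_ge0; [rewrite invr_ge0 ltW|exact: mulrn_wge0].
  by rewrite -EFinB -EFinM lee_fin opprK.
rewrite -lX// => /(le_trans h); rewrite lee_fin => h2.
have {}h2 : s <= 4 * a.
  have := ler_wpM2l (ltW s0) h2; rewrite mulrA mulfV ?gt_eqF// mul1r; lra.
have -> : 16 * a ^+ 2 = (4 * a) ^+ 2 by ring.
by apply: lerXn2r => //; rewrite nnegrE; [exact: ltW|exact: mulr_ge0].
Qed.

End gaussian_variable.

(** * Small balls in Gaussian spaces *)

Section gaussian_space.
Context {d : measure_display} {T : measurableType d} {R : realType}.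
Variable P : probability T R.
Notation mu := (@lebesgue_measure R).
Notation ex := (ex P).
Notation ip := (ip P).
Implicit Types (X Y L U V W : T -> R) (us : seq (T -> R)) (c : seq R) (s a b : R).

Lemma measurable_cos_comp L : measurable_fun setT L ->
  measurable_fun setT (fun w => cos (L w)).
Proof.
move=> mL; apply: measurableT_comp => //.
by apply: continuous_measurable_fun; exact: continuous_cos.
Qed.

Lemma measurable_gauss_weight U a : measurable_fun setT U ->
  measurable_fun setT (fun w => expR (- (a ^+ 2 * U w ^+ 2 / 2))).
Proof.
move=> mU; apply: measurableT_comp => //; apply: measurableT_comp => //.
apply: measurable_funM => //; apply: measurable_funM => //.
exact: measurable_funX.
Qed.

Lemma gauss_weight_le1 U a w : expR (- (a ^+ 2 * U w ^+ 2 / 2)) <= 1.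
Proof. by rewrite -[leRHS]expR0 ler_expR oppr_le0 divr_ge0// mulr_ge0// sqr_ge0. Qed.

(* The weight [exp (- a^2 U^2 / 2)] is the characteristic function of a standard normal variable, evaluated at [a U]; Fubini exchanges it with the expectation. *)
Lemma ex_gauss_weight Y L U a : measurable_fun setT Y -> (forall w, `|Y w| <= 1) ->
  measurable_fun setT L -> measurable_fun setT U ->
  let G g := (ex (fun w => Y w * cos (L w + a * g * U w)) +
              ex (fun w => Y w * cos (L w - a * g * U w))) / 2 * normal_pdf 0 1 g in
  mu.-integrable setT (EFin \o G) /\
  ex (fun w => Y w * expR (- (a ^+ 2 * U w ^+ 2 / 2)) * cos (L w)) = \int[mu]_g G g.
Proof.
move=> mY bY mL mU G.
pose f (z : T * R) := Y z.1 * (cos (L z.1) * cos (a * z.2 * U z.1)) * normal_pdf 0 1 z.2.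
have mf : measurable_fun setT f.
  have m1 (g : T -> R) : measurable_fun setT g -> measurable_fun setT (fun z : T * R => g z.1).
    by move=> mg; apply: measurableT_comp => //; exact: measurable_fst.
  apply: measurable_funM; last first.
    apply: measurableT_comp; [exact: measurable_normal_pdf|exact: measurable_snd].
  apply: measurable_funM; first exact: m1.
  have mc : measurable_fun setT (cos : R -> R).
    by apply: continuous_measurable_fun; exact: continuous_cos.
  apply: measurable_funM.
    by apply: (m1 (fun w => cos (L w))); exact: measurable_cos_comp.
  apply: measurableT_comp => //; apply: measurable_funM; last exact: m1.
  by apply: measurable_funM => //; exact: measurable_snd.
have fb z : `|f z| <= normal_pdf 0 1 z.2.
  rewrite /f !normrM (ger0_norm (normal_pdf_ge0 _ _ _)).
  rewrite -[leRHS]mul1r ler_wpM2r ?normal_pdf_ge0//.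
  rewrite -[leRHS]mul1r ler_pM ?mulr_ge0//.
  by rewrite -[leRHS]mul1r ler_pM ?normr_cos_le1.
have if_ : (P \x mu)%E.-integrable setT (EFin \o f).
  apply/integrable12ltyP; first exact/measurable_EFinP.
  apply: (@le_lt_trans _ _ (\int[P]_x \int[mu]_y (normal_pdf 0 1 y)%:E)%E).
    apply: ge0_le_integral => //=.
    - by move=> x _; exact: integral_ge0.
    - apply: (@measurable_fun_fubini_tonelli_F _ _ _ _ _ mu (fun z => `|(f z)%:E|%E)) => //.
      by apply: measurableT_comp => //; exact/measurable_EFinP.
    - move=> x _; apply: ge0_le_integral => //=.
      + do 2 apply: measurableT_comp => //.
        exact: (measurableT_comp mf (measurable_pair1 x)).
      + by apply/measurable_EFinP; exact: measurable_normal_pdf.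
      + by move=> y _; rewrite lee_fin; exact: (fb (x, y)).
  rewrite integral_normal_pdf integral_cst//= mul1e.
  exact: le_lt_trans (probability_le1 P measurableT) (ltry _).
have FG g : (\int[P]_x (f (x, g))%:E = (G g)%:E)%E.
  rewrite /f /G /=.
  have iY (L' : T -> R) : measurable_fun setT L' ->
      P.-integrable setT (EFin \o (fun w => Y w * cos (L' w))).
    move=> mL'; apply: (@bounded_integrable _ _ _ P _ 1).
      by apply: measurable_funM => //; exact: measurable_cos_comp.
    by move=> w; rewrite normrM -[leRHS]mul1r ler_pM ?normr_cos_le1.
  have mgU : measurable_fun setT (fun w => a * g * U w) by exact: measurable_funM.
  have ip1 := iY _ (measurable_funD mL mgU).
  have im1 := iY _ (measurable_funB mL mgU).
  have -> : (\int[P]_x (Y x * (cos (L x) * cos (a * g * U x)) * normal_pdf 0 1 g)%:E =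
    \int[P]_x ((normal_pdf 0 1 g / 2)%:E * ((Y x * cos (L x + a * g * U x))%:E +
      (Y x * cos (L x - a * g * U x))%:E)))%E.
    apply: eq_integral => w _; by rewrite -EFinD -EFinM cosD cosB; congr EFin; field.
  rewrite integralZl//; last exact: integrableD.
  rewrite integralD//= /ex /Rintegral.
  rewrite -[X in (_ * (X + _))%E]fineK; last exact: integrable_fin_num.
  rewrite -[X in (_ * (_ + X))%E]fineK; last exact: integrable_fin_num.
  by rewrite -EFinD -EFinM; congr EFin; rewrite mulrC mulrA mulrAC.
split.
  apply: (@le_integrable _ _ _ mu _ _ _ (fun g => (normal_pdf 0 1 g)%:E)) => //.
  - have := measurable_fubini_G if_; congr (measurable_fun _ _).
    by apply/funext => g; rewrite /fubini_G/=; exact: FG.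
  - move=> g _; rewrite (_ : (EFin \o G) g = \int[P]_x (f (x, g))%:E)%E; last by rewrite FG.
    apply: (@le_trans _ _ (\int[P]_x `|(f (x, g))%:E|)%E).
      apply: le_abse_integral => //; apply/measurable_EFinP.
      exact: (measurableT_comp mf (measurable_pair2 g)).
    apply: (@le_trans _ _ (\int[P]_x (normal_pdf 0 1 g)%:E)%E).
      apply: ge0_le_integral => //=.
      + do 2 apply: measurableT_comp => //.
        exact: (measurableT_comp mf (measurable_pair2 g)).
      + by move=> x _; rewrite lee_fin; exact: (fb (x, g)).
    rewrite integral_cst// abse_EFin ger0_norm ?normal_pdf_ge0//.
    rewrite -[leRHS]mule1 lee_wpmul2l ?lee_fin ?normal_pdf_ge0//.
    exact: probability_le1.
  exact: integrable_normal_pdf.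
rewrite /ex /Rintegral; congr fine.
transitivity (\int[P]_x \int[mu]_y (f (x, y))%:E)%E.
  apply: eq_integral => w _.
  rewrite /f /=.
  under [RHS]eq_integral do rewrite mulrA -[_ * _ * normal_pdf _ _ _]mulrA EFinM.
  have ic := integrable_cos_normal_pdf (a * U w) (ltr01 : (0 : R) < 1).
  rewrite integralZl//; last first.
    by move: ic; apply: eq_integrable => // x _ /=; rewrite mulrAC.
  under eq_integral do rewrite mulrAC.
  have ncf := normal_cfE (a * U w) (ltr01 : (0 : R) < 1).
  rewrite /normal_cf /Rintegral expr1n mul1r exprMn in ncf.
  rewrite -[X in (_ * X)%E]fineK; last exact: integrable_fin_num.
  by rewrite ncf -EFinM mulrAC.
by rewrite (Fubini if_); apply: eq_integral => g _; exact: FG.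
Qed.

(** Joint Gaussianity without multivariate laws: a linear space each of whose members is a centered
    Gaussian variable. *)
Definition gaussian_space (H : set (T -> R)) :=
  [/\ (forall X Y, H X -> H Y -> H (fun w => X w + Y w)),
      (forall a X, H X -> H (fun w => a * X w)) &
      (forall X, H X -> centered_gaussian P X)].

Variable H : set (T -> R).
Hypothesis GH : gaussian_space H.
Hypothesis H0 : H (fun=> 0).

Let HD X Y : H X -> H Y -> H (fun w => X w + Y w). Proof. by case: GH => h _ _; exact: h. Qed.
Let HZ a X : H X -> H (fun w => a * X w). Proof. by case: GH => _ h _; exact: h. Qed.
Let HG X : H X -> centered_gaussian P X. Proof. by case: GH => _ _ h; exact: h. Qed.
Let HB X Y : H X -> H Y -> H (fun w => X w - Y w).
Proof.
move=> hX hY; have -> : (fun w => X w - Y w) = (fun w => X w + (-1) * Y w).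
  by apply/funext => w; rewrite mulN1r.
by apply: HD => //; exact: HZ.
Qed.
Let Hm X : H X -> measurable_fun setT X. Proof. by move=> /HG; exact: centered_gaussian_measurable. Qed.

Lemma gaussian_integrableM X Y : H X -> H Y -> P.-integrable setT (EFin \o (fun w => X w * Y w)).
Proof.
move=> hX hY.
apply: (@le_integrable _ _ _ P _ _ _ (EFin \o (fun w => X w ^+ 2 + Y w ^+ 2))) => //.
- by apply/measurable_EFinP; apply: measurable_funM; exact: Hm.
- move=> w _ /=; rewrite lee_fin [leRHS]ger0_norm ?addr_ge0 ?sqr_ge0//.
  rewrite normrM -[X w ^+ 2]real_normK ?num_real// -[Y w ^+ 2]real_normK ?num_real//.
  have := sqr_ge0 (`|X w| - `|Y w|); have := sqr_ge0 (`|X w|); have := sqr_ge0 (`|Y w|); nra.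
- have := integrableD measurableT (centered_gaussian_sqr (HG hX)) (centered_gaussian_sqr (HG hY)).
  by apply: eq_integrable.
Qed.

Lemma ipC X Y : ip X Y = ip Y X.
Proof. by rewrite /ip; congr ex; apply/funext => w; rewrite mulrC. Qed.

Lemma ipDl X Y W : H X -> H Y -> H W -> ip (fun w => X w + Y w) W = ip X W + ip Y W.
Proof.
move=> hX hY hW; rewrite /ip /ex -RintegralD//; try exact: gaussian_integrableM.
by apply: eq_Rintegral => w _; rewrite mulrDl.
Qed.

Lemma ipZl a X W : H X -> H W -> ip (fun w => a * X w) W = a * ip X W.
Proof.
move=> hX hW; rewrite /ip /ex -RintegralZl//; last exact: gaussian_integrableM.
by apply: eq_Rintegral => w _; rewrite mulrA.
Qed.

Lemma ipBl X Y W : H X -> H Y -> H W -> ip (fun w => X w - Y w) W = ip X W - ip Y W.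
Proof.
move=> hX hY hW; rewrite /ip /ex -RintegralB//; try exact: gaussian_integrableM.
by apply: eq_Rintegral => w _; rewrite mulrBl.
Qed.

Lemma ipDr X Y W : H X -> H Y -> H W -> ip W (fun w => X w + Y w) = ip W X + ip W Y.
Proof. by move=> *; rewrite ipC ipDl// !(ipC W). Qed.

Lemma ipZr a X W : H X -> H W -> ip W (fun w => a * X w) = a * ip W X.
Proof. by move=> *; rewrite ipC ipZl// !(ipC W). Qed.

Lemma ipBr X Y W : H X -> H Y -> H W -> ip W (fun w => X w - Y w) = ip W X - ip W Y.
Proof. by move=> *; rewrite ipC ipBl// !(ipC W). Qed.

Fixpoint lin c us : T -> R :=
  match c, us with
  | a :: c', u :: us' => fun w => a * u w + lin c' us' w
  | _, _ => fun=> 0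
  end.

Definition in_space us := forall i, (i < size us)%N -> H (nth (fun=> 0) us i).

Lemma in_space_cons u us : in_space (u :: us) <-> H u /\ in_space us.
Proof.
split=> [h|[hu hus] [|i]//]; last exact: hus.
by split=> [|i]; [exact: (h 0%N)|exact: (h i.+1)].
Qed.

Lemma lin_in_space c us : in_space us -> H (lin c us).
Proof.
elim: us c => [|u us IH] [|a c]//= /in_space_cons[hu hus].
by apply: HD; [exact: HZ|exact: IH].
Qed.

(** A smooth substitute for the indicator that all variables are at most 1/a in absolute value; on
    that event it is at least exp(-1/2) to the power [size us]. *)
Definition gauss_weight a us : T -> R :=
  foldr (fun u Y w => Y w * expR (- (a ^+ 2 * u w ^+ 2 / 2))) (fun=> 1) us.

Lemma gauss_weight_bound a us w : 0 < gauss_weight a us w <= 1.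
Proof.
elim: us => [|u us /= /andP[h1 h2]] /=; first by rewrite ltr01 lexx.
rewrite mulr_gt0 ?expR_gt0//= -[leRHS]mul1r; apply: ler_pM => //.
- exact: ltW.
- exact: gauss_weight_le1.
Qed.

Lemma normr_gauss_weight_le1 a us w : `|gauss_weight a us w| <= 1.
Proof. by have /andP[h1 h2] := gauss_weight_bound a us w; rewrite ger0_norm// ltW. Qed.

Lemma measurable_gauss_weights a us : in_space us -> measurable_fun setT (gauss_weight a us).
Proof.
elim: us => [|u us IH]//= /in_space_cons[hu hus].
by apply: measurable_funM; [exact: IH|apply: measurable_gauss_weight; exact: Hm].
Qed.

(** The mean of exp(-k g^2 / 2) for standard normal g, that is (1 + k)^(-1/2). Only the bound
    k^(-1/2) is extracted from it. *)
Definition gauss_factor (k : R) : R := \int[mu]_g (expR (- (k * g ^+ 2 / 2)) * normal_pdf 0 1 g).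

Lemma integrable_expR_normal_pdf (k l : R) : 0 <= k ->
  mu.-integrable setT (fun g => (expR (- (l + k * g ^+ 2) / 2) * normal_pdf 0 1 g)%:E).
Proof.
move=> k0.
have mE : measurable_fun setT (fun g : R => expR (- (l + k * g ^+ 2) / 2)).
  apply: measurableT_comp => //; apply: measurable_funM => //; apply: measurableT_comp => //.
  apply: measurable_funD => //; apply: measurable_funM => //; exact: measurable_funX.
apply: (@le_integrable _ _ _ mu _ _ _ (fun g => (expR (- l / 2))%:E * (normal_pdf 0 1 g)%:E)%E) => //.
- by apply/measurable_EFinP; apply: measurable_funM => //; exact: measurable_normal_pdf.
- move=> g _; rewrite -EFinM !abse_EFin lee_fin !normrM !(ger0_norm (expR_ge0 _)) ler_wpM2r//.
  by rewrite ler_expR; have := mulr_ge0 k0 (sqr_ge0 g); lra.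
- by apply: integrableZl => //; exact: integrable_normal_pdf.
Qed.

Lemma gauss_factorMl (k l : R) : 0 <= k ->
  \int[mu]_g (expR (- (l + k * g ^+ 2) / 2) * normal_pdf 0 1 g) = expR (- (l / 2)) * gauss_factor k.
Proof.
move=> k0; rewrite /gauss_factor -RintegralZl//.
  by apply: eq_Rintegral => g _; rewrite mulrA -expRD; congr (expR _ * _); field.
have := integrable_expR_normal_pdf 0 k0; apply: eq_integrable => // g _ /=.
by rewrite add0r mulNr.
Qed.

Lemma gauss_factor_ge0 (k : R) : 0 <= gauss_factor k.
Proof. by apply: Rintegral_ge0 => g _; rewrite mulr_ge0 ?expR_ge0 ?normal_pdf_ge0. Qed.

(** Replacing the standard density by its peak leaves, up to the factor 1/s, the density of standard
    deviation 1/s, which has mass 1. *)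
Lemma gauss_factor_le (s : R) : 0 < s -> gauss_factor (s ^+ 2) <= s^-1.
Proof.
move=> s0.
pose t := s^-1.
have t0 : 0 < t by rewrite invr_gt0.
have tn0 : t != 0 by rewrite gt_eqF.
have sn0 : s != 0 by rewrite gt_eqF.
have i1 := integrable_expR_normal_pdf 0 (sqr_ge0 s).
have i2 := integrable_normal_pdf (0 : R) t.
have -> : s^-1 = \int[mu]_g (t * normal_pdf 0 t g).
  rewrite RintegralZl//=.
  by rewrite /Rintegral integral_normal_pdf mulr1.
apply: le_Rintegral => //.
- by move: i1; apply: eq_integrable => // g _ /=; rewrite add0r mulNr.
- have := integrableZl measurableT t i2; by apply: eq_integrable => // g _ /=; rewrite EFinM.
move=> g _; rewrite (normal_pdf0E g tn0).
have -> : g ^+ 2 / (t ^+ 2 *+ 2) = s ^+ 2 * g ^+ 2 / 2 by rewrite /t; field.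
set e := expR _; have -> : t * (normal_peak t * e) = e * (t * normal_peak t) by ring.
rewrite ler_pM2l ?expR_gt0//.
have := normal_pdf_ub 0 g (oner_neq0 R) => /le_trans; apply.
rewrite /normal_peak expr1n mul1r /t exprVn -mulrnAr.
rewrite [in leRHS]sqrtrM ?invr_ge0 ?sqr_ge0// sqrtrV ?sqr_ge0// sqrtr_sqr ger0_norm; last exact: ltW.
by rewrite invfM invrK mulrA mulVf// mul1r.
Qed.

Lemma exB X Y : P.-integrable setT (EFin \o X) -> P.-integrable setT (EFin \o Y) ->
  ex (fun w => X w - Y w) = ex X - ex Y.
Proof. by move=> iX iY; rewrite /ex RintegralB. Qed.

Lemma exZ a X : P.-integrable setT (EFin \o X) -> ex (fun w => a * X w) = a * ex X.
Proof. by move=> iX; rewrite /ex RintegralZl. Qed.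

(** [L] and [l] are general for the sake of the induction. Eliminating the head [u] by
    [ex_gauss_weight] moves a multiple a g of [u] into [L], which raises the lower bound [l] on the
    variance by k a^2 g^2; averaging over g then produces one [gauss_factor]. With [L] and [l] zero
    this is the small ball estimate. *)
Lemma gauss_weight_cf_le us a k L l : 0 <= k -> in_space us -> H L ->
  (forall c, size c = size us ->
    k * (\sum_(x <- c) x ^+ 2) + l <= ip (fun w => lin c us w + L w) (fun w => lin c us w + L w)) ->
  ex (fun w => gauss_weight a us w * cos (L w)) <=
    gauss_factor (k * a ^+ 2) ^+ size us * expR (- (l / 2)).
Proof.
move=> k0; elim: us L l => [|u us IH] L l.
  move=> _ hL /(_ [::] erefl); rewrite big_nil mulr0 add0r /=.
  have -> : (fun w => 0 + L w) = L by apply/funext => w; rewrite add0r.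
  move=> h; rewrite expr0 mul1r.
  rewrite (_ : (fun w => 1 * cos (L w)) = (fun w => cos (L w))); last first.
    by apply/funext => w; rewrite mul1r.
  by rewrite (centered_gaussian_cf (HG hL)) ler_expR; lra.
move=> /in_space_cons[hu hus] hL h /=.
have [iG ->] := ex_gauss_weight a (measurable_gauss_weights a hus)
  (normr_gauss_weight_le1 a us) (Hm hL) (Hm hu).
have ka : 0 <= k * a ^+ 2 by rewrite mulr_ge0// sqr_ge0.
set K := gauss_factor _; set n := size us.
rewrite exprS -mulrA mulrCA mulrA -mulrA (mulrC K) -(gauss_factorMl l ka) -RintegralZl//; last exact: integrable_expR_normal_pdf.
have bnd (g : R) : ex (fun w => gauss_weight a us w * cos (L w + g * u w)) <=
    K ^+ n * expR (- ((l + k * g ^+ 2) / 2)).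
  apply: (IH (fun w => L w + g * u w)) => //.
    by apply: HD => //; exact: HZ.
  move=> c sc; have := h (g :: c); rewrite /= sc => /(_ erefl).
  rewrite big_cons.
  rewrite (_ : (fun w => g * u w + lin c us w + L w) = (fun w => lin c us w + (L w + g * u w))); last first.
    by apply/funext => w; ring.
  by apply: le_trans; rewrite le_eqVlt; apply/orP; left; apply/eqP; ring.
apply: le_Rintegral => //.
  have := integrableZl measurableT (K ^+ n) (integrable_expR_normal_pdf l ka).
  by apply: eq_integrable => // g _ /=; rewrite EFinM.
move=> g _; rewrite mulrA ler_wpM2r ?normal_pdf_ge0//.
have := bnd (a * g); have := bnd (- (a * g)).
rewrite (_ : - (l + k * a ^+ 2 * g ^+ 2) / 2 = - ((l + k * (a * g) ^+ 2) / 2)); last by field.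
rewrite sqrrN.
rewrite (_ : (fun w => gauss_weight a us w * cos (L w + - (a * g) * u w)) =
  (fun w => gauss_weight a us w * cos (L w - a * g * u w))); last first.
  by apply/funext => w; rewrite mulNr.
by set x := ex _; set y := ex _; lra.
Qed.

(** Independence at the level of characteristic functions. Each elimination adds to [L] a multiple
    of a member of [us], so orthogonality to [V] persists, and at the end the variance of [L + t V]
    splits by Pythagoras. *)
Lemma gauss_weight_cf_orth us a V (t : R) L : in_space us -> H V -> H L ->
  (forall i, (i < size us)%N -> ip (nth (fun=> 0) us i) V = 0) -> ip L V = 0 ->
  ex (fun w => gauss_weight a us w * cos (L w + t * V w)) =
  expR (- (t ^+ 2 * ip V V / 2)) * ex (fun w => gauss_weight a us w * cos (L w)).
Proof.
move=> + hV; elim: us L => [|u us IH] L.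
  move=> _ hL _ LV /=.
  rewrite (_ : (fun w => 1 * cos (L w)) = (fun w => cos (L w))); last first.
    by apply/funext => w; rewrite mul1r.
  rewrite (_ : (fun w => 1 * _) = (fun w => cos (L w + t * V w))); last first.
    by apply/funext => w; rewrite mul1r.
  have htV := HZ t hV; have hLV := HD hL htV.
  rewrite (centered_gaussian_cf (HG hLV)) (centered_gaussian_cf (HG hL)) -expRD.
  congr expR; rewrite ipDl// !ipDr// !(ipZl, ipZr)// LV (ipC V L) LV.
  by rewrite !mulr0 addr0 add0r; field.
move=> /in_space_cons[hu hus] hL uV LV /=.
have htV := HZ t hV; have hLV := HD hL htV.
have mw := measurable_gauss_weights a hus.
have [iG1 ->] := ex_gauss_weight a mw (normr_gauss_weight_le1 a us) (Hm hLV) (Hm hu).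
have [iG2 ->] := ex_gauss_weight a mw (normr_gauss_weight_le1 a us) (Hm hL) (Hm hu).
rewrite -RintegralZl//; apply: eq_Rintegral => g _.
have step (g' : R) : ex (fun w => gauss_weight a us w * cos (L w + t * V w + g' * u w)) =
    expR (- (t ^+ 2 * ip V V / 2)) * ex (fun w => gauss_weight a us w * cos (L w + g' * u w)).
  have hgu := HZ g' hu.
  rewrite -IH//.
  - by congr ex; apply/funext => w; rewrite addrAC.
  - exact: HD.
  - by move=> i; exact: (uV i.+1).
  - by rewrite ipDl// ipZl// LV (uV 0%N)// mulr0 addr0.
have sN (L' : T -> R) : (fun w => gauss_weight a us w * cos (L' w - a * g * u w)) =
    (fun w => gauss_weight a us w * cos (L' w + - (a * g) * u w)).
  by apply/funext => w; rewrite mulNr.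
have sN2 := sN (fun w => L w + t * V w); cbv beta in sN2.
by rewrite sN2 (sN L) !step; ring.
Qed.

Lemma gauss_weight_indep us a b V : in_space us -> H V ->
  (forall i, (i < size us)%N -> ip (nth (fun=> 0) us i) V = 0) ->
  ex (fun w => gauss_weight a us w * expR (- (b ^+ 2 * V w ^+ 2 / 2))) =
  ex (gauss_weight a us) * gauss_factor (b ^+ 2 * ip V V).
Proof.
move=> hus hV oV.
have [iG] := ex_gauss_weight b (measurable_gauss_weights a hus)
  (normr_gauss_weight_le1 a us) (Hm H0) (Hm hV).
rewrite (_ : (fun w => _ * cos 0) =
  (fun w => gauss_weight a us w * expR (- (b ^+ 2 * V w ^+ 2 / 2)))); last first.
  by apply/funext => w; rewrite cos0 mulr1.
move=> ->.
have ip0 : ip (fun=> 0) V = 0.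
  by rewrite (_ : (fun=> 0) = (fun w => 0 * V w)) ?ipZl ?mul0r//; apply/funext => w; rewrite mul0r.
have step (t : R) : ex (fun w => gauss_weight a us w * cos (0 + t * V w)) =
    expR (- (t ^+ 2 * ip V V / 2)) * ex (gauss_weight a us).
  rewrite gauss_weight_cf_orth//; congr (_ * _).
  by congr ex; apply/funext => w; rewrite cos0 mulr1.
rewrite /gauss_factor mulrC -RintegralZr; last 2 first.
- exact: measurableT.
- have /= := integrable_expR_normal_pdf 0 (mulr_ge0 (sqr_ge0 b) (ipXX_ge0 P V)).
  by apply: eq_integrable => // g _ /=; rewrite add0r mulNr.
apply: eq_Rintegral => g _.
rewrite (_ : (fun w => gauss_weight a us w * cos (0 - b * g * V w)) =
  (fun w => gauss_weight a us w * cos (0 + - (b * g) * V w))); last first.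
  by apply/funext => w; rewrite mulNr.
rewrite !step sqrrN exprMn.
rewrite (_ : b ^+ 2 * g ^+ 2 * ip V V / 2 = b ^+ 2 * ip V V * g ^+ 2 / 2); last by field.
by field.
Qed.

(** The factor (1 - X)^q will dominate the indicator that |V| is large. Powers of [X] are again
    Gaussian weights, to which [gauss_weight_indep] applies; powers of [1 - X] follow by linearity
    from X^j (1 - X)^(q+1) = X^j (1 - X)^q - X^(j+1) (1 - X)^q. *)
Lemma gauss_weight_indep_poly us a b V q j : in_space us -> H V ->
  (forall i, (i < size us)%N -> ip (nth (fun=> 0) us i) V = 0) ->
  let X w := expR (- (b ^+ 2 * V w ^+ 2 / 2)) in
  ex (fun w => gauss_weight a us w * (X w ^+ j * (1 - X w) ^+ q)) =
  ex (gauss_weight a us) * ex (fun w => X w ^+ j * (1 - X w) ^+ q).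
Proof.
move=> hus hV oV X.
have X01 w : 0 <= X w <= 1 by rewrite expR_ge0 gauss_weight_le1.
have mX : measurable_fun setT X by apply: measurable_gauss_weight; exact: Hm.
have mw := measurable_gauss_weights a hus.
have bX j' q' w : `|X w ^+ j' * (1 - X w) ^+ q'| <= 1.
  have /andP[X0 X1] := X01 w.
  rewrite normrM !normrX -[leRHS]mul1r ler_pM ?exprn_ge0// exprn_ile1//.
    by rewrite ger0_norm.
  by rewrite ger0_norm; lra.
have mX' j' q' : measurable_fun setT (fun w => X w ^+ j' * (1 - X w) ^+ q').
  apply: measurable_funM; apply: measurable_funX => //.
  exact: measurable_funB.
have i1 j' q' : P.-integrable setT (EFin \o (fun w => X w ^+ j' * (1 - X w) ^+ q')).
  exact: (@bounded_integrable _ _ _ P _ 1).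
have i2 j' q' : P.-integrable setT
    (EFin \o (fun w => gauss_weight a us w * (X w ^+ j' * (1 - X w) ^+ q'))).
  apply: (@bounded_integrable _ _ _ P _ 1); first exact: measurable_funM.
  by move=> w; rewrite normrM -[leRHS]mul1r ler_pM ?normr_gauss_weight_le1.
elim: q j => [|q IH] j.
  have Xj w : X w ^+ j * (1 - X w) ^+ 0 = expR (- ((Num.sqrt j%:R * b) ^+ 2 * V w ^+ 2 / 2)).
    rewrite expr0 mulr1 /X -expRM_natl exprMn sqr_sqrtr//; congr expR.
    by field.
  have H1 (Z : T -> R) : (fun w => Z w * (X w ^+ j * (1 - X w) ^+ 0)) =
      (fun w => Z w * expR (- ((Num.sqrt j%:R * b) ^+ 2 * V w ^+ 2 / 2))).
    by apply/funext => w; rewrite Xj.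
  rewrite H1 gauss_weight_indep//; congr (_ * _).
  have /= := @gauss_weight_indep [::] a (Num.sqrt j%:R * b) V.
  rewrite (_ : ex (fun=> 1) = 1); last first.
    rewrite /ex /Rintegral integral_cst//= mul1e -[RHS]/(fine 1%E); congr fine.
    exact: probability_setT.
  rewrite mul1r => <-//.
  by congr ex; apply/funext => w; rewrite mul1r Xj.
rewrite (_ : (fun w => X w ^+ j * (1 - X w) ^+ q.+1) =
  (fun w => X w ^+ j * (1 - X w) ^+ q - X w ^+ j.+1 * (1 - X w) ^+ q)); last first.
  by apply/funext => w; rewrite !exprS; ring.
rewrite exB// mulrBr -!IH -exB//.
by congr ex; apply/funext => w; rewrite !exprS; ring.
Qed.

Lemma ex_le X Y : P.-integrable setT (EFin \o X) -> P.-integrable setT (EFin \o Y) ->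
  (forall w, X w <= Y w) -> ex X <= ex Y.
Proof. by move=> iX iY XY; apply: le_Rintegral. Qed.

Lemma prob_le_ex (E : set T) X : measurable E -> P.-integrable setT (EFin \o X) ->
  (forall w, 0 <= X w) -> (forall w, E w -> 1 <= X w) -> (P E <= (ex X)%:E)%E.
Proof.
move=> mE iX X0 X1.
rewrite /ex /Rintegral fineK; last exact: integrable_fin_num.
rewrite -[E]setIT -integral_indic//.
apply: ge0_le_integral => //=.
- by apply/measurable_EFinP; exact: measurable_indic.
- exact: measurable_int iX.
- move=> w _; rewrite lee_fin indicE; case: (boolP (w \in E)) => [|_].
    by rewrite inE; exact: X1.
  exact: X0.
Qed.

(** The Gram matrix of [us] has all its eigenvalues at least [k]. *)
Definition nondegenerate (k : R) us := forall c, size c = size us ->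
  k * (\sum_(x <- c) x ^+ 2) <= ip (lin c us) (lin c us).

Definition small_all (e : R) us w := all (fun u : T -> R => `|u w| <= e) us.

Lemma measurable_le_set X (f : T -> R) : measurable_fun setT X -> measurable_fun setT f ->
  measurable [set w | `|X w| <= f w].
Proof.
move=> mX mf; rewrite (_ : [set w | _] = setT `&` (fun w => f w - `|X w|) @^-1` `[0, +oo[%classic).
  have mn : measurable_fun setT (fun w => f w - `|X w|).
    by apply: measurable_funB => //; exact: measurableT_comp.
  exact: mn.
by rewrite setTI; apply/seteqP; split => w /=; rewrite in_itv/= andbT subr_ge0.
Qed.

Lemma measurable_ge_set X e : measurable_fun setT X -> measurable [set w | e <= `|X w|].
Proof.
move=> mX; rewrite (_ : [set w | _] = setT `&` (fun w => `|X w|) @^-1` `[e, +oo[%classic).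
  have mn : measurable_fun setT (fun w => `|X w|) by exact: measurableT_comp.
  exact: mn.
by rewrite setTI; apply/seteqP; split => w /=; rewrite in_itv/= andbT.
Qed.

Lemma measurable_small_all (f : T -> R) us : measurable_fun setT f -> in_space us ->
  measurable [set w | small_all (f w) us w].
Proof.
move=> mf; elim: us => [|u us IH].
  by move=> _; rewrite (_ : [set w | _] = setT)//; apply/seteqP; split.
move=> /in_space_cons[hu hus].
rewrite (_ : [set w | _] = [set w | `|u w| <= f w] `&` [set w | small_all (f w) us w]).
  by apply: measurableI; [apply: measurable_le_set => //; exact: Hm|exact: IH].
by apply/seteqP; split => w /=; rewrite /small_all/=; [move=> /andP|move=> [-> ->]].
Qed.

Lemma gauss_weight_small_all e us w : 0 < e -> small_all e us w ->
  expR (- 2^-1) ^+ size us <= gauss_weight e^-1 us w.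
Proof.
move=> e0; elim: us => [|u us IH]//= /andP[hu hus].
rewrite exprS mulrC; apply: ler_pM; rewrite ?exprn_ge0 ?expR_ge0//; first exact: IH.
rewrite ler_expR lerN2 -[leRHS]mul1r ler_wpM2r// exprVn ler_pdivrMl ?exprn_gt0// mulr1.
rewrite -[leLHS]real_normK ?num_real//.
by apply: lerXn2r => //; rewrite nnegrE ?ltW.
Qed.

Lemma ex_gauss_weight_le us (k e : R) : 0 < k -> 0 < e -> in_space us -> nondegenerate k us ->
  ex (gauss_weight e^-1 us) <= (e / Num.sqrt k) ^+ size us.
Proof.
move=> k0 e0 hus nd.
have := @gauss_weight_cf_le us e^-1 k (fun=> 0) 0 (ltW k0) hus H0.
rewrite mul0r oppr0 expR0 mulr1 => h.
have {h} h : ex (gauss_weight e^-1 us) <= gauss_factor (k * e^-1 ^+ 2) ^+ size us.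
  have -> : gauss_weight e^-1 us = (fun w => gauss_weight e^-1 us w * cos 0).
    by apply/funext => w; rewrite cos0 mulr1.
  apply: h => c sc; rewrite addr0.
  rewrite (_ : (fun w => lin c us w + 0) = lin c us); first exact: nd.
  by apply/funext => w; rewrite addr0.
apply: le_trans h _; apply: lerXn2r; rewrite ?nnegrE ?gauss_factor_ge0//.
  by rewrite divr_ge0 ?sqrtr_ge0// ltW.
rewrite -[k in gauss_factor (k * _)]sqr_sqrtr; last exact: ltW.
rewrite -exprMn.
apply: le_trans (gauss_factor_le _) _; first by rewrite mulr_gt0 ?invr_gt0 ?sqrtr_gt0.
by rewrite invfM invrK mulrC.
Qed.

(** The inverse of the least value of 1 - exp(-V^2 / (2 K^2)) on the event |V| >= K. *)
Definition tail_cst : R := (1 - expR (- 2^-1))^-1.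

Lemma tail_cst_gt0 : 0 < tail_cst.
Proof. by rewrite invr_gt0 subr_gt0 -[ltRHS]expR0 ltr_expR oppr_lt0 invr_gt0. Qed.

(** The indicator is dominated by a constant times the weight of [us] times (1 - X)^q. The
    expectation of the product factors by independence; the first factor is the small ball bound,
    and 1 - X <= V^2 / (2 K^2) turns the second into a moment of order 2q. *)
Lemma prob_small_all_tail us (k e K : R) V q : 0 < k -> 0 < e -> 0 < K ->
  in_space us -> nondegenerate k us -> H V ->
  (forall i, (i < size us)%N -> ip (nth (fun=> 0) us i) V = 0) ->
  (P ([set w | small_all e us w] `&` [set w | (K <= `|V w|)%R]) <=
   ((expR 2^-1 * (e / Num.sqrt k)) ^+ size us *
     (tail_cst ^+ q * (moment_cst q * (ip V V / (K ^+ 2 * 2)) ^+ q)))%:E)%E.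
Proof.
move=> k0 e0 K0 hus nd hV oV.
pose X w := expR (- (K^-1 ^+ 2 * V w ^+ 2 / 2)).
pose g := gauss_weight e^-1 us.
have X01 w : 0 <= X w <= 1 by rewrite expR_ge0 gauss_weight_le1.
have mX : measurable_fun setT X by apply: measurable_gauss_weight; exact: Hm.
have mw : measurable_fun setT g by exact: measurable_gauss_weights.
have c0 := tail_cst_gt0.
have bX w : `|(1 - X w) ^+ q| <= 1.
  have /andP[X0 X1] := X01 w.
  rewrite normrX exprn_ile1// ger0_norm; lra.
have mXq : measurable_fun setT (fun w => (1 - X w) ^+ q).
  by apply: measurable_funX; exact: measurable_funB.
have iXq : P.-integrable setT (EFin \o (fun w => (1 - X w) ^+ q)).
  exact: (@bounded_integrable _ _ _ P _ 1).
have igXq : P.-integrable setT (EFin \o (fun w => g w * (1 - X w) ^+ q)).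
  apply: (@bounded_integrable _ _ _ P _ 1); first exact: measurable_funM.
  by move=> w; rewrite normrM -[leRHS]mul1r ler_pM ?normr_gauss_weight_le1.
pose c := expR 2^-1 ^+ size us * tail_cst ^+ q.
have cp : 0 <= c by rewrite mulr_ge0 ?exprn_ge0 ?expR_ge0// ltW.
have gX0 w : 0 <= g w * (1 - X w) ^+ q.
  have /andP[X0 X1] := X01 w; have /andP[/ltW g0 _] := gauss_weight_bound e^-1 us w.
  by rewrite mulr_ge0// exprn_ge0// subr_ge0.
apply: (@le_trans _ _ (ex (fun w => c * (g w * (1 - X w) ^+ q)))%:E).
  apply: prob_le_ex.
  - apply: measurableI; first exact: measurable_small_all.
    by apply: measurable_ge_set; exact: Hm.
  - have := integrableZl measurableT c igXq.
    by apply: eq_integrable => // w _ /=; rewrite EFinM.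
  - by move=> w; rewrite mulr_ge0.
  - move=> w [/= sw Kw].
    have h1 := gauss_weight_small_all e0 sw.
    have h2 : tail_cst^-1 <= 1 - X w.
      rewrite /tail_cst invrK lerB// /X ler_expR lerN2 -[leLHS]mul1r ler_wpM2r//.
      rewrite exprVn ler_pdivlMl ?exprn_gt0// mulr1 -[leRHS]real_normK ?num_real//.
      by apply: lerXn2r => //; rewrite nnegrE ?ltW.
    have h3 : 1 <= expR 2^-1 ^+ size us * g w.
      apply: le_trans (_ : expR 2^-1 ^+ size us * expR (- 2^-1) ^+ size us <= _).
        by rewrite -exprMn -expRD subrr expR0 expr1n.
      by rewrite ler_wpM2l// exprn_ge0// expR_ge0.
    have h4 : 1 <= tail_cst ^+ q * (1 - X w) ^+ q.
      rewrite -exprMn exprn_ege1//.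
      by rewrite mulrC -ler_pdivrMr// mul1r.
    rewrite /c (_ : _ * _ * _ = (expR 2^-1 ^+ size us * g w) * (tail_cst ^+ q * (1 - X w) ^+ q)); last by ring.
    by rewrite -[leLHS]mulr1 ler_pM.
rewrite lee_fin exZ//.
have -> : ex (fun w => g w * (1 - X w) ^+ q) = ex g * ex (fun w => (1 - X w) ^+ q).
  have := @gauss_weight_indep_poly us e^-1 K^-1 V q 0 hus hV oV.
  rewrite (_ : (fun w => g w * _) = (fun w => g w * (X w ^+ 0 * (1 - X w) ^+ q))).
    move=> ->; congr (_ * ex _).
    by apply/funext => w; rewrite expr0 mul1r.
  by apply/funext => w; rewrite expr0 mul1r.
rewrite /c exprMn -[leLHS]mulrA -[leRHS]mulrA; apply: ler_wpM2l; first by rewrite exprn_ge0 ?expR_ge0.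
rewrite mulrCA; apply: ler_pM => //.
- by apply: Rintegral_ge0 => w _; have /andP[/ltW] := gauss_weight_bound e^-1 us w.
- apply: mulr_ge0; first by rewrite exprn_ge0// ltW.
  apply: Rintegral_ge0 => w _.
  by have /andP[X0 X1] := X01 w; rewrite exprn_ge0// subr_ge0.
- exact: ex_gauss_weight_le.
apply: ler_wpM2l; first by rewrite exprn_ge0// ltW.
pose b := K^-1 ^+ 2 / 2.
have b0 : 0 <= b by rewrite divr_ge0// sqr_ge0.
have im := centered_gaussian_moment_lt q (HG hV).
apply: (@le_trans _ _ (ex (fun w => b ^+ q * (V w ^+ 2) ^+ q))).
  apply: ex_le => //.
    have := integrableZl measurableT (b ^+ q) im.
    by apply: eq_integrable => // w _ /=; rewrite EFinM.
  move=> w; have /andP[X0 X1] := X01 w; rewrite -exprMn.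
  apply: lerXn2r; rewrite ?nnegrE ?subr_ge0//.
    by rewrite mulr_ge0// sqr_ge0.
  have := expR_ge1Dx (- (K^-1 ^+ 2 * V w ^+ 2 / 2)); rewrite -/(X w) /b; lra.
rewrite exZ// (_ : ip V V / (K ^+ 2 * 2) = b * ip V V); last first.
  by rewrite /b; field; rewrite gt_eqF.
rewrite [(b * ip V V) ^+ q]exprMn mulrCA; apply: ler_wpM2l; first by rewrite exprn_ge0.
exact: centered_gaussian_moment_le (HG hV).
Qed.

Lemma prob_small_all us (k e : R) : 0 < k -> 0 < e ->
  in_space us -> nondegenerate k us ->
  (P [set w | small_all e us w] <= ((expR 2^-1 * (e / Num.sqrt k)) ^+ size us)%:E)%E.
Proof.
move=> k0 e0 hus nd; pose g := gauss_weight e^-1 us.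
have mw : measurable_fun setT g by exact: measurable_gauss_weights.
have ig : P.-integrable setT (EFin \o g).
  by apply: (@bounded_integrable _ _ _ P _ 1) => // w; exact: normr_gauss_weight_le1.
apply: (@le_trans _ _ (ex (fun w => expR 2^-1 ^+ size us * g w))%:E).
  apply: prob_le_ex.
  - exact: measurable_small_all.
  - have := integrableZl measurableT (expR 2^-1 ^+ size us) ig.
    by apply: eq_integrable => // w _ /=; rewrite EFinM.
  - move=> w; have /andP[/ltW g0 _] := gauss_weight_bound e^-1 us w.
    by rewrite mulr_ge0// exprn_ge0// expR_ge0.
  - move=> w /= sw; apply: le_trans (_ : expR 2^-1 ^+ size us * expR (- 2^-1) ^+ size us <= _).
      by rewrite -exprMn -expRD subrr expR0 expr1n.
    rewrite ler_wpM2l ?exprn_ge0 ?expR_ge0//; exact: gauss_weight_small_all.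
rewrite lee_fin exZ// exprMn ler_wpM2l ?exprn_ge0 ?expR_ge0//.
exact: ex_gauss_weight_le.
Qed.

Lemma small_all_le (e e' : R) us w : e <= e' -> small_all e us w -> small_all e' us w.
Proof. by move=> ee; elim: us => //= u us IH /andP[h /IH ->]; rewrite (le_trans h ee). Qed.

(** Here [n] counts the constraints and also fixes the order of the moment, and [v] bounds the
    variance of the independent variable. The summand 1 comes from |V| < 1, the other from the
    dyadic levels; its last factor 2 is the sum of the geometric series of ratio 1/2. *)
Definition ball_cst (n : nat) (k v : R) : R :=
  (expR 2^-1 / Num.sqrt k) ^+ n *
  (1 + 2 ^+ n * (tail_cst ^+ n * (moment_cst n * (v / 2) ^+ n)) * 2).

Lemma moment_cst_ge0 n : (0 : R) <= moment_cst n.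
Proof. by rewrite /moment_cst !mulr_ge0// ?sqrtr_ge0// exprn_ge0. Qed.

(* Dyadic decomposition according to the size of the independent variable [V]. *)
Lemma prob_small_all_max us (k e v : R) V : 0 < k -> 0 < e -> (0 < size us)%N ->
  in_space us -> nondegenerate k us -> H V ->
  (forall i, (i < size us)%N -> ip (nth (fun=> 0) us i) V = 0) -> ip V V <= v ->
  (P [set w | small_all (e * Num.max 1 `|V w|)%R us w] <=
   (ball_cst (size us) k v * e ^+ size us)%:E)%E.
Proof.
move=> k0 e0; set n := size us => n0 hus nd hV oV Vv.
pose A := expR 2^-1 / Num.sqrt k.
have A0 : 0 <= A by rewrite divr_ge0 ?expR_ge0 ?sqrtr_ge0.
pose D := tail_cst ^+ n * (moment_cst n * (v / 2) ^+ n).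
have v0 : 0 <= v by apply: le_trans Vv; exact: ipXX_ge0.
have D0 : 0 <= D.
  by rewrite mulr_ge0 ?exprn_ge0 ?(ltW tail_cst_gt0)// mulr_ge0 ?moment_cst_ge0// exprn_ge0// divr_ge0.
have mmax : measurable_fun setT (fun w => e * Num.max 1 `|V w|).
  apply: measurable_funM => //; apply: measurable_maxr => //.
  by apply: measurableT_comp => //; exact: Hm.
pose B j := [set w | small_all (e * Num.max 1 `|V w|) us w] `&` ~` [set w | 2 ^+ j <= `|V w|].
have mB j : measurable (B j).
  apply: measurableI; first exact: measurable_small_all.
  by apply: measurableC; apply: measurable_ge_set; exact: Hm.
have PB j : (P (B j) <= ((A * e) ^+ n * (1 + 2 ^+ n * D * (2 - 2 * 2^-1 ^+ j)))%:E)%E.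
  elim: j => [|j IH].
    rewrite expr0 mulr1 subrr mulr0 addr0 mulr1.
    have := prob_small_all k0 e0 hus nd.
    rewrite -/n (_ : expR 2^-1 * (e / Num.sqrt k) = A * e); last by rewrite /A mulrA mulrAC.
    apply: le_trans; apply: le_measure; rewrite ?inE//; first exact: measurable_small_all.
    move=> w [/= sw] /negP; rewrite expr0 -ltNge => Vw.
    by move: sw; rewrite max_l ?mulr1// ltW.
  pose C := [set w | small_all (e * 2 ^+ j.+1) us w] `&` [set w | 2 ^+ j <= `|V w|].
  have mC : measurable C.
    apply: measurableI; first exact: measurable_small_all.
    by apply: measurable_ge_set; exact: Hm.
  have BC : B j.+1 `<=` B j `|` C.
    move=> w [/= sw] /negP; rewrite -ltNge => Vw.
    have [Vj|Vj] := leP (2 ^+ j) `|V w|; last first.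
      by left; split => //; apply/negP; rewrite -ltNge.
    right; split => //=; apply: small_all_le sw; rewrite ler_pM2l// ge_max (ltW Vw) andbT.
    by rewrite exprn_ege1// ler1n.
  have e1 : 0 < e * 2 ^+ j.+1 by rewrite mulr_gt0// exprn_gt0.
  have j0 : 0 < (2 : R) ^+ j by rewrite exprn_gt0.
  (* With the moment of order 2n, level j costs 2^((j+1) n) through its radius and gains 4^(-j n)
     through its tail. The net factor 2^n 2^(-j n) is at most 2^n 2^(-j) as [n] is positive, so the
     levels are summable. *)
  have PC := prob_small_all_tail n k0 e1 j0 hus nd hV oV.
  apply: (@le_trans _ _ (P (B j `|` C))).
    by apply: le_measure; rewrite ?inE//; exact: measurableU.
  apply: (@le_trans _ _ (P (B j) + P C)%E).
    by apply: measureU2.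
  apply: le_trans (leeD IH PC) _.
  rewrite -EFinD lee_fin -/n.
  have -> : (A * e) ^+ n * (1 + 2 ^+ n * D * (2 - 2 * 2^-1 ^+ j.+1)) =
    (A * e) ^+ n * (1 + 2 ^+ n * D * (2 - 2 * 2^-1 ^+ j)) + (A * e) ^+ n * (2 ^+ n * D * 2^-1 ^+ j).
    by rewrite exprS; field.
  rewrite lerD2l.
  rewrite (_ : expR 2^-1 * (e * 2 ^+ j.+1 / Num.sqrt k) = (A * e) * (2 * 2 ^+ j)); last first.
    by rewrite exprS /A; ring.
  rewrite exprMn -[leLHS]mulrA; apply: ler_wpM2l.
    by rewrite exprn_ge0// mulr_ge0// ltW.
  apply: (@le_trans _ _ ((2 * 2 ^+ j) ^+ n * (tail_cst ^+ n * (moment_cst n * (v / 2 * (2^-1 ^+ j) ^+ 2) ^+ n)))).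
    apply: ler_wpM2l; first by rewrite exprn_ge0// mulr_ge0// ltW.
    apply: ler_wpM2l; first by rewrite exprn_ge0// ltW// tail_cst_gt0.
    apply: ler_wpM2l; first exact: moment_cst_ge0.
    have h1 : 0 <= ip V V / ((2 ^+ j) ^+ 2 * 2).
      by rewrite divr_ge0 ?ipXX_ge0// mulr_ge0// sqr_ge0.
    have h2 : ip V V / ((2 ^+ j) ^+ 2 * 2) <= v / 2 * (2^-1 ^+ j) ^+ 2.
      rewrite invfM mulrCA mulrC exprVn exprVn; apply: ler_wpM2r.
        by rewrite invr_ge0 sqr_ge0.
      by rewrite ler_wpM2r.
    by apply: lerXn2r => //; rewrite nnegrE; exact: le_trans h2.
  have -> : (2 * 2 ^+ j) ^+ n * (tail_cst ^+ n * (moment_cst n * (v / 2 * (2^-1 ^+ j) ^+ 2) ^+ n)) =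
      2 ^+ n * D * (2 ^+ j * 2^-1 ^+ j * 2^-1 ^+ j) ^+ n.
    by rewrite /D !exprMn; ring.
  have -> : (2 : R) ^+ j * 2^-1 ^+ j * 2^-1 ^+ j = 2^-1 ^+ j.
    by rewrite -exprMn mulfV// expr1n mul1r.
  apply: ler_wpM2l; first by rewrite mulr_ge0// exprn_ge0.
  have h1 : 0 <= (2^-1 : R) ^+ j <= 1.
    by apply/andP; split; [apply: exprn_ge0; lra|apply: exprn_ile1; lra].
  have /andP[h10 h11] := h1.
  by rewrite -{2}[2^-1 ^+ j]expr1; apply: ler_wiXn2l.
have -> : [set w | small_all (e * Num.max 1 `|V w|) us w] = \bigcup_j B j.
  apply/seteqP; split => [w /= sw|w [j _ []]//].
  exists (Num.bound `|V w|) => //; split => //=; apply/negP; rewrite -ltNge.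
  apply: lt_le_trans (_ : (Num.bound `|V w|)%:R <= _).
    by have := archi_boundP (normr_ge0 (V w)).
  by rewrite -natrX ler_nat ltnW// ltn_expl.
have ndB : nondecreasing_seq B.
  move=> i j ij; apply/subsetPset => w [sw] /negP; rewrite -ltNge => Vw.
  split => //=; apply/negP; rewrite -ltNge; apply: lt_le_trans Vw _.
  by apply: ler_weXn2l => //; rewrite ler1n.
have cv : (P \o B) @ \oo --> P (\bigcup_j B j).
  by apply: nondecreasing_cvg_mu => //; exact: bigcup_measurable.
rewrite -(cvg_lim _ cv)//.
apply: lime_le; first by apply/cvg_ex; eexists; exact: cv.
near=> j; apply: le_trans (PB j) _; rewrite lee_fin.
rewrite /ball_cst -/n -/A -/D exprMn mulrAC; apply: ler_wpM2r; first by rewrite exprn_ge0// ltW.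
apply: ler_wpM2l; first by rewrite exprn_ge0.
rewrite lerD2l; apply: ler_wpM2l; first by rewrite mulr_ge0// exprn_ge0.
by rewrite lerBlDr lerDl mulr_ge0// exprn_ge0// invr_ge0.
Unshelve. all: end_near. Qed.

Lemma lin_comb us a b c c' : size c = size us -> size c' = size us ->
  exists2 c2, size c2 = size us &
    lin c2 us = (fun w => a * lin c us w + b * lin c' us w).
Proof.
elim: us c c' => [|u us IH] [|x c] [|y c']//=.
  by move=> _ _; exists [::] => //; apply/funext => w; rewrite !mulr0 addr0.
move=> [sc] [sc']; have [c2 s2 E] := IH c c' sc sc'.
exists (a * x + b * y :: c2); first by rewrite /= s2.
by rewrite /= E; apply/funext => w; ring.
Qed.

Lemma ip_lin0 us c V : in_space us -> H V ->
  (forall i, (i < size us)%N -> ip (nth (fun=> 0) us i) V = 0) -> ip (lin c us) V = 0.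
Proof.
move=> + hV; elim: us c => [|u us IH] [|x c] hus oV /=;
  try by rewrite /ip /ex; under eq_Rintegral do rewrite mul0r; rewrite Rintegral_cst// mul0r.
move/in_space_cons : hus => [hu hus].
rewrite ipDl//; [|exact: HZ|exact: lin_in_space].
rewrite ipZl// (oV 0%N)// mulr0 add0r IH// => i; exact: (oV i.+1).
Qed.

Lemma nondegenerate_cons k u us : nondegenerate k (u :: us) -> nondegenerate k us.
Proof.
move=> nd c sc; have := nd (0 :: c); rewrite /= sc => /(_ erefl).
rewrite big_cons expr0n/= add0r.
by rewrite (_ : (fun w => 0 * u w + lin c us w) = lin c us)//; apply/funext => w; rewrite mul0r add0r.
Qed.

(** Gram-Schmidt by induction: [W] and the head [u] are made orthogonal to the tail, then the
    residue of [W] is projected along the residue [u1] of [u]. *)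
Lemma regression k us W : 0 < k -> nondegenerate k us -> in_space us -> H W ->
  exists2 c, size c = size us &
    forall i, (i < size us)%N -> ip (nth (fun=> 0) us i) (fun w => W w - lin c us w) = 0.
Proof.
move=> k0; elim: us W => [|u us IH] W; first by move=> _ _ _; exists [::].
move=> nd /in_space_cons[hu hus] hW.
have nd' := nondegenerate_cons nd.
have [c1 s1 o1] := IH W nd' hus hW.
have [f sf of_] := IH u nd' hus hu.
pose u1 w := u w - lin f us w; pose W1 w := W w - lin c1 us w.
have hu1 : H u1 by apply: HB => //; exact: lin_in_space.
have hW1 : H W1 by apply: HB => //; exact: lin_in_space.
(* [u1] is a combination of the list with coefficient 1 at [u], so nondegeneracy bounds its variance
   below by [k]. *)
have u1gt0 : 0 < ip u1 u1.
  have [g sg E] := lin_comb (-1) 0 sf sf.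
  have := nd (1 :: g); rewrite /= sg => /(_ erefl).
  rewrite big_cons expr1n E (_ : (fun w => _) = u1); last first.
    by apply/funext => w; rewrite /u1; ring.
  apply: lt_le_trans; rewrite mulr_gt0// ltr_pwDl// sumr_ge0// => x _; exact: sqr_ge0.
pose t := ip u1 W1 / ip u1 u1.
have [g sg E] := lin_comb 1 (- t) s1 sf.
exists (t :: g); first by rewrite /= sg.
have -> : (fun w => W w - lin (t :: g) (u :: us) w) = (fun w => W1 w - t * u1 w).
  by apply/funext => w; rewrite /= E /W1 /u1; ring.
have htu : H (fun w => t * u1 w) by exact: HZ.
have hW2 : H (fun w => W1 w - t * u1 w) by exact: HB.
have o2 i : (i < size us)%N -> ip (nth (fun=> 0) us i) (fun w => W1 w - t * u1 w) = 0.
  move=> i_us; have hi := hus _ i_us.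
  by rewrite ipBr// ipZr// (o1 _ i_us) (of_ _ i_us) mulr0 subrr.
case => [_|i]; last exact: o2.
have -> : nth (fun=> 0) (u :: us) 0 = (fun w => u1 w + lin f us w).
  by apply/funext => w; rewrite /u1/= subrK.
rewrite ipDl//; last exact: lin_in_space.
rewrite (ip_lin0 f hus hW2 o2) addr0 ipBr// ipZr//.
by rewrite /t divfK ?subrr// gt_eqF.
Qed.

Lemma ip_lin_le k us c W : nondegenerate k us -> in_space us -> H W -> size c = size us ->
  (forall i, (i < size us)%N -> ip (nth (fun=> 0) us i) (fun w => W w - lin c us w) = 0) ->
  ip (fun w => W w - lin c us w) (fun w => W w - lin c us w) <= ip W W /\ k * (\sum_(x <- c) x ^+ 2) <= ip W W.
Proof.
move=> nd hus hW sc o; pose V w := W w - lin c us w.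
have hl : H (lin c us) by exact: lin_in_space.
have hV : H V by exact: HB.
have lV : ip (lin c us) V = 0 by exact: ip_lin0.
have -> : ip W W = ip V V + ip (lin c us) (lin c us).
  have WE : W = (fun w => V w + lin c us w) by apply/funext => w; rewrite /V subrK.
  rewrite {1 2}WE ipDl//; last exact: HD.
  by rewrite (ipDr hV hl hV) (ipDr hV hl hl) lV (ipC V (lin c us)) lV addr0 add0r.
split; first by rewrite lerDl ipXX_ge0.
by apply: le_trans (nd c sc) _; rewrite lerDr ipXX_ge0.
Qed.

Lemma lin_small c us (e B : R) w : 0 <= e -> 0 <= B -> size c = size us ->
  (forall x, x \in c -> `|x| <= B) -> small_all e us w ->
  `|lin c us w| <= (size us)%:R * (B * e).
Proof.
move=> e0 B0; elim: us c => [|u us IH] [|x c]//=; first by rewrite normr0 mul0r.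
move=> [sc] cB /andP[hu hus]; apply: le_trans (ler_normD _ _) _.
rewrite -natr1 addrC mulrDl mul1r lerD//.
  by apply: IH => // y yc; apply: cB; rewrite inE yc orbT.
by rewrite normrM ler_pM//; apply: cB; rewrite inE eqxx.
Qed.

(** [W] may be correlated with [us], but on the event its regression on [us] is at most |W| / 2 as
    soon as |W| > 1, by the smallness of [e]. Then |W| is at most twice the independent residue,
    which explains the variable [V = 2 V0] and the variance 4M. The regression coefficients satisfy
    x^2 <= M/k, hence |x| <= 1 + M/k. *)
Lemma prob_small_all_rel us (k e M : R) W : 0 < k -> 0 < e -> 0 <= M -> (0 < size us)%N ->
  in_space us -> nondegenerate k us -> H W -> ip W W <= M ->
  (size us)%:R * ((1 + M / k) * e) <= 2^-1 ->
  (P [set w | small_all (e * Num.max 1 `|W w|)%R us w] <=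
   (ball_cst (size us) k (4 * M) * e ^+ size us)%:E)%E.
Proof.
move=> k0 e0 M0 n0 hus nd hW WM eM.
have [c sc o] := regression k0 nd hus hW.
have [VW cW] := ip_lin_le nd hus hW sc o.
pose V0 w := W w - lin c us w; pose V w := 2 * V0 w.
have hV0 : H V0 by apply: HB => //; exact: lin_in_space.
have hV : H V by exact: HZ.
have oV i : (i < size us)%N -> ip (nth (fun=> 0) us i) V = 0.
  by move=> i_us; rewrite ipZr ?o ?mulr0//; exact: hus.
have VM : ip V V <= 4 * M.
  rewrite ipZl// ipZr// mulrA; have := le_trans VW WM; rewrite -/V0; lra.
apply: le_trans (prob_small_all_max k0 e0 n0 hus nd hV oV VM).
have mm X : H X -> measurable_fun setT (fun w => e * Num.max 1 `|X w|).
  move=> hX; apply: measurable_funM => //; apply: measurable_maxr => //.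
  by apply: measurableT_comp => //; exact: Hm.
apply: le_measure; rewrite ?inE; try by apply: measurable_small_all => //; exact: mm.
move=> w /= sw; apply: small_all_le (sw); rewrite ler_pM2l//.
have [W1|W1] := leP `|W w| 1; first by rewrite le_max lexx.
have em0 : 0 <= e * Num.max 1 `|W w| by rewrite mulr_ge0// ?ltW// lt_max ltr01.
have B0 : 0 <= 1 + M / k by rewrite addr_ge0// divr_ge0// ltW.
have cB x : x \in c -> `|x| <= 1 + M / k.
  move=> xc; apply: le_trans (normr_le_1Dsqr x) _; rewrite lerD2l ler_pdivlMr// mulrC.
  apply: le_trans WM; apply: le_trans cW; rewrite ler_pM2l//.
  by rewrite (big_rem _ xc)/= lerDl sumr_ge0// => y _; exact: sqr_ge0.
have := lin_small em0 B0 sc cB sw.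
rewrite (max_r (ltW W1)) => hl.
have h2 : `|lin c us w| <= 2^-1 * `|W w|.
  apply: le_trans hl _; rewrite [leLHS](_ : _ = ((size us)%:R * ((1 + M / k) * e)) * `|W w|); last by ring.
  by rewrite ler_wpM2r.
rewrite le_max; apply/orP; right.
have : `|W w| <= `|V0 w| + `|lin c us w|.
  by rewrite -[W w](subrK (lin c us w)); exact: ler_normD.
rewrite /V normrM (ger0_norm (ler0n _ 2)) => h3.
move: h2 h3; set x := `|W w|; set y := `|V0 w|; set z := `|lin _ _ _|; lra.
Qed.

Definition sum_norms (ws : seq (T -> R)) w : R := \sum_(W <- ws) `|W w|.

(** The zero variable put in front of the list stands for the summand 1, so that one of
    [size ws + 1] candidates always dominates, even for an empty list. *)
Lemma sum_norms_max ws w : exists2 i, (i <= size ws)%N &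
  1 + sum_norms ws w <= (size ws).+1%:R * Num.max 1 `|nth (fun=> 0) ((fun=> 0) :: ws) i w|.
Proof.
elim: ws => [|W ws [i i_ws IH]].
  by exists 0%N => //; rewrite /sum_norms big_nil addr0 mul1r le_max lexx.
rewrite /sum_norms big_cons -/(sum_norms ws w).
set m := Num.max 1 `|nth _ _ i w| in IH.
have [h|h] := leP m (Num.max 1 `|W w|).
  exists 1%N => //=; rewrite -natr1 mulrDl mul1r addrCA addrC lerD//.
    by apply: le_trans IH _; rewrite ler_wpM2l.
  by rewrite le_max lexx orbT.
case: i i_ws @m IH h => [|i] i_ws m IH h.
  exists 0%N => //=; rewrite -natr1 mulrDl mul1r addrCA addrC lerD//.
  by apply: le_trans (ltW h); rewrite le_max lexx orbT.
exists i.+2 => //=; rewrite -natr1 mulrDl mul1r addrCA addrC lerD//.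
by apply: le_trans (ltW h); rewrite le_max lexx orbT.
Qed.

Lemma measurable_sum_norms ws : in_space ws -> measurable_fun setT (sum_norms ws).
Proof.
elim: ws => [|W ws IH].
  by move=> _; rewrite (_ : sum_norms _ = fun=> 0)//; apply/funext => w; rewrite /sum_norms big_nil.
move=> /in_space_cons[hW hws].
rewrite (_ : sum_norms _ = fun w => `|W w| + sum_norms ws w); last first.
  by apply/funext => w; rewrite /sum_norms big_cons.
apply: measurable_funD; last exact: IH.
by apply: measurableT_comp => //; exact: Hm.
Qed.

(** A union bound over the variable of [ws] that dominates the radius, at the price of enlarging [e]
    by the number of candidates. The bound involves only [k], [M], [e] and the two sizes, so it is
    uniform over cells. *)
Theorem small_ball_random_radius us ws (k e M : R) : 0 < k -> 0 < e -> 0 <= M -> (0 < size us)%N ->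
  in_space us -> nondegenerate k us -> in_space ws ->
  (forall i, (i < size ws)%N -> ip (nth (fun=> 0) ws i) (nth (fun=> 0) ws i) <= M) ->
  (size us)%:R * ((1 + M / k) * ((size ws).+1%:R * e)) <= 2^-1 ->
  (P [set w | small_all (e * (1 + sum_norms ws w))%R us w] <=
   ((size ws).+1%:R * (ball_cst (size us) k (4 * M) * ((size ws).+1%:R * e) ^+ size us))%:E)%E.
Proof.
move=> k0 e0 M0 n0 hus nd hws wM eM.
pose p := (size ws).+1.
pose E i := [set w | small_all ((p%:R * e) * Num.max 1 `|nth (fun=> 0) ((fun=> 0) :: ws) i w|) us w].
have hn i : (i < p)%N -> H (nth (fun=> 0) ((fun=> 0) :: ws) i).
  by case: i => //= i; rewrite ltnS; exact: hws.
have mm X f : H X -> measurable_fun setT (fun w => f * Num.max 1 `|X w|).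
  move=> hX; apply: measurable_funM => //; apply: measurable_maxr => //.
  by apply: measurableT_comp => //; exact: Hm.
have mE i : (i < p)%N -> measurable (E i).
  by move=> ip; apply: measurable_small_all => //; apply: mm; exact: hn.
have pe0 : 0 < p%:R * e by rewrite mulr_gt0// ltr0n.
have z0 : ip (fun=> 0) (fun=> 0) = 0.
  by rewrite /ip /ex; under eq_Rintegral do rewrite mul0r; rewrite Rintegral_cst// mul0r.
have PE i : (i < p)%N -> (P (E i) <= (ball_cst (size us) k (4 * M) * (p%:R * e) ^+ size us)%:E)%E.
  move=> ip; apply: prob_small_all_rel => //; first exact: hn.
  by case: i ip => [|i] ip /=; [rewrite z0|exact: wM].
apply: (@le_trans _ _ (P (\big[setU/set0]_(i < p) E i))).
  apply: le_measure; rewrite ?inE.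
  - apply: measurable_small_all => //; apply: measurable_funM => //.
    by apply: measurable_funD => //; exact: measurable_sum_norms.
  - by apply: bigsetU_measurable => i _; exact: mE.
  move=> w /= sw; have [i i_ws h] := sum_norms_max ws w.
  rewrite -bigcup_mkord; exists i => //=.
  by rewrite /E/=; apply: small_all_le sw; rewrite -mulrA mulrCA ler_pM2l.
apply: (@le_trans _ _ (\sum_(i < p) P (E i))%E).
  by apply: Boole_inequality => i ip; exact: mE.
apply: (@le_trans _ _ (\sum_(i < p) (ball_cst (size us) k (4 * M) * (p%:R * e) ^+ size us)%:E)%E).
  by apply: lee_sum => i _; exact: PE.
by rewrite sumEFin lee_fin sumr_const card_ord -[leLHS]mulr_natl.
Qed.

End gaussian_space.

(** Completeness of row vectors, for the Banach fixed point theorem in [local_curve]. *)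
HB.instance Definition _ (R : realType) (m n : nat) :=
  Uniform_isComplete.Build 'M[R]_(m, n) (@mx_complete R m n).

(** * Critical points of zero sets *)

Section coordinates.
Context {R : realType}.

Lemma mx_entry_le (m n : nat) (x : 'M[R]_(m, n)) i j : `|x i j| <= `|x|.
Proof. by rewrite [leRHS]mx_normrE; exact: (le_bigmax _ (fun ij : 'I_m * 'I_n => `|x ij.1 ij.2|) (i, j)). Qed.

Lemma mx_norm_le (m n : nat) (x : 'M[R]_(m, n)) e : 0 <= e ->
  (forall i j, `|x i j| <= e) -> `|x| <= e.
Proof. by move=> e0 h; rewrite [leLHS]mx_normrE; apply: bigmax_le => // ij _; exact: h. Qed.

Lemma derive_pd (n : nat) (g : 'rV[R]_n -> R) (x v : 'rV[R]_n) : differentiable g x ->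
  'D_v g x = \sum_(j < n) v ord0 j * pd j g x.
Proof.
move=> dg; rewrite deriveE// {1}(row_sum_delta v) linear_sum/=.
by apply: eq_bigr => j _; rewrite linearZ/= /pd deriveE.
Qed.

Lemma is_derive_line (n : nat) (g : 'rV[R]_n -> R) (y v : 'rV[R]_n) (t : R) :
  derivable g (y + t *: v) v ->
  is_derive t 1 (fun s : R => g (y + s *: v)) ('D_v g (y + t *: v)).
Proof.
move=> dg.
have E : (fun h : R => h^-1 *: (((fun s : R => g (y + s *: v)) \o shift t) (h *: 1) - g (y + t *: v))) =
         (fun h : R => h^-1 *: ((g \o shift (y + t *: v)) (h *: v) - g (y + t *: v))).
  apply/funext => h /=; congr (_ *: (g _ - _)).
  by rewrite /GRing.scale/= mulr1 -/(GRing.scale _ _) scalerDl addrCA.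
apply: DeriveDef; first by rewrite /derivable E.
by rewrite /derive E.
Qed.

(** The mean value theorem on the segment after subtracting the linear form [a]. It serves with [a]
    the gradient at [x], for a contraction estimate, and with [a = 0], for a Lipschitz bound; the
    factor n comes from the sup norm. *)
Lemma mvt_affine (n : nat) (g : 'rV[R]_n -> R) (x : 'rV[R]_n) (rho B : R) (a : 'I_n -> R) :
  (forall y : 'rV[R]_n, `|y - x| < rho -> differentiable g y) ->
  (forall (y : 'rV[R]_n) j, `|y - x| < rho -> `|pd j g y - a j| <= B) ->
  forall y z : 'rV[R]_n, `|y - x| < rho -> `|z - x| < rho ->
  `|g z - g y - \sum_(j < n) a j * (z ord0 j - y ord0 j)| <= n%:R * (B * `|z - y|).
Proof.
move=> dg bg y z yx zx; set v := z - y.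
have seg (t : R) : 0 <= t <= 1 -> `|y + t *: v - x| < rho.
  move=> /andP[t0 t1].
  have -> : y + t *: v - x = (1 - t) *: (y - x) + t *: (z - x).
    by apply/rowP => j; rewrite !mxE; ring.
  apply: le_lt_trans (ler_normD _ _) _; rewrite !normrZ.
  rewrite ger0_norm ?subr_ge0// (ger0_norm t0).
  have [->|tn0] := eqVneq t 0; first by rewrite subr0 mul0r addr0 mul1r.
  have tp : 0 < t by rewrite lt_def tn0.
  have h1 : (1 - t) * `|y - x| <= (1 - t) * rho by rewrite ler_wpM2l ?subr_ge0// ltW.
  have h2 : t * `|z - x| < t * rho by rewrite ltr_pM2l.
  by lra.
pose s := \sum_(j < n) a j * v ord0 j.
pose h t := g (y + t *: v) - t * s.
have dh (t : R) : 0 <= t <= 1 -> is_derive t 1 h (\sum_(j < n) v ord0 j * pd j g (y + t *: v) - s).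
  move=> t01; have d1 := dg _ (seg t t01).
  have h1 := is_derive_line (@diff_derivable _ _ _ g _ v d1).
  rewrite (derive_pd _ d1) in h1.
  have h2 : is_derive t 1 (fun t : R => t * s) s.
    by apply: is_derive_eq; rewrite /GRing.scale/= ?mulr0 ?add0r ?mulr1 ?addr0.
  exact: is_deriveB.
have ch : {within `[0, 1], continuous h}.
  apply: derivable_within_continuous => t; rewrite in_itv/= => t01.
  by have [] := dh t t01.
have [|c c01] := @MVT R h (fun t => \sum_(j < n) v ord0 j * pd j g (y + t *: v) - s) 0 1 ltr01 _ ch.
  by move=> t; rewrite in_itv/= => /andP[t0 t1]; apply: dh; rewrite !ltW.
rewrite subr0 mulr1 /h scale1r scale0r addr0 mul0r mul1r subr0.
have -> : y + v = z by rewrite /v addrC subrK.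
move=> E.
have -> : g z - g y - \sum_(j < n) a j * (z ord0 j - y ord0 j) = g z - s - g y.
  rewrite addrAC; congr (_ - _ - _).
  by rewrite /s; apply: eq_bigr => j _; rewrite !mxE.
rewrite E /s -sumrB.
apply: le_trans (ler_norm_sum _ _ _) _.
apply: (@le_trans _ _ (\sum_(j < n) B * `|v|)).
  apply: ler_sum => j _; rewrite [a j * _]mulrC -mulrBr normrM mulrC.
  apply: ler_pM => //; last exact: mx_entry_le.
  apply: bg; apply: seg.
  by move: c01; rewrite in_itv/= => /andP[c0 c1]; rewrite !ltW.
by rewrite sumr_const card_ord -[leLHS]mulr_natl.
Qed.

Lemma clamp_dist (b t s : R) : 0 <= b ->
  `|Num.max 0 (Num.min t b) - Num.max 0 (Num.min s b)| <= `|t - s|.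
Proof.
move=> b0; wlog st : s t / s <= t => [H|].
  by have [st|/ltW ts] := leP s t; [exact: H|rewrite distrC [leRHS]distrC; exact: H].
rewrite (ger0_norm (_ : 0 <= t - s)) ?subr_ge0// ler_norml; apply/andP.
have [tb|tb] := leP t b; have [sb|sb] := leP s b; rewrite ?(max_r b0).
- by have [t0|t0] := leP 0 t; have [s0|s0] := leP 0 s; split; lra.
- by have [t0|t0] := leP 0 t; split; lra.
- by have [s0|s0] := leP 0 s; split; lra.
- by split; lra.
Qed.

End coordinates.

(** * Implicit curves through regular zeros *)

Section local_curve.
Context {R : realType} (n m : nat).
Variables (G : 'rV[R]_n -> 'rV[R]_m) (x : 'rV[R]_n) (j0 : 'I_n) (rho : R).
Let gi i y := G y ord0 i.
Hypothesis rho0 : 0 < rho.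
Hypothesis dg : forall i (y : 'rV[R]_n), `|y - x| < rho -> differentiable (gi i) y.
Hypothesis cg : forall i j, {for x, continuous (pd j (gi i))}.
Hypothesis Gx : G x = 0.

(** Column [j0] is zeroed instead of deleted: the rank is the same and the indices of the other
    columns are kept. *)
Definition transverse_jacobian : 'M[R]_(m, n) :=
  \matrix_(i < m, j < n) (if j == j0 then 0 else pd j (gi i) x).

Lemma near_pd (eta : R) : 0 < eta -> exists2 r : R, 0 < r <= rho &
  forall y : 'rV[R]_n, `|y - x| < r -> forall i j, `|pd j (gi i) y - pd j (gi i) x| <= eta.
Proof.
move=> eta0.
have : \forall y \near x, forall (i : 'I_m) (j : 'I_n), `|pd j (gi i) y - pd j (gi i) x| <= eta.
  apply: (@filter_forall _ _ (fun i (y : 'rV[R]_n) => forall j, `|pd j (gi i) y - pd j (gi i) x| <= eta) (nbhs x) _) => i.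
  apply: (@filter_forall _ _ (fun j (y : 'rV[R]_n) => `|pd j (gi i) y - pd j (gi i) x| <= eta) (nbhs x) _) => j.
  have /cvgrPdist_le/(_ _ eta0) := @cg i j.
  by apply: filterS => y; rewrite distrC.
move=> /nbhs_normP[r /= r0 h].
exists (Num.min r rho); first by rewrite lt_min r0 rho0 ge_min lexx orbT.
move=> y; rewrite lt_min => /andP[yr _]; apply: h.
by rewrite /= distrC.
Qed.

(* The instance of the implicit function theorem in which [j0] is the free coordinate. *)
Lemma local_curve : row_free transverse_jacobian ->
  exists2 t0 : R, 0 < t0 & exists gamma : R -> 'rV[R]_n,
    [/\ gamma 0 = x, continuous gamma & forall t : R, 0 <= t <= t0 ->
      [/\ `|gamma t - x| < rho, G (gamma t) = 0 & gamma t ord0 j0 = x ord0 j0 + t]].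
Proof.
move=> /row_freeP[B AB].
(* From the right inverse [B]: a displacement that leaves coordinate [j0] fixed and along which the
   differential of [G] at [x] equals [z]. *)
pose v (z : 'rV[R]_m) : 'rV[R]_n := \row_j (if j == j0 then 0 else \sum_k z ord0 k * B j k).
pose cB := m%:R * `|B|.
have cB0 : 0 <= cB by rewrite mulr_ge0.
have vB z z' : v z - v z' = v (z - z').
  apply/rowP => j; rewrite !mxE; case: ifP => _; first by rewrite subrr.
  by rewrite -sumrB; apply: eq_bigr => k _; rewrite !mxE mulrBl.
have vle z : `|v z| <= cB * `|z|.
  apply: mx_norm_le => [|i j]; first by rewrite mulr_ge0.
  rewrite mxE; case: ifP => _; first by rewrite normr0 mulr_ge0.
  apply: le_trans (ler_norm_sum _ _ _) _.
  apply: (@le_trans _ _ (\sum_(k < m) `|B| * `|z|)).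
    by apply: ler_sum => k _; rewrite normrM mulrC ler_pM// mx_entry_le.
  by rewrite sumr_const card_ord -mulr_natl mulrA.
have Av z i : \sum_(j < n) (if j == j0 then 0 else pd j (gi i) x) * v z ord0 j = z ord0 i.
  transitivity (\sum_(k < m) (transverse_jacobian *m B) i k * z ord0 k).
    under [RHS]eq_bigr do rewrite mxE mulr_suml.
    rewrite exchange_big/=; apply: eq_bigr => j _; rewrite !mxE.
    case: ifP => jj0; first by rewrite mul0r big1// => k _; rewrite !mul0r.
    by rewrite mulr_sumr; apply: eq_bigr => k _; ring.
  rewrite AB (bigD1 i)//= mxE eqxx mul1r big1 ?addr0// => k ki.
  by rewrite mxE eq_sym (negbTE ki) mul0r.
pose p (t : R) z := x + t *: evec j0 + v z.
have pB t s z z' : `|p t z - p s z'| <= `|t - s| + cB * `|z - z'|.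
  have -> : p t z - p s z' = (t - s) *: evec j0 + v (z - z').
    by rewrite -vB scalerBl; apply/rowP => j; rewrite !mxE; ring.
  apply: le_trans (ler_normD _ _) _; rewrite lerD ?vle// normrZ ler_piMr//.
  apply: mx_norm_le => // i j; rewrite mxE; case: (_ && _); first by rewrite normr1.
  by rewrite normr0.
have v0 : v 0 = 0 by apply/rowP => j; rewrite !mxE; case: ifP => // _; rewrite big1// => k _; rewrite mxE mul0r.
have p00 : p 0 0 = x by rewrite /p scale0r v0 !addr0.
have pj0 t z : p t z ord0 j0 = x ord0 j0 + t.
  by rewrite !mxE !eqxx/= mulr1 addr0.
(* Chosen so that n eta (cB + 1) <= 1/2, the contraction factor obtained in [TmE]. *)
pose eta := (2 * (n%:R + 1) * (cB + 1))^-1.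
have eta0 : 0 < eta by rewrite invr_gt0 !mulr_gt0// ltr_wpDl.
have [r /andP[r0 r_rho] near_r] := near_pd eta0.
pose alpha := \sum_i `|pd j0 (gi i) x|.
have alpha0 : 0 <= alpha by exact: sumr_ge0.
have alphaE i : `|pd j0 (gi i) x| <= alpha.
  by rewrite /alpha (bigD1 i)//= lerDl sumr_ge0.
pose beta := alpha + 1.
have beta0 : 0 < beta by rewrite ltr_wpDl.
(* A Newton map with frozen differential: its fixed points are the [z] for which [p t z] is a zero
   of [G]. *)
pose Tm t z := z - G (p t z).
have TmE t s z z' : `|p t z - x| < r -> `|p s z' - x| < r ->
    `|Tm t z - Tm s z'| <= 2^-1 * `|z - z'| + beta * `|t - s|.
  move=> hp hq; apply: mx_norm_le => [|i i'].
    by rewrite addr_ge0// mulr_ge0// ?invr_ge0// ltW.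
  rewrite ord1 {i}.
  have dg' y : `|y - x| < r -> differentiable (gi i') y.
    by move=> yr; apply: dg; exact: lt_le_trans r_rho.
  have := @mvt_affine R n (gi i') x r eta (fun j => pd j (gi i') x) dg'
    (fun y j yr => near_r y yr i' j) _ _ hq hp.
  rewrite (bigD1 j0)//= !pj0.
  have -> : \sum_(j < n | j != j0) pd j (gi i') x * (p t z ord0 j - p s z' ord0 j) =
      (z - z') ord0 i'.
    rewrite -Av [RHS](bigD1 j0)//= eqxx mul0r add0r; apply: eq_bigr => j jj0.
    by rewrite (negbTE jj0) -vB !mxE eqxx (negbTE jj0) /=; ring.
  rewrite (_ : x ord0 j0 + t - (x ord0 j0 + s) = t - s); last by ring.
  rewrite !mxE -/(gi i' _) -/(gi i' _).
  set D := gi i' (p t z) - gi i' (p s z') - _ => hD.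
  have -> : z ord0 i' - gi i' (p t z) - (z' ord0 i' - gi i' (p s z')) =
     - D - pd j0 (gi i') x * (t - s) by rewrite /D; ring.
  apply: le_trans (ler_normB _ _) _; rewrite normrN normrM.
  have h1 : `|D| <= 2^-1 * (`|t - s| + `|z - z'|).
    apply: le_trans hD _.
    apply: (@le_trans _ _ (n%:R * (eta * ((cB + 1) * (`|t - s| + `|z - z'|))))).
      rewrite ler_wpM2l// ler_pM2l//; apply: le_trans (pB _ _ _ _) _.
      have := normr_ge0 (t - s); have := normr_ge0 (z - z'); nra.
    have -> : n%:R * (eta * ((cB + 1) * (`|t - s| + `|z - z'|))) =
       (n%:R / (n%:R + 1)) * (2^-1 * (`|t - s| + `|z - z'|)).
      rewrite /eta; field; rewrite gt_eqF ?ltr_wpDl//= gt_eqF// ltr_wpDl//.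
    rewrite ler_piMl ?mulr_ge0 ?invr_ge0 ?addr_ge0//.
    by rewrite ler_pdivrMr ?ltr_wpDl// mul1r lerDl.
  have h2 : `|pd j0 (gi i') x| * `|t - s| <= alpha * `|t - s| by rewrite ler_wpM2r.
  have h3 := normr_ge0 (t - s).
  by rewrite /beta; lra.
(* For t <= t0 and |z| <= 2 beta t0, the point [p t z] is within t0 (1 + 2 cB beta) = r/2 of [x]. *)
pose t0 := r / (2 * (1 + 2 * cB * beta)).
have den0 : 0 < 1 + 2 * cB * beta by rewrite ltr_pwDl// !mulr_ge0// ltW.
have t00 : 0 < t0 by rewrite divr_gt0// mulr_gt0.
have inr t z : 0 <= t <= t0 -> `|z| <= 2 * beta * t0 -> `|p t z - x| < r.
  move=> /andP[t_ge0 tt0] hz; rewrite -{1}p00; apply: le_lt_trans (pB _ _ _ _) _.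
  rewrite !subr0 ger0_norm//.
  apply: (@le_lt_trans _ _ (t0 * (1 + 2 * cB * beta))).
    rewrite mulrDr mulr1 lerD//; apply: le_trans (ler_wpM2l cB0 hz) _.
    by rewrite le_eqVlt; apply/orP; left; apply/eqP; ring.
  have -> : t0 * (1 + 2 * cB * beta) = r / 2.
    by rewrite /t0; move: den0; set dd := 1 + _ => dd0; field; rewrite gt_eqF.
  by lra.
have z00 : `|0 : 'rV[R]_m| <= 2 * beta * t0 
  by rewrite normr0; apply: mulr_ge0; [apply: mulr_ge0 => //|]; exact: ltW.
have Tm00 : Tm 0 0 = 0 by rewrite /Tm p00 Gx subr0.
have t0le : 0 <= (0 : R) <= t0 by rewrite lexx ltW.
(* This ball is invariant: half of its radius plus beta t is again at most 2 beta t0. *)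
pose U : set 'rV[R]_m := [set z | `|z| <= 2 * beta * t0].
have fixpt t : 0 <= t <= t0 -> exists2 z, U z & z = Tm t z.
  move=> ht; have /andP[t_ge0 tt0] := ht.
  have TU : set_fun U U (Tm t).
    move=> z Uz /=; rewrite -[Tm t z]subr0 -Tm00.
    apply: le_trans (TmE _ _ _ _ (inr _ _ ht Uz) (inr _ _ t0le z00)) _.
    rewrite !subr0 (ger0_norm t_ge0).
    have h1 : beta * t <= beta * t0 by rewrite ler_pM2l.
    by move: Uz; rewrite /U/=; lra.
  pose TF := isFun.Build _ _ U U (Tm t) TU.
  pose F : {fun U >-> U} := HB.pack (Tm t) TF.
  have half0 : (0 : R) <= 2^-1 by rewrite invr_ge0.
  apply: (@banach_fixed_point R _ U F).
  - exists (NngNum half0); split => /=; first by rewrite invf_lt1// ltr1n.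
    move=> [z z'] [/= Uz Uz'].
    apply: le_trans (TmE _ _ _ _ (inr _ _ ht Uz) (inr _ _ ht Uz')) _.
    by rewrite subrr normr0 mulr0 addr0.
  - rewrite (_ : U = (fun z : 'rV[R]_m => `|z|) @^-1` [set y | y <= 2 * beta * t0])//.
    apply: closed_comp; last exact: closed_le.
    by move=> z _; exact: norm_continuous.
  - by exists 0.
(* Clamping the time to [0, t0] makes the curve defined and continuous on the whole line. *)
pose tau (t : R) := Num.max 0 (Num.min t t0).
have tau01 t : 0 <= tau t <= t0.
  by rewrite /tau le_max lexx/= ge_max (ltW t00) ge_min lexx orbT.
have tau_id t : 0 <= t <= t0 -> tau t = t.
  by move=> /andP[a b]; rewrite /tau min_l// max_r.
have tauB t s : `|tau t - tau s| <= `|t - s|.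
  by apply: clamp_dist; exact: ltW.
have /choice[y Hy] : forall t, exists z, U z /\ z = Tm (tau t) z.
  by move=> t; have [z Uz zE] := fixpt _ (tau01 t); exists z.
have yB t s : `|y t - y s| <= 2 * beta * `|t - s|.
  have [Ut yt] := Hy t; have [Us ys] := Hy s.
  have := TmE _ _ _ _ (inr _ _ (tau01 t) Ut) (inr _ _ (tau01 s) Us).
  rewrite -yt -ys; have := ler_wpM2l (ltW beta0) (tauB t s).
  by lra.
pose gamma t := p (tau t) (y t).
have y0 : y 0 = 0.
  have [U0 yE] := Hy 0.
  have := TmE _ _ _ _ (inr _ _ (tau01 0) U0) (inr _ _ t0le z00).
  rewrite -yE Tm00 tau_id// subrr normr0 mulr0 addr0 subr0 => h.
  by apply/eqP; rewrite -normr_le0; lra.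
exists t0 => //; exists gamma; split.
- by rewrite /gamma tau_id// y0.
- have L0 : 0 < 1 + cB * (2 * beta) by rewrite ltr_pwDl// !mulr_ge0// ltW.
  have gB t s : `|gamma t - gamma s| <= (1 + cB * (2 * beta)) * `|t - s|.
    apply: le_trans (pB _ _ _ _) _; rewrite mulrDl mul1r lerD//.
    by rewrite -mulrA ler_wpM2l.
  move=> t; apply/cvgrPdist_le => e e0; near=> s.
  apply: le_trans (gB _ _) _; rewrite -ler_pdivlMl//.
  near: s; apply: cvgr_dist_le; first exact: cvg_id.
  by rewrite mulr_gt0// invr_gt0.
- move=> t ht; rewrite /gamma tau_id//.
  have [Ut yt] := Hy t; rewrite tau_id// in yt.
  split; first by apply: lt_le_trans r_rho; exact: inr.
  + by have := congr1 (fun z => y t - z) yt; rewrite subrr /Tm opprB addrCA subrr addr0 => <-.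
  + exact: pj0.
Unshelve. all: end_near. Qed.
End local_curve.

Section critical_point.
Context {R : realType} (n m : nat).
Implicit Types (x y : 'rV[R]_n) (r : R).

Lemma cube_norm_lt r x : cube n r x -> `|x| <= r \/ n = 0%N.
Proof.
case: n x => [|k] x hx; [by right|left].
apply: mx_norm_le => [|i j].
  by have /andP[h1 h2] := hx ord0; lra.
by rewrite ord1 ler_norml; have /andP[/ltW -> /ltW ->] := hx j.
Qed.

Lemma cube_shift r (e : R) x y : cube n r x -> `|y - x| < e -> cube n (r + e) y.
Proof.
move=> hx yx j; have /andP[h1 h2] := hx j.
have := le_lt_trans (mx_entry_le (y - x) ord0 j) yx.
by rewrite !mxE ltr_norml => /andP[h3 h4]; apply/andP; split; lra.
Qed.

Lemma inner_component_critical r (G : 'rV[R]_n -> 'rV[R]_m) (j0 : 'I_n) S :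
  (forall i, C3minus (cube n (r + 1)) (fun x => G x ord0 i)) ->
  inner_components r G S ->
  exists2 x, S x & [/\ cube n r x, G x = 0 &
    exists i0 (lam : 'I_m -> R), [/\ lam i0 = 1, (forall i, `|lam i| <= 1) &
      forall j, j != j0 -> \sum_i lam i * pd j (fun x => G x ord0 i) x = 0]].
Proof.
move=> hC [x0 Zx0 [SE Scube]].
have Sx0 : S x0 by rewrite SE; exact: connected_component_refl.
have cS : connected S by rewrite SE; exact: component_connected.
have SZ : S `<=` zero_set r G by rewrite SE; exact: connected_component_sub.
have dG i y : cube n (r + 1) y -> differentiable (fun x => G x ord0 i) y.
  by move=> hy; have [h _ _ _] := hC i; exact: h.
(* [S] lies in the small cube and the field lives on the larger one, so limits of points of [S] are
   still zeros in the domain. The closure is then a connected set of zeros, hence contained in the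
   component: [S] is closed, and compact. *)
have clcube y : closure S y -> cube n (r + 1) y.
  move=> cy; have [z [Sz]] := cy _ (nbhsx_ballx y 1 ltr01).
  by rewrite -ball_normE/= => yz; apply: cube_shift (Scube _ Sz) yz.
have clZ : closure S `<=` zero_set r G.
  move=> y cy; split; first exact: clcube.
  apply/rowP => i; rewrite mxE; apply/eqP; apply: contrapT => /negP Gy.
  have cont : {for y, continuous (fun x => G x ord0 i)}.
    by apply: differentiable_continuous; apply: dG; exact: clcube.
  have nb : nbhs y [set z | G z ord0 i != 0] by exact: (cvgr_neq0 _ cont Gy).
  have [z [Sz /=]] := cy _ nb.
  by have [_ ->] := SZ _ Sz; rewrite mxE eqxx.
have closedS : closed S.
  suff : closure S `<=` connected_component (zero_set r G) x0 by rewrite -SE.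
  apply: connected_component_max => //; first exact: subset_closure.
  exact: connected_closure.
have n0 : n <> 0%N by move=> n0; move: j0; rewrite n0 => -[].
have bS : bounded_set S.
  exists r; split; first exact: num_real.
  by move=> M rM x /Scube/cube_norm_lt[] // /le_trans; apply; exact: ltW.
have compS := bounded_closed_compact bS closedS.
have [||x] := @EVT_max_rV _ _ (fun x => x ord0 j0) S _ compS.
- by exists x0.
- by apply: continuous_subspaceT => z; exact: coord_continuous.
rewrite inE => Sx maxx.
have [cx Gx] := SZ _ Sx.
have xr := Scube _ Sx.
exists x => //; split => //.
have [free|nfree] := boolP (row_free (transverse_jacobian G x j0)).
  have near1 (y : 'rV[R]_n) : `|y - x| < 1 -> cube n (r + 1) y by exact: cube_shift.
  have [||t0 t00 [gamma [g0 cgam Hg]]] := local_curve (rho := 1) ltr01 _ _ Gx free.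
  - by move=> i y /near1; exact: dG.
  - move=> i j; have [_ h _ _] := hC i.
    by apply: differentiable_continuous; exact: h.
  have : S (gamma t0).
    have SEx : S = connected_component (zero_set r G) x.
      by rewrite SE; apply: same_connected_component; rewrite -SE.
    (* The curve is a connected set of zeros through [x], so it stays in [S], while its [j0]
       coordinate exceeds the maximum. *)
    have ht : gamma @` `[0, t0] `<=` connected_component (zero_set r G) x.
      apply: connected_component_max.
      - by exists 0 => //=; rewrite in_itv/= lexx ltW.
      - move=> _ [t + <-]; rewrite /= in_itv/= => /Hg[h1 h2 _]; split => //.
        exact: near1.
      - apply: connected_continuous_connected; first exact: segment_connected.
        exact: continuous_subspaceT.
    by rewrite SEx; apply: ht; exists t0 => //=; rewrite in_itv/= lexx ltW.
  have [|_ _ gt] := Hg t0; first by rewrite lexx ltW.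
  rewrite -inE => /maxx; rewrite gt; lra.
(* A left kernel vector divided by its entry of largest modulus gives [lam i0 = 1] and all entries
   at most 1, so that a finite grid can approximate [lam]. *)
have : kermx (transverse_jacobian G x j0) != 0 by rewrite kermx_eq0.
move=> /rowV0Pn[u /sub_kermxP uA u0].
have nu : mx_norm u != 0 by apply: contra u0 => /eqP /mx_norm_eq0 ->.
have [[i' i0] /= ui0] := mx_norm_neq0 nu; rewrite (ord1 i') in ui0.
have unz : u ord0 i0 != 0 by rewrite -normr_eq0 -ui0.
exists i0, (fun i => u ord0 i / u ord0 i0); split.
- by rewrite divff.
- move=> i; rewrite normrM normfV ler_pdivrMr ?normr_gt0// mul1r -ui0.
  exact: mx_entry_le.
- move=> j jj0; transitivity ((u ord0 i0)^-1 * (u *m transverse_jacobian G x j0) ord0 j).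
    by rewrite mxE mulr_sumr; apply: eq_bigr => i _; rewrite mxE (negbTE jj0); ring.
  by rewrite uA mxE mulr0.
Qed.

End critical_point.

(** * Finite differences *)

Section finite_differences.
Context {R : realType} (n : nat).
Implicit Types (x y c : 'rV[R]_n) (g : 'rV[R]_n -> R) (h k : R) (j l : 'I_n).

Definition fd j h g : 'rV[R]_n -> R := fun x => (g (x + h *: evec j) - g x) / h.

Lemma normr_le_via (a b d u v w : R) :
  `|a - b| <= u -> `|d - b| <= v -> `|d| <= w -> `|a| <= u + v + w.
Proof.
move=> ab db dw; rewrite -[a](subrK b) -[b in _ + b](subrK d) addrA.
apply: le_trans (ler_normD _ _) _; rewrite lerD//.
by apply: le_trans (ler_normD _ _) _; rewrite lerD// distrC.
Qed.

Lemma half_add_half : 2^-1 + 2^-1 = 1 :> R.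
Proof. lra. Qed.

Lemma norm_evec j : `|evec j : 'rV[R]_n| <= 1.
Proof.
apply: mx_norm_le => // i i'; rewrite mxE; case: (_ && _); first by rewrite normr1.
by rewrite normr0.
Qed.

Lemma fdC j l h k g x : fd j h (fd l k g) x = fd l k (fd j h g) x.
Proof.
rewrite /fd (addrAC x); set A := g _; set B := g (x + h *: _); set C := g (x + k *: _).
by set hi := h^-1; set ki := k^-1; ring.
Qed.

Lemma fd_mvt j h g x : 0 < h ->
  (forall t, 0 <= t <= h -> derivable g (x + t *: evec j) (evec j)) ->
  exists2 t, 0 < t < h & fd j h g x = pd j g (x + t *: evec j).
Proof.
move=> h0 dg.
have d t : 0 <= t <= h -> is_derive t (1 : R) (fun s : R => g (x + s *: evec j)) (pd j g (x + t *: evec j)).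
  by move=> /dg; exact: is_derive_line.
have [||t] := @MVT R (fun s : R => g (x + s *: evec j)) (fun t => pd j g (x + t *: evec j)) 0 h h0.
- by move=> t; rewrite in_itv/= => /andP[a b]; apply: d; rewrite !ltW.
- apply: derivable_within_continuous => t; rewrite in_itv/= => th.
  by have [] := d t th.
rewrite in_itv/= scale0r addr0 subr0 => th E; exists t => //.
by rewrite /fd E mulfK// gt_eqF.
Qed.

Lemma pd_fd j l k g x : derivable g x (evec j) -> derivable g (x + k *: evec l) (evec j) ->
  derivable (fd l k g) x (evec j) /\ pd j (fd l k g) x = fd l k (pd j g) x.
Proof.
move=> d1 d2.
have i1 : is_derive x (evec j) g (pd j g x) by exact: derivableP.
have i2 : is_derive x (evec j) (fun y => g (y + k *: evec l)) (pd j g (x + k *: evec l)).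
  have E : (fun h : R => h^-1 *: (((fun y => g (y + k *: evec l)) \o shift x) (h *: evec j) - g (x + k *: evec l))) =
    (fun h : R => h^-1 *: ((g \o shift (x + k *: evec l)) (h *: evec j) - g (x + k *: evec l))).
    by apply/funext => h /=; rewrite addrA.
  by apply: DeriveDef; [rewrite /derivable E|rewrite /derive E].
have i3 : is_derive x (evec j) (fd l k g) (k^-1 *: (pd j g (x + k *: evec l) - pd j g x)).
  have -> : fd l k g = k^-1 \*: ((fun y => g (y + k *: evec l)) - g).
    by apply/funext => y; rewrite /fd /= mulrC.
  exact: is_deriveZ.
split; first by case: i3.
by rewrite /pd (derive_val (is_derive := i3)) /fd mulrC.
Qed.

(** The mean value theorem in direction [j] for the quotient [fd l k g], then in direction [l] for
    [pd j g]. The order of the mixed derivative is tracked; the commutation used later is that of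
    quotients, [fdC]. *)
Lemma fd2_mvt j l h k g x (rho : R) x0 : 0 < h -> 0 < k ->
  `|x - x0| + h + k < rho ->
  (forall y, `|y - x0| < rho -> differentiable g y) ->
  (forall y, `|y - x0| < rho -> differentiable (pd j g) y) ->
  exists2 y, `|y - x0| <= `|x - x0| + h + k & fd j h (fd l k g) x = pd l (pd j g) y.
Proof.
move=> h0 k0 hk dg dpg.
have bnd s t : 0 <= s <= h -> 0 <= t <= k ->
    `|x + s *: evec j + t *: evec l - x0| <= `|x - x0| + h + k.
  move=> /andP[s0 sh] /andP[t0 tk].
  rewrite (_ : _ - x0 = (x - x0) + s *: evec j + t *: evec l); last by rewrite addrAC -!addrA; congr (_ + _); rewrite addrCA addrA addrAC.
  apply: le_trans (ler_normD _ _) _; apply: lerD.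
    apply: le_trans (ler_normD _ _) _; rewrite lerD2l normrZ ger0_norm//.
    by apply: le_trans sh; rewrite ler_piMr// norm_evec.
  rewrite normrZ ger0_norm//.
  by apply: le_trans tk; rewrite ler_piMr// norm_evec.
have k0k : 0 <= (0 : R) <= k by rewrite lexx ltW.
have kk : 0 <= k <= k by rewrite lexx ltW.
have b0 s : 0 <= s <= h -> `|x + s *: evec j - x0| < rho.
  move=> hs; apply: le_lt_trans hk; have := bnd s 0 hs k0k.
  by rewrite scale0r addr0.
have pf s : 0 <= s <= h -> derivable (fd l k g) (x + s *: evec j) (evec j) /\
    pd j (fd l k g) (x + s *: evec j) = fd l k (pd j g) (x + s *: evec j).
  move=> hs; apply: pd_fd; apply: diff_derivable; apply: dg; first exact: b0.
  exact: le_lt_trans (bnd _ _ hs kk) hk.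
have [|s s0h E] := @fd_mvt j h (fd l k g) x h0.
  by move=> s /pf[].
have hs : 0 <= s <= h by move: s0h => /andP[a b]; rewrite !ltW.
have [|t t0k E2] := @fd_mvt l k (pd j g) (x + s *: evec j) k0.
  move=> t ht; apply: diff_derivable; apply: dpg.
  exact: le_lt_trans (bnd _ _ hs ht) hk.
exists (x + s *: evec j + t *: evec l).
  by apply: bnd => //; move: t0k => /andP[a b]; rewrite !ltW.
by rewrite E; have [_ ->] := pf _ hs.
Qed.

(* First-order Taylor estimates at a grid point [c] near a critical zero [x]; all bounds are expressed through finite differences at [c]. *)
Lemma taylor_critical (m : nat) (f : 'I_m -> 'rV[R]_n -> R) (lam lam0 : 'I_m -> R)
    x c (e h S rho : R) (J : pred 'I_n) :
  0 < h -> h <= e -> 1 <= S -> `|c - x| <= e -> 3 * e < rho -> 5 * n%:R * e <= 1 ->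
  (forall i y, `|y - x| < rho -> differentiable (f i) y) ->
  (forall i j y, `|y - x| < rho -> differentiable (pd j (f i)) y) ->
  (forall i j l y, `|y - x| < rho -> `|pd j (pd l (f i)) y - pd j (pd l (f i)) x| <= 2^-1) ->
  (forall i j, 1 + `|fd j h (f i) c| <= S) ->
  (forall i j l, (j <= l)%N -> 1 + `|fd j h (fd l h (f i)) c| <= S) ->
  (forall i, f i x = 0) -> (forall i, `|lam i| <= 1) -> (forall i, `|lam0 i - lam i| <= e) ->
  (forall j, J j -> \sum_i lam i * pd j (f i) x = 0) ->
  (forall i, `|f i c| <= (2 * n%:R + m%:R * (2 * n%:R + 1)) * e * S) /\
  (forall j, J j -> `|\sum_i lam0 i * fd j h (f i) c| <= (2 * n%:R + m%:R * (2 * n%:R + 1)) * e * S).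
Proof.
move=> h0 he S1le cx e_rho ne dfx ddfx near2 S1 S2 fx0 lam1 lam0e crit.
have e0 : 0 < e by exact: lt_le_trans he.
have rho0 : 0 < rho by lra.
have xx : `|x - x| < rho by rewrite subrr normr0.
have cxr : `|c - x| < rho by lra.
have hh : `|c - x| + h + h < rho by lra.
have S0 : 0 <= S by lra.
(* A second quotient at [c] is a second derivative at some nearby [y']. Passing from [y'] to [x] and
   from [x] to [y] costs 1/2 each, which is paid by the 1 included in [S]. *)
have dd i j l y : `|y - x| < rho -> `|pd l (pd j (f i)) y| <= S.
  move=> yx.
  have [y' y'x E] := fd2_mvt l h0 h0 hh (dfx i) (ddfx i j).
  have y'r : `|y' - x| < rho by exact: le_lt_trans hh.
  have h1 : 1 + `|pd l (pd j (f i)) y'| <= S.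
    rewrite -E; case: (leqP j l) => jl; first exact: S2.
    by rewrite fdC; apply: S2; exact: ltnW.
  have h2 := near2 i l j _ yx; have h3 := near2 i l j _ y'r.
  have h4 : `|pd l (pd j (f i)) y'| <= S - 1 by rewrite lerBrDl.
  apply: le_trans (normr_le_via h2 h3 h4) _.
  by rewrite half_add_half addrC subrK.
have d1 i j y z : `|y - x| < rho -> `|z - x| < rho ->
    `|pd j (f i) z - pd j (f i) y| <= n%:R * (S * `|z - y|).
  move=> yx zx.
  have := @mvt_affine R n (pd j (f i)) x rho S (fun=> 0) (ddfx i j) _ y z yx zx.
  under eq_bigr do rewrite mul0r.
  rewrite big1// subr0; apply => y' l y'x; rewrite subr0; exact: dd.
have fdE i j : exists2 y, `|y - x| <= 2 * e & fd j h (f i) c = pd j (f i) y.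
  have bt t : 0 <= t <= h -> `|c + t *: evec j - x| <= 2 * e.
    move=> /andP[t0 th]; rewrite addrAC; apply: le_trans (ler_normD _ _) _.
    have : `|t *: evec j : 'rV[R]_n| <= t by rewrite normrZ ger0_norm// ler_piMr// norm_evec.
    lra.
  have [|t /andP[t0 th] ->] := @fd_mvt j h (f i) c h0.
    by move=> t /bt ht; apply: diff_derivable; apply: dfx; lra.
  by exists (c + t *: evec j) => //; apply: bt; rewrite !ltW.
have fdx i j : `|fd j h (f i) c - pd j (f i) x| <= 2 * n%:R * e * S.
  have [y yx ->] := fdE i j.
  have yr : `|y - x| < rho by lra.
  apply: le_trans (d1 i j _ _ xx yr) _.
  have -> : 2 * n%:R * e * S = n%:R * (S * (2 * e)) by ring.
  by rewrite ler_wpM2l// ler_wpM2l.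
have nn : (0 : R) <= n%:R by [].
have mm : (0 : R) <= m%:R by [].
have eS : 0 <= e * S by rewrite mulr_ge0// ltW.
have nS : 5 * n%:R * e * S <= S by rewrite ler_piMl.
split => [i|j Jj].
  (* The gradient near [x] is at most 3neS + 2neS + (S - 1), and 5ne <= 1 turns this into 2S. *)
  have pdb y j : `|y - x| < 3 * e -> `|pd j (f i) y - 0| <= 2 * S.
    move=> y3; have yr : `|y - x| < rho by lra.
    have h1 := d1 i j _ _ xx yr; have h2 := fdx i j; have h3 := S1 i j.
    have h4 : n%:R * (S * `|y - x|) <= n%:R * (S * (3 * e)) by rewrite ler_wpM2l// ler_wpM2l// ltW.
    have h5 : `|fd j h (f i) c| <= S - 1 by rewrite lerBrDl.
    rewrite subr0; apply: le_trans (normr_le_via (le_trans h1 h4) h2 h5) _.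
    by clear -nS; lra.
  have x3 : `|x - x| < 3 * e by rewrite subrr normr0; lra.
  have c3 : `|c - x| < 3 * e by lra.
  have := @mvt_affine R n (f i) x (3 * e) (2 * S) (fun=> 0) _ pdb x c x3 c3.
  under eq_bigr do rewrite mul0r.
  rewrite big1// fx0 !subr0 => H.
  apply: le_trans (H _) _; first by move=> y y3; apply: dfx; lra.
  apply: (@le_trans _ _ (n%:R * (2 * S * e))).
    by rewrite ler_wpM2l// ler_wpM2l// mulr_ge0.
  have -> : (2 * n%:R + m%:R * (2 * n%:R + 1)) * e * S =
     n%:R * (2 * S * e) + (m%:R * (2 * n%:R + 1)) * (e * S) by ring.
  by rewrite lerDl mulr_ge0// mulr_ge0// addr_ge0// mulr_ge0.
(* Subtracting the vanishing sum of [lam i * pd j (f i) x] splits the error into replacing [lam] by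
   [lam0] and replacing the derivative by the quotient. *)
have -> : \sum_i lam0 i * fd j h (f i) c =
    \sum_i ((lam0 i - lam i) * fd j h (f i) c + lam i * (fd j h (f i) c - pd j (f i) x)).
  transitivity (\sum_i lam0 i * fd j h (f i) c - \sum_i lam i * pd j (f i) x).
    by rewrite crit// subr0.
  by rewrite -sumrB; apply: eq_bigr => i _; ring.
apply: le_trans (ler_norm_sum _ _ _) _.
apply: (@le_trans _ _ (\sum_(i < m) ((2 * n%:R + 1) * (e * S)))).
  apply: ler_sum => i _; apply: le_trans (ler_normD _ _) _; rewrite (normrM (lam0 i - lam i)) (normrM (lam i)).
  have h1 : `|lam0 i - lam i| * `|fd j h (f i) c| <= e * S.
    by apply: ler_pM => //; have := S1 i j; lra.
  have h2 : `|lam i| * `|fd j h (f i) c - pd j (f i) x| <= 1 * (2 * n%:R * e * S).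
    by apply: ler_pM.
  have -> : (2 * n%:R + 1) * (e * S) = e * S + 1 * (2 * n%:R * e * S) by ring.
  exact: lerD.
rewrite sumr_const card_ord -[leLHS]mulr_natl.
have -> : (2 * n%:R + m%:R * (2 * n%:R + 1)) * e * S =
   m%:R * ((2 * n%:R + 1) * (e * S)) + 2 * n%:R * (e * S) by ring.
by rewrite lerDl mulr_ge0// mulr_ge0.
Qed.

End finite_differences.

(** * Limits of Gaussian variables *)

Section fatou_bounds.
Context {d : measure_display} {T : measurableType d} {R : realType}.
Variable P : probability T R.
Local Open Scope ereal_scope.

Lemma ge0_le_integralT (f g : T -> \bar R) : (forall w, 0 <= f w) -> (forall w, f w <= g w) ->
  \int[P]_w f w <= \int[P]_w g w.
Proof.
move=> f0 fg; have g0 w : 0 <= g w by exact: le_trans (fg w).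
rewrite !ge0_integralTE//; apply: le_ereal_sup => _ [h hf <-].
by exists h => // w; exact: le_trans (fg w).
Qed.

Lemma limn_einf_le (u : (\bar R)^nat) (C : \bar R) : (forall k, u k <= C) -> limn_einf u <= C.
Proof.
move=> uC; rewrite limn_einf_lim; apply: lime_le; first exact: is_cvg_einfs.
by near=> k; apply: le_trans (uC k); apply: ereal_inf_lbound; exists k => /=.
Unshelve. all: end_near. Qed.

Lemma limn_einf_ge (u : (\bar R)^nat) (x : \bar R) (N : nat) :
  (forall k, (N <= k)%N -> x <= u k) -> x <= limn_einf u.
Proof.
move=> xu; rewrite limn_einf_lim; apply: lime_ge; first exact: is_cvg_einfs.
near=> k; apply: le_ereal_inf_tmp => _ [l /= kl <-]; apply: xu; apply: leq_trans kl.
by near: k; exact: nbhs_infty_ge.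
Unshelve. all: end_near. Qed.

(* [f] need not be measurable: the integral of a nonnegative function is a supremum over simple functions below it. *)
Lemma integral_le_fatou (f : T -> \bar R) (g : nat -> T -> \bar R) (C : \bar R) :
  (forall w, 0 <= f w) -> (forall k, measurable_fun setT (g k)) -> (forall k w, 0 <= g k w) ->
  {ae P, forall w, f w <= limn_einf (g ^~ w)} -> (forall k, \int[P]_w g k w <= C) ->
  \int[P]_w f w <= C.
Proof.
move=> f0 mg g0 [Z [mZ PZ fZ]] gC.
(* [f] may be nonmeasurable, so it is left untouched; making the [g k] infinite on the null set
   turns the almost sure inequality into one that holds everywhere, without changing the
   integrals. *)
pose g' k w := if w \in Z then +oo else g k w.
have mg' k : measurable_fun setT (g' k).
  apply: measurable_fun_ifT => //.
  apply: (measurable_fun_bool true); rewrite setTI (_ : _ @^-1` _ = Z)//.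
  apply/seteqP; split => w /=; first by move/set_mem.
  by move/mem_set.
have g'0 k w : 0 <= g' k w by rewrite /g'; case: ifP.
have fg w : f w <= limn_einf (g' ^~ w).
  rewrite /g'; case: (boolP (w \in Z)) => wZ.
    apply: le_trans (leey _) _; apply: (@limn_einf_ge _ _ 0%N) => k _; exact: lexx.
  move: wZ => /negP; rewrite inE => wZ; apply: contrapT => h; apply: wZ; exact: fZ.
apply: le_trans (ge0_le_integralT f0 fg) _.
apply: le_trans (fatou P measurableT mg' (fun k w _ => g'0 k w)) _.
apply: limn_einf_le => k; apply: le_trans (gC k).
rewrite le_eqVlt; apply/orP; left; apply/eqP; apply: ge0_ae_eq_integral => //.
exists Z; split => // w /= h; apply: contrapT => nZ; apply: h => _.
by rewrite /g' ifF//; apply/negP; rewrite inE.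
Qed.

End fatou_bounds.

Section gaussian_limits.
Context {d : measure_display} {T : measurableType d} {R : realType}.
Variable P : probability T R.
Notation ip := (ip P).

(* Almost sure convergence to 0 of centered Gaussian variables forces their variances to be small, by anticoncentration. *)
Lemma ae_cvg0_ip (V : nat -> T -> R) (e : R) : 0 < e -> (forall N, centered_gaussian P (V N)) ->
  {ae P, forall w, V ^~ w @ \oo --> (0 : R)} -> exists N, ip (V N) (V N) <= e.
Proof.
move=> e0 gV [Z [mZ PZ cZ]].
pose a := Num.sqrt e / 4.
have a0 : 0 < a by rewrite divr_gt0// sqrtr_gt0.
have aE : 16 * a ^+ 2 = e by rewrite /a expr_div_n sqr_sqrtr ?ltW//; field.
have mV N : measurable_fun setT (V N) by exact: centered_gaussian_measurable (gV N).
pose A N := [set w | `|V N w| <= a].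
have mA N : measurable (A N).
  apply: (@measurable_le_set _ _ _ (V N) (fun=> a)) => //.
pose B N := \bigcap_(k in [set k | (N <= k)%N]) A k.
have mB N : measurable (B N) by apply: bigcap_measurable => [|k _]; [by exists N => /= | exact: mA].
have ndB : nondecreasing_seq B.
  move=> i j ij; apply/subsetPset => w Bw k /= jk; apply: Bw => /=; exact: leq_trans jk.
have cv : (P \o B) @ \oo --> P (\bigcup_N B N).
  by apply: nondecreasing_cvg_mu => //; exact: bigcup_measurable.
have full : (1 <= P (\bigcup_N B N))%E.
  have -> : (1 = P (~` Z))%E by rewrite probability_setC// PZ sube0.
  apply: le_measure; rewrite ?inE.
  - exact: measurableC.
  - exact: bigcup_measurable.
  move=> w nZ; have cw : V ^~ w @ \oo --> (0 : R) by apply: contrapT => h; apply: nZ; exact: cZ.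
  have /cvgrPdist_le/(_ _ a0)[N _ hN] := cw.
  by exists N => // k /= Nk; have := hN k Nk; rewrite /= sub0r normrN.
(* The events [B N] increase to one of probability 1, so some of them reach probability 1/2, the
   level required by anticoncentration. *)
have [N hN] : exists N, (2^-1%:E <= P (B N))%E.
  apply: contrapT => /forallNP h.
  have : (P (\bigcup_N B N) <= 2^-1%:E)%E.
    rewrite -(cvg_lim _ cv)//; apply: lime_le; first by apply/cvg_ex; eexists; exact: cv.
    by near=> k; have /negP := h k; rewrite -ltNge => /ltW.
  by move=> /(le_trans full); rewrite lee_fin => ?; lra.
exists N; rewrite -aE; apply: centered_gaussian_anticoncentration (ltW a0) _ => //.
apply: le_trans hN _; apply: le_measure; rewrite ?inE//.
exact: (mA N).
by move=> w /(_ N); apply => /=.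
Unshelve. all: end_near. Qed.

(** For Gaussian variables an almost surely convergent family is Cauchy in L^2. Otherwise pairs of
    indices of fineness d0 / (N + 1), with variance of the difference above [e], would give a
    sequence tending to 0 almost surely. Read [ok r i] as: the index [i] is at least as fine as
    [r]. *)
Lemma ip_cauchy (H : set (T -> R)) (I : Type) (ok : R -> I -> Prop) (Z : I -> T -> R) (D : T -> R)
    (d0 e : R) : gaussian_space P H -> 0 < e -> 0 < d0 ->
  (forall r i, r <= d0 -> ok r i -> H (Z i)) ->
  {ae P, forall w, forall eta : R, 0 < eta -> exists2 r : R, 0 < r &
     forall i, ok r i -> `|Z i w - D w| <= eta} ->
  (forall r r' i, r <= r' -> ok r i -> ok r' i) ->
  exists2 r : R, 0 < r <= d0 & forall i i', ok r i -> ok r i' ->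
    ip (fun w => Z i w - Z i' w) (fun w => Z i w - Z i' w) <= e.
Proof.
move=> GH e0 d00 HZ0 aeZ okm; apply: contrapT => h.
pose rr (N : nat) := d0 / N.+1%:R.
have rr0 N : 0 < rr N <= d0.
  by rewrite divr_gt0//= ler_pdivrMr// ler_peMr ?ler1n// ltW.
have /choice[f Hf] N : exists p : I * I, [/\ ok (rr N) p.1, ok (rr N) p.2 &
    e < ip (fun w => Z p.1 w - Z p.2 w) (fun w => Z p.1 w - Z p.2 w)].
  apply: contrapT => h2; apply: h; exists (rr N) => // i i' oi oi'.
  rewrite leNgt; apply/negP => ei; apply: h2; by exists (i, i').
pose V N w := Z (f N).1 w - Z (f N).2 w.
have [HD HZ HG] := GH.
have gV N : centered_gaussian P (V N).
  have [ok1 ok2 _] := Hf N; have /andP[_ le0] := rr0 N.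
  apply: HG; rewrite (_ : V N = fun w => Z (f N).1 w + (-1) * Z (f N).2 w); last first.
    by apply/funext => w; rewrite mulN1r.
  apply: HD; first exact: HZ0 le0 ok1.
  by apply: HZ; exact: HZ0 le0 ok2.
have [|N VN] := ae_cvg0_ip e0 gV.
  apply: filterS aeZ => w cw; apply/cvgrPdist_le => eta eta0.
  have [|r r0 hr] := cw (eta / 2); first by rewrite divr_gt0.
  near=> N; rewrite sub0r normrN.
  have rN : rr N <= r.
    rewrite /rr ler_pdivrMr// mulrC -ler_pdivrMr//.
    near: N; exists (Num.truncn (d0 / r)) => // N /= Nr.
    by rewrite ltW// (lt_le_trans (truncnS_gt _))// ler_nat ltnS.
  have [ok1 ok2 _] := Hf N.
  have h1 := hr _ (okm _ _ _ rN ok1); have h2 := hr _ (okm _ _ _ rN ok2).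
  rewrite /V -[Z (f N).1 w](subrK (D w)) -addrA.
  apply: le_trans (ler_normD _ _) _; rewrite distrC in h2.
  by rewrite [eta]splitr; exact: lerD.
by have [_ _] := Hf N; rewrite ltNge => /negP; apply.
Unshelve. all: end_near. Qed.

End gaussian_limits.

(** * Difference quotients of the field *)

Section difference_limits.
Context {R : realType} (n : nat).
Implicit Types (g : 'rV[R]_n -> R) (s : seq 'I_n) (hs : seq R) (c x : 'rV[R]_n) (h r : R) (j : 'I_n).
Implicit Types L : seq (R * 'rV[R]_n).

Definition fdl s hs g := foldr (fun p => fd p.1 p.2) g (zip s hs).

Definition step_ok s r hs := size hs = size s /\ forall h, h \in hs -> 0 < h <= r.

(** A combination of point evaluations as a list of weighted points: in this form a difference
    quotient of the field is visibly a finite linear combination of its values. *)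
Definition ev L g : R := \sum_(p <- L) p.1 * g p.2.

Definition fd_points L j h :=
  [seq (p.1 / h, p.2 + h *: evec j) | p <- L] ++ [seq (- (p.1 / h), p.2) | p <- L].

Definition fdl_points s hs c := foldl (fun L p => fd_points L p.1 p.2) [:: (1, c)] (zip s hs).

Lemma ev_fd_points L j h g : ev (fd_points L j h) g = ev L (fd j h g).
Proof.
rewrite /ev big_cat !big_map /= -big_split /=; apply: eq_bigr => p _.
by rewrite /fd; ring.
Qed.

Lemma ev_fdl_points s hs c g : ev (fdl_points s hs c) g = fdl s hs g c.
Proof.
have E q L : ev (foldl (fun L p => fd_points L p.1 p.2) L q) g = ev L (foldr (fun p => fd p.1 p.2) g q).
  by elim: q L => //= p q IH L; rewrite IH ev_fd_points.
by rewrite E /ev big_seq1 mul1r.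
Qed.

Lemma fdl_points_dist s hs c r p : 0 <= r -> step_ok s r hs -> p \in fdl_points s hs c ->
  `|p.2 - c| <= r * (size s)%:R.
Proof.
move=> r0 [].
have E q L (e : R) : (forall z, z \in q -> 0 < z.2 <= r) -> (forall z, z \in L -> `|z.2 - c| <= e) ->
    forall z, z \in foldl (fun L p => fd_points L p.1 p.2) L q -> `|z.2 - c| <= e + r * (size q)%:R.
  elim: q L e => [|z q IH] L e hq hL; first by rewrite mulr0 addr0.
  move=> y /= /IH; rewrite -natr1 mulrDr mulr1 (addrC _ r) addrA; apply.
    by move=> u uq; apply: hq; rewrite inE uq orbT.
  have /andP[z0 zr] := hq z (mem_head _ _).
  move=> u; rewrite mem_cat => /orP[] /mapP[v vL ->] /=; have := hL _ vL; last by lra.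
  move=> h1; rewrite addrAC; apply: le_trans (ler_normD _ _) _; apply: lerD => //.
  by rewrite normrZ gtr0_norm//; apply: le_trans zr; rewrite ler_piMr ?norm_evec// ltW.
move=> sz hok /(E (zip s hs) [:: (1, c)] 0).
rewrite add0r size_zip sz minnn; apply.
  move=> z zq; apply: hok; have <- : unzip2 (zip s hs) = hs by rewrite unzip2_zip// sz.
  exact: map_f.
by move=> z; rewrite inE => /eqP ->; rewrite subrr normr0.
Qed.

Lemma fd_cvg j g x : derivable g x (evec j) -> fd j h g x @[h --> (0 : R)^'+] --> pd j g x.
Proof.
move=> dg; have h1 := cvg_dnbhs_at_right dg; apply: cvg_trans h1.
apply: near_eq_cvg; near=> h; rewrite /fd /=.
by rewrite mulrC (addrC (h *: _)).
Unshelve. all: end_near. Qed.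

Lemma sum_fd (I : finType) (a : I -> R) (Phi : I -> 'rV[R]_n -> R) (x : I -> 'rV[R]_n) j h :
  \sum_(p : I * bool) (if p.2 then a p.1 / h else - (a p.1 / h)) *
     Phi p.1 (if p.2 then x p.1 + h *: evec j else x p.1) =
  \sum_i a i * fd j h (Phi i) (x i).
Proof.
rewrite -(pair_bigA _ (fun i b => (if b then a i / h else - (a i / h)) *
     Phi i (if b then x i + h *: evec j else x i))) /=.
by apply: eq_bigr => i _; rewrite big_bool /= /fd; ring.
Qed.

Lemma comb_limit_ge (I : finType) (a : I -> R) (g : I -> 'rV[R]_n -> R) (x : I -> 'rV[R]_n) j (B r : R) :
  0 < r -> (forall i, derivable (g i) (x i) (evec j)) ->
  (forall h, 0 < h < r -> B <= \sum_i a i * fd j h (g i) (x i)) ->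
  B <= \sum_i a i * pd j (g i) (x i).
Proof.
move=> r0 dg hB.
have cv : (\sum_i a i * fd j h (g i) (x i)) @[h --> (0 : R)^'+] --> \sum_i a i * pd j (g i) (x i).
  apply: cvg_big => [|i _]; first exact: add_continuous.
  by apply: cvgM; [exact: cvg_cst|exact: fd_cvg].
rewrite -(cvg_lim _ cv)//; apply: limr_ge; first by apply/cvg_ex; eexists; exact: cv.
near=> h; apply: hB; apply/andP; split; near: h; first exact: nbhs_right_gt.
exact: nbhs_right_lt.
Unshelve. all: end_near. Qed.

(** Lower bounds on all fine quotients pass to the derivative. The statement is about combinations
    over a finite type because replacing the outermost derivative by a quotient doubles the
    evaluations of the remaining ones; the induction continues over [I * bool]. *)
Lemma iterD_comb_ge (I : finType) (a : I -> R) (g : I -> 'rV[R]_n -> R) (x : I -> 'rV[R]_n)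
    (U : set 'rV[R]_n) s (B r : R) : 0 < r ->
  (forall i, derivable_seq U s (g i)) ->
  (forall i y, `|y - x i| < r * (size s)%:R -> U y) ->
  (forall hs, size hs = size s -> (forall h, h \in hs -> 0 < h < r) ->
     B <= \sum_i a i * fdl s hs (g i) (x i)) ->
  B <= \sum_i a i * Defs.iterD s (g i) (x i).
Proof.
move=> r0; elim: s I a g x => [|j s IH] I a g x dg hU hB.
  exact: (hB [::]).
apply: (comb_limit_ge r0) => [i|h /andP[h0 hr]].
  by have [_] := dg i; apply; apply: (hU i); rewrite subrr normr0 mulr_gt0// ltr0n.
rewrite -(sum_fd a (fun i => Defs.iterD s (g i))).
apply: (IH _ (fun p : I * bool => if p.2 then a p.1 / h else - (a p.1 / h)) (fun p => g p.1)
  (fun p => if p.2 then x p.1 + h *: evec j else x p.1)).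
- by move=> p; have [] := dg p.1.
- move=> [i b] y /= hy; apply: (hU i); rewrite -natr1 mulrDr mulr1.
  case: b hy => hy; last by apply: lt_trans hy _; rewrite ltrDl.
  have -> : y - x i = (y - (x i + h *: evec j)) + h *: evec j by rewrite opprD addrA subrK.
  apply: le_lt_trans (ler_normD _ _) _; apply: ltrD => //.
  by rewrite normrZ gtr0_norm//; apply: le_lt_trans hr; rewrite ler_piMr ?norm_evec// ltW.
move=> hs sz hok; rewrite (sum_fd a (fun i => fdl s hs (g i))).
apply: (hB (h :: hs)) => [|h']; first by rewrite /= sz.
by rewrite inE => /orP[/eqP ->|/hok//]; apply/andP.
Qed.

(** Applied first in [x], with a single term. The resulting quotient is then a combination over the
    points of [fdl_points], and the lemma is applied once more to the derivatives in [y] at these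
    points. *)
Lemma iterD2_ge (U : set 'rV[R]_n) s (K : 'rV[R]_n -> 'rV[R]_n -> R) c (B r : R) :
  0 < r -> U c -> (forall x, `|x - c| < r *+ 2 * (size s).+1%:R -> U x) ->
  (forall x, U x -> derivable_seq U s (K x)) ->
  (forall y, U y -> derivable_seq U s (fun x => Defs.iterD s (K x) y)) ->
  (forall hs hs', step_ok s r hs -> step_ok s r hs' ->
     B <= fdl s hs (fun x => fdl s hs' (K x) c) c) ->
  B <= Defs.iterD s (fun x => Defs.iterD s (K x) c) c.
Proof.
move=> r0 Uc hU d1 d2 hB.
have le2 (x : 'rV[R]_n) : `|x - c| < r * (size s).+1%:R -> U x.
  move=> h; apply: hU; apply: lt_le_trans h _.
  by rewrite mulr2n mulrDl lerDl mulr_ge0// ltW.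
have := @iterD_comb_ge unit (fun=> 1) (fun=> fun x => Defs.iterD s (K x) c) (fun=> c) U s B r r0.
rewrite !big_const !card_unit /= !addr0 !mul1r; apply.
- by move=> _; exact: d2.
- by move=> _ y hy; apply: le2; apply: lt_le_trans hy _; rewrite ler_wpM2l ?ler_nat// ltW.
move=> hs sz hok.
have ok : step_ok s r hs by split => // h /hok/andP[-> /ltW ->].
rewrite !big_const !card_unit /= !addr0 !mul1r.
rewrite -ev_fdl_points /ev (big_nth (1, c)) big_mkord.
have near_c (i : 'I_(size (fdl_points s hs c))) : `|(nth (1, c) (fdl_points s hs c) i).2 - c| <= r * (size s)%:R.
  by apply: (fdl_points_dist (ltW r0) ok); exact: mem_nth.
set pts := fdl_points s hs c in near_c *.
apply: (@iterD_comb_ge _ (fun i : 'I_(size pts) => (nth (1, c) pts i).1)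
  (fun i => K (nth (1, c) pts i).2) (fun=> c) U s B r) => //.
- move=> i; apply: d1; apply: le2; apply: le_lt_trans (near_c i) _.
  by rewrite ltr_pM2l// ltr_nat.
- by move=> _ y hy; apply: le2; apply: lt_le_trans hy _; rewrite ler_wpM2l ?ler_nat// ltW.
move=> hs' sz' hok'; have ok' : step_ok s r hs' by split => // h /hok'/andP[-> /ltW ->].
have := hB _ _ ok ok'; rewrite -(ev_fdl_points s hs c) /ev.
by rewrite (big_nth (1, c)) big_mkord.
Qed.

End difference_limits.

(** * Multi-indices as sorted lists of directions *)

Section multi_index_of_seq.
Context {n : nat}.
Implicit Types (s : seq 'I_n) (j l : 'I_n).

Lemma mi_order_count s : mi_order (fun a => count_mem a s) = size s.
Proof.
rewrite /mi_order; elim: s => [|b s IH]; first by rewrite big1.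
rewrite /= big_split /= IH (bigD1 b)//= eqxx big1// => a ab.
by rewrite eq_sym (negbTE ab).
Qed.

(** (A2) is indexed by multi-indices, whose direction lists are sorted; a sorted list is thus
    recovered from its multiplicities. This is why second differences are controlled for j <= l
    only. *)
Lemma mi_dirs_count s : sorted (fun j l => (j <= l)%N) s ->
  mi_dirs (fun a => count_mem a s) = s.
Proof.
move=> ss; apply: (@sorted_eq _ (fun j l : 'I_n => (j <= l)%N)) => //.
- by move=> a b c; exact: leq_trans.
- by move=> a b ab; apply/val_inj/anti_leq.
- have : pairwise (fun j l : 'I_n => (j <= l)%N) (enum 'I_n).
    rewrite -sorted_pairwise; last by move=> a b c; exact: leq_trans.
    have := iota_sorted 0 n; rewrite -val_enum_ord sorted_map.
    by [].
  rewrite sorted_pairwise; last by move=> a b c; exact: leq_trans.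
  rewrite /mi_dirs; elim: (enum 'I_n) => //= a e IH /andP[ae pe].
  rewrite pairwise_cat IH// andbT; apply/andP; split.
    apply/allrelP => x y; rewrite mem_nseq => /andP[_ /eqP ->] /flattenP[z /mapP[b be ->]].
    by rewrite mem_nseq => /andP[_ /eqP ->]; exact: (allP ae).
  by apply/(pairwiseP a) => i k; rewrite !inE size_nseq => hi hk _; rewrite !nth_nseq hi hk.
apply/allP => x _ /=; rewrite /mi_dirs count_flatten -map_comp sumnE big_map big_enum /=.
rewrite (bigD1 x)//= count_nseq /= eqxx mul1n big1 ?addn0// => a ax.
by rewrite count_nseq /= (negbTE ax).
Qed.

End multi_index_of_seq.

(** * Convergence of difference quotients to derivatives *)

Section pointwise_convergence.
Context {R : realType} {n : nat}.
Implicit Types (g : 'rV[R]_n -> R) (c : 'rV[R]_n) (j l : 'I_n) (hs : seq R).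

Lemma fd1_near j g c (rho eta : R) : 0 < rho -> 0 < eta ->
  (forall y, `|y - c| < rho -> differentiable g y) -> {for c, continuous (pd j g)} ->
  exists2 r : R, 0 < r & forall hs, step_ok [:: j] r hs ->
    `|fdl [:: j] hs g c - pd j g c| <= eta.
Proof.
move=> rho0 eta0 dg /cvgrPdist_le/(_ _ eta0)/nbhs_ballP[e /= e0 he].
exists (Num.min rho e / 2); first by rewrite divr_gt0// lt_min rho0 e0.
move=> [|h [|? ?]] [//= _] /(_ h (mem_head _ _)) /andP[h0]; rewrite ler_pdivlMr// le_min => /andP[h1 h2].
have bt (t : R) : 0 <= t <= h -> `|t *: evec j : 'rV[R]_n| <= h.
  by move=> /andP[t0 th]; rewrite normrZ ger0_norm//; apply: le_trans th; rewrite ler_piMr// norm_evec.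
have [|t /andP[t0 th]] := @fd_mvt _ _ j h g c h0.
  move=> t ht; apply: diff_derivable; apply: dg; rewrite addrC addKr.
  by apply: le_lt_trans (bt _ ht) _; lra.
rewrite /fdl /= => ->; rewrite distrC; apply: he; rewrite -ball_normE /= distrC addrC addKr.
by apply: (@le_lt_trans _ _ h); [apply: bt; rewrite !ltW|lra].
Qed.

Lemma fd2_near j l g c (rho eta : R) : 0 < rho -> 0 < eta ->
  (forall y, `|y - c| < rho -> differentiable g y) ->
  (forall y, `|y - c| < rho -> differentiable (pd j g) y) -> {for c, continuous (pd l (pd j g))} ->
  exists2 r : R, 0 < r & forall hs, step_ok [:: j; l] r hs ->
    `|fdl [:: j; l] hs g c - pd l (pd j g) c| <= eta.
Proof.
move=> rho0 eta0 dg ddg /cvgrPdist_le/(_ _ eta0)/nbhs_ballP[e /= e0 he].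
exists (Num.min rho e / 3); first by rewrite divr_gt0// lt_min rho0 e0.
move=> [|h [|k [|? ?]]] [//= _] hok.
have /andP[h0] := hok h (mem_head _ _).
have /andP[k0] : 0 < k <= Num.min rho e / 3 by apply: hok; rewrite !inE eqxx orbT.
rewrite !ler_pdivlMr// !le_min => /andP[k1 k2] /andP[h1 h2].
have hk : `|c - c| + h + k < rho by rewrite subrr normr0; lra.
have [y yc] := fd2_mvt l h0 k0 hk dg ddg.
rewrite /fdl /= => ->; rewrite distrC; apply: he; rewrite -ball_normE /= distrC.
by apply: le_lt_trans yc _; rewrite subrr normr0; lra.
Qed.

End pointwise_convergence.

(** * Variances of sums and of difference quotients *)

Section gaussian_sums.
Context {d : measure_display} {T : measurableType d} {R : realType}.
Variables (P : probability T R) (H : set (T -> R)).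
Hypothesis GH : gaussian_space P H.
Hypothesis H0 : H (fun=> 0).
Notation ip := (ip P).
Implicit Types (V W X Y : T -> R).

Lemma in_space_sum (I : eqType) (q : seq I) (a : I -> R) (X : I -> T -> R) :
  (forall i, i \in q -> H (X i)) -> H (fun w => \sum_(i <- q) a i * X i w).
Proof.
have [HD HZ _] := GH.
elim: q => [|i q IH] hX.
  by rewrite (_ : (fun w => _) = fun=> 0)//; apply/funext => w; rewrite big_nil.
rewrite (_ : (fun w => _) = fun w => a i * X i w + \sum_(i <- q) a i * X i w); last first.
  by apply/funext => w; rewrite big_cons.
apply: HD; first by apply: HZ; apply: hX; exact: mem_head.
by apply: IH => k kq; apply: hX; rewrite inE kq orbT.
Qed.

Lemma ip_suml (I : eqType) (q : seq I) (a : I -> R) (X : I -> T -> R) Y :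
  (forall i, i \in q -> H (X i)) -> H Y ->
  ip (fun w => \sum_(i <- q) a i * X i w) Y = \sum_(i <- q) a i * ip (X i) Y.
Proof.
move=> + hY; have [HD HZ _] := GH.
elim: q => [|i q IH] hX.
  rewrite big_nil (_ : (fun w => _) = fun w => 0 * Y w); last first.
    by apply/funext => w; rewrite big_nil mul0r.
  by rewrite (ipZl GH)// mul0r.
have hi : H (X i) by apply: hX; exact: mem_head.
have hq k : k \in q -> H (X k) by move=> kq; apply: hX; rewrite inE kq orbT.
rewrite big_cons -(IH hq) -(ipZl GH (a i) hi hY).
rewrite -(ipDl GH (HZ (a i) _ hi) (in_space_sum a hq) hY).
by congr (ip _ _); apply/funext => w; rewrite big_cons.
Qed.

Lemma in_spaceB X Y : H X -> H Y -> H (fun w => X w - Y w).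
Proof.
have [HD HZ _] := GH; move=> hX hY.
rewrite (_ : (fun w => _) = fun w => X w + (-1) * Y w); last first.
  by apply/funext => w; rewrite mulN1r.
by apply: HD => //; exact: HZ.
Qed.

Lemma ip_parallelogram X Y : H X -> H Y ->
  ip (fun w => X w - Y w) (fun w => X w - Y w) = ip X X + ip Y Y - 2 * ip X Y.
Proof.
move=> hX hY; have hB := in_spaceB hX hY.
rewrite (ipBl GH)// !(ipBr GH)// (ipC P Y X); ring.
Qed.

Lemma ip_le_2sub X Y : H X -> H Y ->
  ip X X <= 2 * ip Y Y + 2 * ip (fun w => X w - Y w) (fun w => X w - Y w).
Proof.
move=> hX hY; rewrite ip_parallelogram//.
have [HD HZ _] := GH.
have h2 : H (fun w => 2 * Y w) by exact: HZ.
(* The claim is exactly that [X - 2 Y] has nonnegative variance. *)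
have := ipXX_ge0 P (fun w => X w - 2 * Y w).
rewrite ip_parallelogram// (ipZl GH)// !(ipZr GH)//; lra.
Qed.

Lemma ip_le_half X Y : H X -> H Y -> ip X Y <= (ip X X + ip Y Y) / 2.
Proof.
move=> hX hY; have := ipXX_ge0 P (fun w => X w - Y w).
rewrite ip_parallelogram//; lra.
Qed.

Lemma ip_sum_le (I : finType) (a : I -> R) (X : I -> T -> R) (e : R) :
  0 <= e -> (forall i, `|a i| <= 1) -> (forall i, H (X i)) -> (forall i, ip (X i) (X i) <= e) ->
  ip (fun w => \sum_i a i * X i w) (fun w => \sum_i a i * X i w) <= #|I|%:R ^+ 2 * e.
Proof.
move=> e0 a1 hX Xe; have [HD HZ _] := GH.
pose Y i w := a i * X i w.
have hY i : H (Y i) by exact: HZ.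
have Ye i : ip (Y i) (Y i) <= e.
  rewrite (ipZl GH)// (ipZr GH)// mulrA -expr2 -real_normK ?num_real//.
  apply: le_trans (Xe i); rewrite ler_piMl ?ipXX_ge0//.
  by rewrite exprn_ile1.
have E : (fun w => \sum_i a i * X i w) = (fun w => \sum_i 1 * Y i w).
  by apply/funext => w; apply: eq_bigr => i _; rewrite mul1r.
have hS : H (fun w => \sum_i 1 * Y i w) by exact: in_space_sum.
rewrite E ip_suml//.
apply: (@le_trans _ _ (\sum_(i : I) \sum_(k : I) e)).
  apply: ler_sum => i _; rewrite mul1r (ipC P) ip_suml//.
  apply: ler_sum => k _; rewrite mul1r; apply: le_trans (ip_le_half (hY k) (hY i)) _.
  by have := Ye i; have := Ye k; lra.
by rewrite !sumr_const expr2 -mulrA !mulr_natl.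
Qed.

End gaussian_sums.

Section field_differences.
Context {d : measure_display} {T : measurableType d} {R : realType} {n : nat}.
Variables (P : probability T R) (H : set (T -> R)).
Hypothesis GH : gaussian_space P H.
Hypothesis H0 : H (fun=> 0).
Notation ip := (ip P).
Variables (U : set 'rV[R]_n) (phi : T -> 'rV[R]_n -> R).
Hypothesis Hphi : forall x, U x -> H (fun w => phi w x).
Implicit Types (c x y : 'rV[R]_n) (s : seq 'I_n) (hs : seq R) (r : R) (L : seq (R * 'rV[R]_n)).
Notation K x y := (ip (fun w => phi w x) (fun w => phi w y)).

Lemma in_space_ev L : (forall p, p \in L -> U p.2) -> H (fun w => ev L (phi w)).
Proof. by move=> hL; apply: (in_space_sum GH H0) => p /hL; exact: Hphi. Qed.

Lemma ip_evl L Y : (forall p, p \in L -> U p.2) -> H Y ->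
  ip (fun w => ev L (phi w)) Y = ev L (fun x => ip (fun w => phi w x) Y).
Proof. by move=> hL hY; rewrite (ip_suml GH H0)// => p /hL; exact: Hphi. Qed.

Lemma in_space_fdl s hs c : (forall p, p \in fdl_points s hs c -> U p.2) ->
  H (fun w => fdl s hs (phi w) c).
Proof.
move=> h; rewrite (_ : (fun w => _) = fun w => ev (fdl_points s hs c) (phi w)).
  exact: in_space_ev.
by apply/funext => w; rewrite ev_fdl_points.
Qed.

Lemma ip_fdl s hs hs' c : (forall p, p \in fdl_points s hs c -> U p.2) ->
  (forall p, p \in fdl_points s hs' c -> U p.2) ->
  ip (fun w => fdl s hs (phi w) c) (fun w => fdl s hs' (phi w) c) =
  fdl s hs (fun x => fdl s hs' (fun y => K x y) c) c.
Proof.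
move=> h h'.
have E q : (fun w => fdl s q (phi w) c) = (fun w => ev (fdl_points s q c) (phi w)).
  by apply/funext => w; rewrite ev_fdl_points.
rewrite !E ip_evl//; last exact: in_space_ev.
rewrite -ev_fdl_points /ev; apply: eq_big_seq => p ph; congr (_ * _).
rewrite (ipC P) ip_evl//; last exact/Hphi/h.
rewrite -ev_fdl_points /ev; apply: eq_bigr => q _; by rewrite (ipC P).
Qed.

Variables (c : 'rV[R]_n) (rho : R).
Hypothesis rho0 : 0 < rho.
Hypothesis hU : forall x, `|x - c| < rho -> U x.

Lemma fdl_points_in s hs p : step_ok s (rho / (size s).+1%:R) hs -> p \in fdl_points s hs c -> U p.2.
Proof.
move=> hok /(fdl_points_dist _ hok) h; apply: hU; apply: le_lt_trans (h _) _.
  by rewrite divr_ge0// ltW.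
by rewrite mulrAC ltr_pdivrMr ?ltr0n// ltr_pM2l// ltr_nat.
Qed.

Lemma step_okW s r r' hs : r <= r' -> step_ok s r hs -> step_ok s r' hs.
Proof. by move=> rr [sz h]; split => // z /h/andP[-> /le_trans->]. Qed.

(* The finite differences [Z] form a Cauchy net in L^2, so if one of them had variance above [2 M + 2] then all products [ip Z Z'] of fine ones would exceed [M], contradicting that their limit is a derivative of the covariance. *)
Lemma fdl_variance_le s (D : T -> R) (M : R) :
  (forall x, U x -> derivable_seq U s (fun y => K x y)) ->
  (forall y, U y -> derivable_seq U s (fun x => Defs.iterD s (fun y => K x y) y)) ->
  Defs.iterD s (fun x => Defs.iterD s (fun y => K x y) c) c <= M ->
  {ae P, forall w, forall eta : R, 0 < eta -> exists2 r : R, 0 < r &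
     forall hs, step_ok s r hs -> `|fdl s hs (phi w) c - D w| <= eta} ->
  exists2 r : R, 0 < r & forall hs, step_ok s r hs ->
    ip (fun w => fdl s hs (phi w) c) (fun w => fdl s hs (phi w) c) <= 2 * M + 2.
Proof.
move=> d1 d2 KM ae.
pose r0 := rho / (2 * (size s).+1%:R).
have s0 : (0 : R) < (size s).+1%:R by rewrite ltr0n.
have r00 : 0 < r0 by rewrite divr_gt0// mulr_gt0.
have r0rho : r0 *+ 2 * (size s).+1%:R = rho.
  by rewrite /r0 -mulr_natl; field; rewrite gt_eqF.
have r0le : r0 <= rho / (size s).+1%:R.
  rewrite /r0 invfM mulrA mulrAC ler_piMr ?divr_ge0 ?(ltW rho0)//; lra.
have [||r /andP[r1 r2] hr] := @ip_cauchy _ _ _ P H (seq R) (step_ok s) (fun hs w => fdl s hs (phi w) c)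
   D r0 2^-1 GH _ r00 _ ae (fun r r' hs => @step_okW s r r' hs).
- by lra.
- move=> r hs rr0 hok; apply: in_space_fdl => p; apply: fdl_points_in.
  by apply: step_okW hok; exact: le_trans r0le.
have hin hs : step_ok s r hs -> forall p, p \in fdl_points s hs c -> U p.2.
  move=> hok p; apply: fdl_points_in; apply: step_okW hok; exact: le_trans r0le.
have hH hs : step_ok s r hs -> H (fun w => fdl s hs (phi w) c).
  by move=> hok; apply: in_space_fdl; exact: hin.
exists r => // hs0 hok0; rewrite leNgt; apply/negP => big.
(* With tolerance 1/2, a variance above 2M + 2 forces every fine quotient to have variance above M +
   1/2; by the parallelogram identity the product of two of them exceeds (2M + 1 - 1/2) / 2 = M +
   1/4. *)
have : M + 4^-1 <= Defs.iterD s (fun x => Defs.iterD s (fun y => K x y) c) c.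
  apply: (@iterD2_ge _ _ U s (fun x y => K x y) c (M + 4^-1) r) => //.
  - by apply: hU; rewrite subrr normr0.
  - move=> x xc; apply: hU; apply: lt_le_trans xc _; rewrite -r0rho.
    by rewrite ler_wpM2r ?ler_wMn2r// ltW.
  move=> hs hs' ok1 ok2; rewrite -ip_fdl; try exact: hin.
  have h1 := hr _ _ hok0 ok1; have h2 := hr _ _ ok1 ok2.
  have h3 := ip_le_2sub GH (hH _ hok0) (hH _ ok1).
  have h4 := ip_le_2sub GH (hH _ hok0) (hH _ ok2).
  have h5 := hr _ _ hok0 ok2.
  have := ip_parallelogram GH (hH _ ok1) (hH _ ok2).
  lra.
lra.
Qed.

End field_differences.

(** * Transfer of nondegeneracy from derivatives to quotients *)

Section nondegeneracy.
Context {d : measure_display} {T : measurableType d} {R : realType}.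
Variables (P : probability T R) (H : set (T -> R)).
Hypothesis GH : gaussian_space P H.
Hypothesis H0 : H (fun=> 0).
Notation ip := (ip P).

Lemma integral_sqrE (X : T -> R) : H X -> (\int[P]_w ((X w) ^+ 2)%:E = (ip X X)%:E)%E.
Proof.
move=> hX; rewrite /ip /ex /Rintegral fineK.
  by apply: eq_integral => w _; rewrite expr2.
by apply: integrable_fin_num => //; exact: (gaussian_integrableM GH).
Qed.

(** Fatou's lemma goes in the useful direction: the second moment of the limit, bounded below by
    [k], is at most any common bound on the variances along steps tending to 0. Each of these
    variances is compared with the one at step [h] through [ip_le_2sub], the source of both factors
    2. *)
Lemma nondegenerate_limit (I : finType) (A : T -> R) (Y : R -> I -> T -> R) (D : I -> T -> R)
    (xi : I -> R) (k r e : R) :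
  0 < r -> 0 <= e -> H A -> (forall h i, 0 < h <= r -> H (Y h i)) ->
  {ae P, forall w, forall i (eta : R), 0 < eta -> exists2 r' : R, 0 < r' &
    forall h, 0 < h <= r' -> `|Y h i w - D i w| <= eta} ->
  (forall h h' i, 0 < h <= r -> 0 < h' <= r ->
    ip (fun w => Y h i w - Y h' i w) (fun w => Y h i w - Y h' i w) <= e) ->
  (forall i, `|xi i| <= 1) ->
  (k%:E <= \int[P]_w ((A w + \sum_i xi i * D i w) ^+ 2)%:E)%E ->
  forall h, 0 < h <= r ->
  k <= 2 * ip (fun w => A w + \sum_i xi i * Y h i w) (fun w => A w + \sum_i xi i * Y h i w)
       + 2 * (#|I|%:R ^+ 2 * e).
Proof.
move=> r0 e0 hA hY ae cauchy xi1 kle h hr; have [HD HZ HG] := GH.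
pose X t w := A w + \sum_i xi i * Y t i w.
have hX t : 0 < t <= r -> H (X t).
  by move=> tr; apply: HD => //; apply: (in_space_sum GH H0) => i _; exact: hY.
rewrite -lee_fin; apply: le_trans kle _.
have pr (p : nat) : 0 < r / p.+1%:R <= r.
  by rewrite divr_gt0//= ler_pdivrMr// ler_peMr ?ler1n// ltW.
apply: (@integral_le_fatou _ _ _ P _ (fun p w => ((X (r / p.+1%:R) w) ^+ 2)%:E)).
- by move=> w; rewrite lee_fin sqr_ge0.
- move=> p; apply/measurable_EFinP; apply: measurable_funX.
  by apply: centered_gaussian_measurable; apply: HG; exact: hX.
- by move=> p w; rewrite lee_fin sqr_ge0.
- apply: filterS ae => w cw.
  have cY i : Y (r / p.+1%:R) i w @[p --> \oo] --> D i w.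
    apply/cvgrPdist_le => eta eta0; have [r' r'0 hr'] := cw i _ eta0.
    near=> p; rewrite distrC; apply: hr'; have /andP[-> _] := pr p => /=.
    rewrite ler_pdivrMr// mulrC -ler_pdivrMr//.
    near: p; exists (Num.truncn (r / r')) => // p /= Np.
    by rewrite ltW// (lt_le_trans (truncnS_gt _))// ler_nat ltnS.
  have cX : X (r / p.+1%:R) w @[p --> \oo] --> A w + \sum_i xi i * D i w.
    apply: cvgD; first exact: cvg_cst.
    apply: cvg_big => [|i _]; first exact: add_continuous.
    by apply: cvgM; [exact: cvg_cst|exact: cY].
  have cX2 : ((X (r / p.+1%:R) w) ^+ 2)%:E @[p --> \oo] --> ((A w + \sum_i xi i * D i w) ^+ 2)%:E.
    by apply: cvg_EFin; [exact: nearW|rewrite /comp /=; under eq_fun do rewrite expr2; rewrite expr2; exact: cvgM].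
  by rewrite (cvg_limn_einf_sup cX2).1.
move=> p; rewrite integral_sqrE; last exact: hX.
rewrite lee_fin; apply: le_trans (ip_le_2sub GH (hX _ (pr p)) (hX _ hr)) _.
rewrite lerD2l ler_pM2l//.
rewrite (_ : (fun w => X (r / p.+1%:R) w - X h w) =
  (fun w => \sum_i xi i * (Y (r / p.+1%:R) i w - Y h i w))).
  apply: (ip_sum_le GH H0) => //.
  - by move=> i; apply: (in_spaceB GH); exact: hY.
  - by move=> i; exact: cauchy.
apply/funext => w; rewrite /X opprD addrACA subrr add0r -sumrB.
by apply: eq_bigr => i _; rewrite mulrBr.
Unshelve. all: end_near. Qed.

End nondegeneracy.

Lemma finite_threshold (R : realType) (I : finType) (Q : I -> R -> Prop) :
  (forall i r r', r <= r' -> Q i r' -> Q i r) ->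
  (forall i, exists2 r : R, 0 < r & Q i r) -> exists2 r : R, 0 < r & forall i, Q i r.
Proof.
move=> mono ex.
suff [r r0 h] : exists2 r : R, 0 < r & forall i, i \in enum I -> Q i r.
  by exists r => // i; apply: h; rewrite mem_enum.
elim: (enum I) => [|i s [r r0 IH]]; first by exists 1.
have [r' r'0 hr'] := ex i.
exists (Num.min r r'); first by rewrite lt_min r0.
move=> k; rewrite inE => /orP[/eqP ->|/IH]; last by apply: mono; rewrite ge_min lexx.
by apply: mono hr'; rewrite ge_min lexx orbT.
Qed.

(** * The Gaussian space of the field and the choice of the step *)

Section field_space.
Context {d : measure_display} {T : measurableType d} {R : realType} {n m : nat}.
Variables (P : probability T R) (U : set 'rV[R]_n) (F : T -> 'rV[R]_n -> 'rV[R]_m).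
Hypothesis GF : centered_gaussian_field P U F.

(** The span of the field values on [U], in the form for which the hypothesis on [F] gives
    Gaussianity. No closure is taken; derivatives enter only as limits of members. *)
Definition field_space : set (T -> R) :=
  [set X | exists k (xs : 'I_k -> 'rV[R]_n) (idx : 'I_k -> 'I_m) (c : 'I_k -> R),
    (forall l, U (xs l)) /\ X = (fun w => \sum_(l < k) c l * F w (xs l) ord0 (idx l))].

Lemma field_space_gaussian : gaussian_space P field_space.
Proof.
split=> [_ _ [k [xs [idx [c [hU ->]]]]] [k' [xs' [idx' [c' [hU' ->]]]]]|a _ [k [xs [idx [c [hU ->]]]]]|
         _ [k [xs [idx [c [hU ->]]]]]].
- exists (k + k')%N, (fun l => match fintype.split l with inl i => xs i | inr i => xs' i end),
   (fun l => match fintype.split l with inl i => idx i | inr i => idx' i end),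
   (fun l => match fintype.split l with inl i => c i | inr i => c' i end); split.
    by move=> l; case: fintype.split.
  apply/funext => w; rewrite big_split_ord /=; congr (_ + _); apply: eq_bigr => i _.
    by rewrite -[lshift _ _]/(unsplit (inl i)) unsplitK.
  by rewrite -[rshift _ _]/(unsplit (inr i)) unsplitK.
- exists k, xs, idx, (fun l => a * c l); split => //.
  by apply/funext => w; rewrite mulr_sumr; apply: eq_bigr => i _; rewrite mulrA.
- exact: GF.
Qed.

Lemma field_space0 : field_space (fun=> 0).
Proof.
exists 0%N, (fun=> 0), (fun l : 'I_0 => False_rect _ (notF (valP l))), (fun=> 0).
by split => [[]//|]; apply/funext => w; rewrite big_ord0.
Qed.

Lemma field_space_fcomp i x : U x -> field_space (fun w => fcomp F i w x).
Proof.
move=> Ux; exists 1%N, (fun=> x), (fun=> i), (fun=> 1); split => //.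
by apply/funext => w; rewrite big_ord1 mul1r.
Qed.

Lemma covKE i1 i2 : covK P F i1 i2 = fun x y => ip P (fun w => fcomp F i1 w x) (fun w => fcomp F i2 w y).
Proof. by apply/funext => x; apply/funext => y; rewrite /covK unlock. Qed.

End field_space.

Section good_step.
Context {d : measure_display} {T : measurableType d} {R : realType} {n m : nat}.
Variables (P : probability T R) (r M k1 : R) (F : T -> 'rV[R]_n -> 'rV[R]_m).
Hypothesis GF : centered_gaussian_field P (cube n (r + 1)) F.
Hypothesis A1 : assumption_A1 P r k1 F.
Hypothesis A2 : assumption_A2 P r M F.
Notation H := (field_space (cube n (r + 1)) F).
Notation ip := (ip P).
Notation GH := (field_space_gaussian GF).
Notation H0 := (@field_space0 _ _ _ _ _ (cube n (r + 1)) F).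
Implicit Types (c : 'rV[R]_n) (h : R) (i : 'I_m) (j l : 'I_n).

Definition fd1 c h i j (w : T) : R := fd j h (fcomp F i w) c.

Definition fd2 c h i j l (w : T) : R := fd j h (fd l h (fcomp F i w)) c.

Definition first_order c h (eta : 'I_m -> R) (xi : 'I_m -> 'I_n -> R) (w : T) : R :=
  \sum_i eta i * fcomp F i w c + \sum_i \sum_j xi i j * fd1 c h i j w.

(** All that the ball estimate needs to know about the law at the centre [c]. The bounds [k] and [v]
    will be uniform in [c], while no lower bound on [h] is claimed. The restriction to j <= l loses
    nothing, since quotients commute. *)
Definition good_step c h (k v : R) :=
  [/\ (forall i j, H (fd1 c h i j) /\ ip (fd1 c h i j) (fd1 c h i j) <= v),
      (forall i j l, (j <= l)%N -> H (fd2 c h i j l) /\ ip (fd2 c h i j l) (fd2 c h i j l) <= v) &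
      (forall eta xi, k * (\sum_i eta i ^+ 2 + \sum_i \sum_j xi i j ^+ 2) <=
         ip (first_order c h eta xi) (first_order c h eta xi))].

Lemma fdl_variance_bounded c s i (D : T -> R) : cube n r c ->
  sorted (fun j l => (j <= l)%N) s -> (size s <= 3)%N ->
  {ae P, forall w, forall eta : R, 0 < eta -> exists2 e : R, 0 < e &
     forall hs, step_ok s e hs -> `|fdl s hs (fcomp F i w) c - D w| <= eta} ->
  exists2 e : R, 0 < e & forall hs, step_ok s e hs ->
    ip (fun w => fdl s hs (fcomp F i w) c) (fun w => fdl s hs (fcomp F i w) c) <= 2 * M + 2.
Proof.
move=> hc ss sz; have hU x : `|x - c| < 1 -> cube n (r + 1) x by exact: cube_shift.
have [_ /(_ i i (fun a => count_mem a s))] := A2.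
rewrite mi_order_count sz covKE mi_dirs_count// => /(_ isT)[a1 a2 a3].
have Uc : cube n (r + 1) c by apply: hU; rewrite subrr normr0.
apply: (fdl_variance_le GH H0 (fun x => @field_space_fcomp _ _ _ _ _ _ F i x) ltr01 hU) => //.
exact: le_trans (ler_norm _) (a3 c Uc).
Qed.

Lemma exists_good_step c (e0 : R) : cube n r c -> 0 < e0 ->
  exists2 h, 0 < h <= e0 & good_step c h (k1 / 4) (2 * M + 2).
Proof.
move=> hc e00; have hU x : `|x - c| < 1 -> cube n (r + 1) x by exact: cube_shift.
have Uc : cube n (r + 1) c by apply: hU; rewrite subrr normr0.
have [k10 hA1] := A1; have [hC _] := A2.
have cv1 i j : {ae P, forall w, forall eta : R, 0 < eta -> exists2 e : R, 0 < e &
    forall hs, step_ok [:: j] e hs -> `|fdl [:: j] hs (fcomp F i w) c - pd j (fcomp F i w) c| <= eta}.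
  apply: filterS (hC i) => w [dg ddg _ _] eta eta0.
  apply: (fd1_near ltr01 eta0); first by move=> y /hU; exact: dg.
  by apply: differentiable_continuous; exact: ddg.
have cv2 i j l : {ae P, forall w, forall eta : R, 0 < eta -> exists2 e : R, 0 < e &
    forall hs, step_ok [:: j; l] e hs ->
      `|fdl [:: j; l] hs (fcomp F i w) c - pd l (pd j (fcomp F i w)) c| <= eta}.
  apply: filterS (hC i) => w [dg ddg dc _] eta eta0.
  apply: (fd2_near ltr01 eta0); first by move=> y /hU; exact: dg.
    by move=> y /hU; exact: ddg.
  exact: dc.
have [r1 r10 v1] : exists2 e : R, 0 < e & forall (p : 'I_m * 'I_n) hs, step_ok [:: p.2] e hs ->
    ip (fun w => fdl [:: p.2] hs (fcomp F p.1 w) c) (fun w => fdl [:: p.2] hs (fcomp F p.1 w) c) <= 2 * M + 2.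
  apply: finite_threshold => [p e e' ee' h hs ok|[i j]]; first exact/h/(step_okW ee').
  exact: fdl_variance_bounded (cv1 i j).
have [r2 r20 v2] : exists2 e : R, 0 < e & forall (p : 'I_m * 'I_n * 'I_n), (p.1.2 <= p.2)%N ->
    forall hs, step_ok [:: p.1.2; p.2] e hs ->
    ip (fun w => fdl [:: p.1.2; p.2] hs (fcomp F p.1.1 w) c)
       (fun w => fdl [:: p.1.2; p.2] hs (fcomp F p.1.1 w) c) <= 2 * M + 2.
  apply: finite_threshold => [p e e' ee' h jl hs ok|[[i j] l]]; first exact/(h jl)/(step_okW ee').
  rewrite /=; case: (leqP j l) => [jl|_]; last by exists 1.
  have [||e e1 h] := @fdl_variance_bounded c [:: j; l] i _ hc _ _ (cv2 i j l) => //.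
    by rewrite /= jl.
  by exists e.
pose N : R := #|{: 'I_m * 'I_n}|%:R.
(* This tolerance gives N^2 e <= k1/4, so that k1 <= 2 ip + 2 N^2 e leaves ip >= k1/4. *)
pose e : R := k1 / (4 * (N ^+ 2 + 1)).
have N0 : 0 < N ^+ 2 + 1 by rewrite ltr_wpDl ?sqr_ge0.
have e_0 : 0 < e by rewrite divr_gt0// mulr_gt0.
have d00 : (0 : R) < 3^-1 by rewrite invr_gt0.
have hin s hs p : (size s <= 2)%N -> step_ok s 3^-1 hs -> p \in fdl_points s hs c -> cube n (r + 1) p.2.
  move=> sz ok; apply: (fdl_points_in ltr01 hU); apply: step_okW ok.
  by rewrite div1r lef_pV2 ?posrE ?ltr0n// (ler_nat _ _ 3).
have hH i s hs : (size s <= 2)%N -> step_ok s 3^-1 hs -> H (fun w => fdl s hs (fcomp F i w) c).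
  move=> sz ok; apply: (in_space_fdl GH H0 (fun x => @field_space_fcomp _ _ _ _ _ _ F i x)).
  by move=> p; exact: hin.
have [r3 r30 v3] : exists2 e' : R, 0 < e' & forall (p : 'I_m * 'I_n) hs hs',
    step_ok [:: p.2] e' hs -> step_ok [:: p.2] e' hs' -> 
    ip (fun w => fdl [:: p.2] hs (fcomp F p.1 w) c - fdl [:: p.2] hs' (fcomp F p.1 w) c)
       (fun w => fdl [:: p.2] hs (fcomp F p.1 w) c - fdl [:: p.2] hs' (fcomp F p.1 w) c) <= e.
  apply: finite_threshold => [p e' e'' ee h hs hs' ok1 ok2|[i j]].
    by apply: h; [exact: step_okW ok1|exact: step_okW ok2].
  have [|e' /andP[e'0 _] h] := @ip_cauchy _ _ _ P H (seq R) (step_ok [:: j])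
    (fun hs w => fdl [:: j] hs (fcomp F i w) c) _ 3^-1 e GH e_0 d00 _ (cv1 i j)
    (fun a b hs => @step_okW _ _ [:: j] a b hs).
    by move=> e' hs ee ok; apply: hH => //; exact: step_okW ok.
  by exists e'.
pose h := Num.min (Num.min e0 3^-1) (Num.min r1 (Num.min r2 r3)).
have h0 : 0 < h by rewrite !lt_min e00 d00 r10 r20 r30.
have [he h3 hr1 hr2 hr3] : [/\ h <= e0, h <= 3^-1, h <= r1, h <= r2 & h <= r3].
  by split; rewrite !ge_min lexx ?orbT.
clearbody h; exists h; first by rewrite h0.
have ok1 j (e' : R) : h <= e' -> step_ok [:: j] e' [:: h].
  by move=> he'; split => // z; rewrite inE => /eqP ->; rewrite h0.
have ok2 j l (e' : R) : h <= e' -> step_ok [:: j; l] e' [:: h; h].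
  by move=> he'; split => // z; rewrite !inE => /orP[] /eqP ->; rewrite h0.
have H1 t i j : 0 < t <= 3^-1 -> H (fd1 c t i j).
  move=> /andP[t0 t3]; apply: (hH i [:: j] [:: t]) => //.
  by split => // z; rewrite inE => /eqP ->; rewrite t0.
split.
- move=> i j; split; first by apply: H1; rewrite h0.
  exact: (v1 (i, j) [:: h] (ok1 j _ hr1)).
- move=> i j l jl; split; first exact: (hH i [:: j; l] [:: h; h] isT (ok2 j l _ h3)).
  exact: (v2 (i, j, l) jl [:: h; h] (ok2 j l _ hr2)).
have Hfo eta xi : H (first_order c h eta xi).
  have [HD _ _] := GH; apply: HD.
    by apply: (in_space_sum GH H0) => i _; exact: field_space_fcomp.
  rewrite (_ : (fun w => _) = fun w => \sum_(p : 'I_m * 'I_n) xi p.1 p.2 * fd1 c h p.1 p.2 w).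
    by apply: (in_space_sum GH H0) => p _; apply: H1; rewrite h0.
  by apply/funext => w; rewrite (pair_bigA _ (fun i j => xi i j * fd1 c h i j w)).
have unit eta xi : \sum_i eta i ^+ 2 + \sum_i \sum_j xi i j ^+ 2 = 1 ->
    k1 / 4 <= ip (first_order c h eta xi) (first_order c h eta xi).
  move=> E1.
  have E1' := E1; rewrite (pair_bigA _ (fun i j => xi i j ^+ 2)) /= in E1'.
  have xi1 (p : 'I_m * 'I_n) : `|xi p.1 p.2| <= 1.
    rewrite -(@expr_le1 _ 2)// real_normK ?num_real// -E1' (bigD1 p)//=.
    rewrite addrCA lerDl addr_ge0// sumr_ge0// => *; exact: sqr_ge0.
  pose r' := Num.min r3 3^-1.
  have r'0 : 0 < r' by rewrite lt_min r30 d00.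
  have hr' : 0 < h <= r' by rewrite h0 le_min hr3 h3.
  pose A w := \sum_i eta i * fcomp F i w c.
  have hA : H A by apply: (in_space_sum GH H0) => i _; exact: field_space_fcomp.
  have step t j : 0 < t <= r' -> step_ok [:: j] r3 [:: t].
    rewrite le_min => /andP[t0 /andP[t1 t2]].
    by split => // z; rewrite inE => /eqP ->; rewrite t0.
  have hE : first_order c h eta xi = (fun w => A w + \sum_(p : 'I_m * 'I_n) xi p.1 p.2 * fd1 c h p.1 p.2 w).
    by apply/funext => w; rewrite /first_order/= (pair_bigA _ (fun i j => xi i j * fd1 c h i j w)).
  have : k1 <= 2 * ip (first_order c h eta xi) (first_order c h eta xi) + 2 * (N ^+ 2 * e).
    rewrite hE; apply: (@nondegenerate_limit _ _ _ P H GH H0 ('I_m * 'I_n)%type A (fun t p => fd1 c t p.1 p.2)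
      (fun p w => pd p.2 (fcomp F p.1 w) c) (fun p => xi p.1 p.2) k1 r' e r'0 (ltW e_0) hA) => //.
    - move=> t p; rewrite le_min => /andP[t0 /andP[_ t3]]; apply: H1; by rewrite t0.
    - have : {ae P, forall w, forall p : 'I_m * 'I_n, (fun p w => forall eta : R, 0 < eta -> exists2 e : R, 0 < e &
        forall hs, step_ok [:: p.2] e hs -> `|fdl [:: p.2] hs (fcomp F p.1 w) c - pd p.2 (fcomp F p.1 w) c| <= eta) p w}.
        by apply: filter_forall => p; exact: cv1.
      apply: filterS => w hw p et et0; have [e' e'0 he'] := hw p _ et0.
      exists e' => // t t01; apply: (he' [:: t]); split => // z; by rewrite inE => /eqP ->.
    - move=> t t' p ht ht'; exact: (v3 p [:: t] [:: t'] (step _ _ ht) (step _ _ ht')).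
    - have := hA1 c Uc (\row_i eta i) (\matrix_(i, j) xi i j).
      under eq_bigr do rewrite mxE.
      under [X in _ + X]eq_bigr do under eq_bigr do rewrite mxE.
      move=> /(_ E1) /le_trans; apply; rewrite unlock le_eqVlt; apply/orP; left; apply/eqP.
      apply: eq_integral => w _; congr (_ ^+ 2)%:E; congr (_ + _).
        by apply: eq_bigr => i _; rewrite mxE.
      rewrite (pair_bigA _ (fun i j => (\matrix_(i, j) xi i j) i j * pd j (fcomp F i w) c)).
      by apply: eq_bigr => p _; rewrite mxE.
  have : N ^+ 2 * e <= k1 / 4.
    have -> : N ^+ 2 * e = k1 / 4 * (N ^+ 2 / (N ^+ 2 + 1)) by rewrite /e invfM; ring.
    rewrite ler_piMr ?divr_ge0 ?(ltW k10)// ler_pdivrMr// mul1r lerDl.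
    exact: ler01.
  lra.
move=> eta xi; set s := _ + _.
have s0 : 0 <= s.
  by apply: addr_ge0; apply: sumr_ge0 => i _; [exact: sqr_ge0|apply: sumr_ge0 => j _; exact: sqr_ge0].
have [->|sn0] := eqVneq s 0; first by rewrite mulr0 ipXX_ge0.
have sp : 0 < s by rewrite lt_neqAle eq_sym sn0.
(* (A1) concerns unit vectors; the general case follows by homogeneity. *)
pose t := (Num.sqrt s)^-1.
have t2 : t ^+ 2 = s^-1 by rewrite /t exprVn sqr_sqrtr.
have E : first_order c h (fun i => t * eta i) (fun i j => t * xi i j) = fun w => t * first_order c h eta xi w.
  apply/funext => w; rewrite /first_order mulrDr !mulr_sumr; congr (_ + _).
    by apply: eq_bigr => i _; rewrite mulrA.
  apply: eq_bigr => i _; rewrite mulr_sumr; apply: eq_bigr => j _.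
  exact/esym/mulrA.
have := unit (fun i => t * eta i) (fun i j => t * xi i j).
rewrite E (ipZl GH); [|exact: Hfo|by have [_ HZ _] := GH; apply: HZ].
rewrite (ipZr GH)// mulrA -expr2 t2.
have -> : \sum_i (t * eta i) ^+ 2 + \sum_i \sum_j (t * xi i j) ^+ 2 = s^-1 * s.
  rewrite -t2 /s mulrDr !mulr_sumr; congr (_ + _); first by apply: eq_bigr => i _; rewrite exprMn.
  by apply: eq_bigr => i _; rewrite mulr_sumr; apply: eq_bigr => j _; rewrite exprMn.
rewrite mulVf ?gt_eqF// => /(_ erefl).
by rewrite (mulrC s^-1) ler_pdivlMr.
Qed.

End good_step.

(** * Probability of a nearly critical cell *)

Section lists_of_variables.
Context {d : measure_display} {T : measurableType d} {R : realType}.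
Implicit Types (H : set (T -> R)).

Lemma in_space_map H (I : eqType) (q : seq I) (X : I -> T -> R) :
  (forall i, i \in q -> H (X i)) -> in_space H (map X q).
Proof.
move=> hX k; rewrite size_map; case: q hX => // i0 q hX kq.
by rewrite (nth_map i0)//; apply: hX; exact: mem_nth.
Qed.

Lemma in_space_cat H us vs : in_space H us -> in_space H vs -> in_space H (us ++ vs).
Proof.
move=> hu hv k; rewrite size_cat nth_cat => kq; case: ltnP => hk; first exact: hu.
by apply: hv; rewrite ltn_subLR.
Qed.

End lists_of_variables.

Section lin_map.
Context {d : measure_display} {T : measurableType d} {R : realType}.

Lemma lin_cat (c c' : seq R) (us vs : seq (T -> R)) w : size c = size us ->
  lin (c ++ c') (us ++ vs) w = lin c us w + lin c' vs w.
Proof.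
elim: c us => [|a c IH] [|u us]//= => [_|[sz]]; first by rewrite add0r.
by rewrite IH// addrA.
Qed.

Lemma lin_map (I : eqType) (q : seq I) (X : I -> T -> R) (c : seq R) : uniq q -> size c = size q ->
  exists2 a : I -> R, \sum_(x <- c) x ^+ 2 = \sum_(i <- q) a i ^+ 2 &
    forall w, lin c (map X q) w = \sum_(i <- q) a i * X i w.
Proof.
elim: q c => [|i q IH] [|b c]//=.
  by exists (fun=> 0) => [|w]; rewrite !big_nil.
move=> /andP[iq uq] [sz]; have [a E1 E2] := IH c uq sz.
have aE k : k \in q -> (if k == i then b else a k) = a k.
  by move=> kq; case: eqP => // ki; rewrite ki (negbTE iq) in kq.
exists (fun k => if k == i then b else a k) => [|w].
  rewrite !big_cons eqxx E1; congr (_ + _); apply: eq_big_seq => k kq; by rewrite aE.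
rewrite big_cons eqxx E2; congr (_ + _); apply: eq_big_seq => k kq; by rewrite aE.
Qed.

End lin_map.

Section event.
Context {d : measure_display} {T : measurableType d} {R : realType} {n m : nat}.
Variables (P : probability T R) (r : R) (F : T -> 'rV[R]_n -> 'rV[R]_m).
Notation U := (cube n (r + 1)).
Hypothesis GF : centered_gaussian_field P U F.
Notation H := (field_space U F).
Notation ip := (ip P).
Notation GH := (field_space_gaussian GF).
Notation H0 := (@field_space0 _ _ _ _ _ U F).
Implicit Types (c : 'rV[R]_n) (h : R) (lam : 'I_m -> R).

Definition step_norms c h : seq (T -> R) :=
  [seq fd1 F c h p.1 p.2 | p <- enum {: 'I_m * 'I_n}] ++
  [seq fd2 F c h p.1.1 p.1.2 p.2 | p <- enum [pred p : 'I_m * 'I_n * 'I_n | (p.1.2 <= p.2)%N]].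

Definition step_norms_size := (#|{: 'I_m * 'I_n}| + #|[pred p : 'I_m * 'I_n * 'I_n | (p.1.2 <= p.2)%N]|)%N.

Definition constraints c h (j0 : 'I_n) lam : seq (T -> R) :=
  [seq (fun w => fcomp F i w c) | i <- enum 'I_m] ++
  [seq (fun w => \sum_i lam i * fd1 F c h i j w) | j <- enum (predC1 j0)].

Lemma size_step_norms c h : size (step_norms c h) = step_norms_size.
Proof. by rewrite /step_norms size_cat; congr (_ + _)%N; rewrite size_map -cardE. Qed.

Lemma size_constraints c h (j0 : 'I_n) lam : size (constraints c h j0 lam) = (m + n.-1)%N.
Proof. rewrite /constraints size_cat; congr (_ + _)%N; rewrite size_map -cardE ?card_ord//.
by rewrite cardC1 card_ord. Qed.

Definition near_critical c h (j0 : 'I_n) lam (t : R) : set T :=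
  [set w | small_all (t * (1 + sum_norms (step_norms c h) w)) (constraints c h j0 lam) w].

Variables (c : 'rV[R]_n) (h k v : R) (j0 : 'I_n) (lam : 'I_m -> R) (i0 : 'I_m).
Hypotheses (Uc : U c) (k0 : 0 < k) (v0 : 0 <= v) (lam0 : lam i0 = 1).
Hypothesis good : good_step P r F c h k v.

Lemma step_norms_in_space : in_space H (step_norms c h).
Proof.
have [g1 g2 _] := good.
apply: in_space_cat; apply: in_space_map => p; first by move=> _; have [] := g1 p.1 p.2.
by rewrite mem_enum inE => /g2 -/(_ p.1.1)[].
Qed.

Lemma constraints_in_space : in_space H (constraints c h j0 lam).
Proof.
have [g1 _ _] := good.
apply: in_space_cat; apply: in_space_map => p _; first exact: field_space_fcomp.
by apply: (in_space_sum GH H0) => i _; have [] := g1 i p.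
Qed.

(** A combination with coefficients [a1] and [a2] is a first order form whose matrix is
    [a2 j * lam i] off column [j0]. Since [lam i0 = 1], row [i0] of this matrix is [a2] itself, so
    the squared norm does not drop and the same [k] works for every [lam]. *)
Lemma constraints_nondegenerate : nondegenerate P k (constraints c h j0 lam).
Proof.
have [_ _ g] := good.
move=> a; rewrite size_constraints => sz.
have s1 : size (take m a) = m by rewrite size_takel// sz leq_addr.
have s2 : size (drop m a) = n.-1 by rewrite size_drop sz addKn.
have [|a1 E1 L1] := @lin_map _ T R _ (enum 'I_m) (fun i w => fcomp F i w c) (take m a) (enum_uniq _).
  by rewrite s1 -cardE card_ord.
have [|a2 E2 L2] := @lin_map _ T R _ (enum (predC1 j0)) (fun j w => \sum_i lam i * fd1 F c h i j w)
  (drop m a) (enum_uniq _).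
  by rewrite s2 -cardE cardC1 card_ord.
rewrite -(cat_take_drop m a) big_cat /= E1 E2.
pose xi i j := if j == j0 then 0 else a2 j * lam i.
have -> : lin (take m a ++ drop m a) (constraints c h j0 lam) = first_order F c h a1 xi.
  apply/funext => w; rewrite lin_cat; last by rewrite size_map -cardE card_ord.
  rewrite L1 L2 !big_enum /first_order; congr (_ + _).
  rewrite exchange_big /= [RHS](bigD1 j0)//= [X in _ = X + _]big1 ?add0r; last first.
    by move=> i _; rewrite /xi eqxx mul0r.
  apply: eq_bigr => j jj0; rewrite mulr_sumr; apply: eq_bigr => i _.
  rewrite /xi (negbTE jj0); exact: mulrA.
apply: le_trans (g a1 xi); rewrite ler_pM2l// !big_enum lerD2l /=.
rewrite exchange_big /= [leRHS](bigD1 j0)//= [X in _ <= X + _]big1 ?add0r; last first.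
  by move=> i _; rewrite /xi eqxx expr0n.
apply: ler_sum => j jj0; rewrite (bigD1 i0)//= /xi (negbTE jj0) lam0 mulr1 lerDl.
by apply: sumr_ge0 => i _; exact: sqr_ge0.
Qed.

Lemma measurable_near_critical (t : R) : measurable (near_critical c h j0 lam t).
Proof.
apply: (measurable_small_all GH _ constraints_in_space).
apply: measurable_funM => //; apply: measurable_funD => //.
exact: (measurable_sum_norms GH step_norms_in_space).
Qed.

Lemma prob_near_critical (t : R) : 0 < t ->
  (m + n.-1)%:R * ((1 + v / k) * (step_norms_size.+1%:R * t)) <= 2^-1 ->
  (P (near_critical c h j0 lam t) <= (step_norms_size.+1%:R *
     (ball_cst (m + n.-1) k (4 * v) * (step_norms_size.+1%:R * t) ^+ (m + n.-1)))%:E)%E.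
Proof.
move=> t0 ht.
have := @small_ball_random_radius _ _ _ P H GH H0 (constraints c h j0 lam) (step_norms c h) k t v k0 t0 v0.
rewrite size_constraints size_step_norms; apply => //.
- by rewrite addn_gt0 (leq_ltn_trans (leq0n _) (ltn_ord i0)).
- exact: constraints_in_space.
- exact: constraints_nondegenerate.
- exact: step_norms_in_space.
have [g1 g2 _] := good.
have : in_space [set X | ip X X <= v] (step_norms c h).
  apply: in_space_cat; apply: in_space_map => p; first by move=> _; have [] := g1 p.1 p.2.
  by rewrite mem_enum inE => /g2 -/(_ p.1.1)[].
by move=> + i; rewrite -(size_step_norms c h); apply.
Qed.

End event.

(** * Covering the components by cells *)

From mathcomp Require Import finmap.

Section grid.
Context {R : realType}.
Implicit Types (r e a b : R).

Lemma near_div_lt a b : 0 < b -> \forall k \near \oo, (0 < k)%N /\ a / k%:R < b.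
Proof.
move=> b0; exists (Num.truncn (`|a| / b)).+1 => // k /= Nk.
have k0 : (0 < k)%N by exact: leq_trans Nk.
split => //; rewrite ltr_pdivrMr ?ltr0n// mulrC -ltr_pdivrMr//.
apply: le_lt_trans (_ : `|a| / b < _); first by rewrite ler_wpM2r ?invr_ge0 ?ler_norm// ltW.
by apply: lt_le_trans (truncnS_gt _) _; rewrite ler_nat.
Qed.

Lemma near_seq (I : eqType) (s : seq I) (Q : I -> nat -> Prop) :
  (forall i, i \in s -> \forall k \near \oo, Q i k) -> \forall k \near \oo, forall i, i \in s -> Q i k.
Proof.
elim: s => [|i s IH] hQ; first by near=> k.
have h1 := hQ i (mem_head _ _).
have h2 := IH (fun j js => hQ j (mem_behead (s := i :: s) js)).
by apply: filterS2 h1 h2 => k hi hs j; rewrite inE => /orP[/eqP ->|/hs].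
Unshelve. all: end_near. Qed.

Definition center n r k (q : {ffun 'I_n -> 'I_k}) : 'rV[R]_n :=
  \row_j (- r + ((q j)%:R + 2^-1) * (2 * r / k%:R)).

Lemma center_cube n r k (q : {ffun 'I_n -> 'I_k}) : 0 < r -> cube n r (center r q).
Proof.
move=> r0 j; have kq := ltn_ord (q j).
have k0 : (0 : R) < k%:R by rewrite ltr0n (leq_ltn_trans _ kq).
have e0 : 0 < 2 * r / k%:R by rewrite divr_gt0// mulr_gt0.
have ke : k%:R * (2 * r / k%:R) = 2 * r by rewrite mulrC divfK// gt_eqF.
have q0 : (0 : R) <= (q j)%:R by [].
have q1 : (q j)%:R + 1 <= k%:R :> R by rewrite natr1 ler_nat.
rewrite mxE; apply/andP; split; first by rewrite ltrDl mulr_gt0// ltr_wpDl.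
have : ((q j)%:R + 2^-1) * (2 * r / k%:R) < k%:R * (2 * r / k%:R) by rewrite ltr_pM2r//; lra.
by rewrite ke; lra.
Qed.

Lemma exists_center n r k (x : 'rV[R]_n) : (0 < k)%N -> 0 < r -> cube n r x ->
  exists q : {ffun 'I_n -> 'I_k}, `|center r q - x| <= 2 * r / k%:R.
Proof.
move=> k0' r0 hx.
have k0 : (0 : R) < k%:R by rewrite ltr0n.
have e0 : 0 < 2 * r / k%:R by rewrite divr_gt0// mulr_gt0.
pose t j := (x ord0 j + r) / (2 * r / k%:R).
have tb j : 0 <= t j < k%:R.
  have /andP[h1 h2] := hx j; apply/andP; split; first by rewrite divr_ge0 ?(ltW e0)//; lra.
  rewrite ltr_pdivrMr// mulrC divfK ?gt_eqF//; lra.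
have tq j : (Num.truncn (t j) < k)%N.
  have /andP[t0 tk] := tb j; rewrite -(ltr_nat R); apply: le_lt_trans tk.
  by rewrite truncn_le.
exists [ffun j => Ordinal (tq j)].
apply: mx_norm_le => [|i j]; first exact: ltW.
rewrite ord1 !mxE ffunE /=.
have -> : - r + ((Num.truncn (t j))%:R + 2^-1) * (2 * r / k%:R) - x ord0 j =
   ((Num.truncn (t j))%:R + 2^-1 - t j) * (2 * r / k%:R).
  by rewrite [RHS]mulrBl [t j * _]divfK ?gt_eqF//; ring.
rewrite normrM (gtr0_norm e0) ler_piMl ?(ltW e0)//.
have /andP[t0 tk] := tb j.
have := truncnS_gt (t j); rewrite -natr1.
have : (Num.truncn (t j))%:R <= t j by rewrite truncn_le.
by rewrite ler_norml; lra.
Qed.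

(** Entry [i0] is pinned to 1, which saves one power of the mesh. The others range over [p.+1]
    points of [-1, 1], both ends included. *)
Definition grid_form m p (i0 : 'I_m.+1) (g : {ffun 'I_m -> 'I_p.+1}) (i : 'I_m.+1) : R :=
  if unlift i0 i is Some l then - 1 + (g l)%:R * (2 / p%:R) else 1.

Lemma grid_form_id m p i0 (g : {ffun 'I_m -> 'I_p.+1}) : grid_form i0 g i0 = 1.
Proof. by rewrite /grid_form unlift_none. Qed.

Lemma exists_grid_form m p (i0 : 'I_m.+1) (lam : 'I_m.+1 -> R) : (0 < p)%N ->
  lam i0 = 1 -> (forall i, `|lam i| <= 1) ->
  exists g : {ffun 'I_m -> 'I_p.+1}, forall i, `|grid_form i0 g i - lam i| <= 2 / p%:R.
Proof.
move=> p0' l0 l1.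
have p0 : (0 : R) < p%:R by rewrite ltr0n.
have e0 : 0 < 2 / p%:R :> R by rewrite divr_gt0.
pose t l := (lam (lift i0 l) + 1) / (2 / p%:R).
have tb l : 0 <= t l <= p%:R.
  have := l1 (lift i0 l); rewrite ler_norml => /andP[h1 h2]; apply/andP; split.
    by rewrite divr_ge0 ?(ltW e0)//; lra.
  rewrite ler_pdivrMr// mulrC divfK ?gt_eqF//; lra.
have tq l : (Num.truncn (t l) < p.+1)%N.
  have /andP[t0 tk] := tb l; rewrite ltnS -(ler_nat R); apply: le_trans tk.
  by rewrite truncn_le.
exists [ffun l => Ordinal (tq l)] => i; rewrite /grid_form.
case: unliftP => [l ->|->]; last by rewrite l0 subrr normr0 ltW.
rewrite ffunE /=.
have -> : - 1 + (Num.truncn (t l))%:R * (2 / p%:R) - lam (lift i0 l) =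
   ((Num.truncn (t l))%:R - t l) * (2 / p%:R).
  by rewrite [RHS]mulrBl [t l * _]divfK ?gt_eqF//; ring.
rewrite normrM (gtr0_norm e0) ler_piMl ?(ltW e0)//.
have /andP[t0 tk] := tb l.
have := truncnS_gt (t l); rewrite -natr1.
have : (Num.truncn (t l))%:R <= t l by rewrite truncn_le.
by rewrite ler_norml; lra.
Qed.

End grid.

Lemma sum1_le_indic (R : realType) (X : choiceType) (T : Type) (I : finType) (A : set X) (E : I -> set T) (w : T) (f : X -> I) :
  finite_set A -> {in A &, injective f} -> (forall S, A S -> E (f S) w) ->
  (\sum_(S \in A) (1%:E : \bar R) <= \sum_(i : I) (\1_(E i) w)%:E)%E.
Proof.
move=> finA injf fE.
rewrite fsbig_finite//=.
have finE S : S \in fset_set A -> A S by rewrite in_fset_set// => /set_mem.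
have -> : (\sum_(S <- fset_set A) (1%:E : \bar R) = \sum_(i <- map f (fset_set A)) (\1_(E i) w)%:E)%E.
  rewrite big_map; apply: eq_big_seq => S /finE AS.
  by rewrite indicE mem_set//; exact: fE.
rewrite big_uniq /=; last first.
  rewrite map_inj_in_uniq ?fset_uniq// => S S' /finE AS /finE AS'.
  by apply: injf; exact: mem_set.
rewrite big_mkcond; apply: lee_sum => i _; case: ifP => // _.
Qed.

Section inner_components.
Context {R : realType} {n m : nat}.
Implicit Types (G : 'rV[R]_n -> 'rV[R]_m) (r : R).

Lemma inner_components_inj r G S S' x : inner_components r G S -> inner_components r G S' ->
  S x -> S' x -> S = S'.
Proof.
move=> [y _ [-> _]] [y' _ [-> _]] h h'.
by rewrite (same_connected_component h) (same_connected_component h').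
Qed.

End inner_components.

Section covering.
Context {d : measure_display} {T : measurableType d} {R : realType} {n m' : nat}.
Notation m := m'.+1.
Variables (F : T -> 'rV[R]_n -> 'rV[R]_m) (r : R) (j0 : 'I_n).
Hypothesis r0 : 0 < r.
Variable step : R -> 'rV[R]_n -> R.
Hypothesis step_gt0 : forall e c, 0 < e -> cube n r c -> 0 < step e c <= e.

(** The constant of [taylor_critical]: 2n bounds the values and m (2n + 1) the derivative forms;
    their sum serves as a common threshold. *)
Definition critical_cst : R := 2 * n%:R + m%:R * (2 * n%:R + 1).

Definition mesh k : R := 2 * r / k%:R.

Definition fineness k := (Num.truncn (2 / mesh k)).+1.

(** A cube of the subdivision together with the index of the normalised entry of [lam] and a grid
    value for the other entries. *)
Definition cell k : Type := {ffun 'I_n -> 'I_k} * ('I_m * {ffun 'I_m' -> 'I_(fineness k).+1}).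

HB.instance Definition _ k := Finite.copy (cell k) ({ffun 'I_n -> 'I_k} * ('I_m * {ffun 'I_m' -> 'I_(fineness k).+1}))%type.

Definition cell_event k (q : cell k) : set T :=
  near_critical F (center r q.1) (step (mesh k) (center r q.1)) j0 (grid_form q.2.1 q.2.2)
    (critical_cst * mesh k).

Lemma mesh_gt0 k : (0 < k)%N -> 0 < mesh k.
Proof. by move=> k0; rewrite divr_gt0 ?ltr0n// mulr_gt0. Qed.

Lemma fineness_mesh k : (0 < k)%N -> 2 / (fineness k)%:R <= mesh k.
Proof.
move=> k0; rewrite ler_pdivrMr ?ltr0n// mulrC -ler_pdivrMr ?mesh_gt0//.
exact/ltW/truncnS_gt.
Qed.

Lemma sum_norms_ge (I : eqType) (s1 s2 : seq (T -> R)) (q : seq I) (X : I -> T -> R) i w : i \in q ->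
  `|X i w| <= sum_norms (s1 ++ map X q ++ s2) w.
Proof.
move=> iq; rewrite /sum_norms !big_cat /=.
have ge0 s : 0 <= \sum_(W <- s) `|(W : T -> R) w| by apply: sumr_ge0.
rewrite addrCA ler_wpDr ?addr_ge0// big_map.
by rewrite (big_rem i)//= lerDl sumr_ge0.
Qed.

(** The claim is only eventual in [k]: the mesh has to be small compared with the radius on which
    the second derivatives of this sample path vary by at most 1/2. That radius depends on [w] and
    on the component, whence the passage through Fatou's lemma. *)
Lemma component_cell (w : T) S :
  (forall i, C3minus (cube n (r + 1)) (fcomp F i w)) -> inner_components r (F w) S ->
  exists2 x, S x & \forall k \near \oo, exists2 q : cell k,
    `|center r q.1 - x| <= mesh k & cell_event q w.
Proof.
move=> hC hS.
have [x Sx [cx Fx [i0 [lam [l0 l1 crit]]]]] := inner_component_critical j0 hC hS.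
exists x => //.
have hU (y : 'rV[R]_n) : `|y - x| < 1 -> cube n (r + 1) y by exact: cube_shift.
have Ux : cube n (r + 1) x by apply: hU; rewrite subrr normr0.
have [rho1 rho10 near1] : exists2 e : R, 0 < e & forall (p : 'I_m * ('I_n * 'I_n)) y, `|y - x| < e ->
    `|pd p.2.1 (pd p.2.2 (fcomp F p.1 w)) y - pd p.2.1 (pd p.2.2 (fcomp F p.1 w)) x| <= 2^-1.
  apply: finite_threshold => [p e e' ee h y yx|[i [j l]]]; first exact/h/(lt_le_trans yx).
  have [_ _ /(_ j l x Ux) + _] := hC i.
  have h2 : (0 : R) < 2^-1 by rewrite invr_gt0.
  move=> /cvgrPdist_le/(_ _ h2)/nbhs_ballP[e /= e0 he].
  exists e => // y yx; rewrite distrC; apply: he; by rewrite -ball_normE /= distrC.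
pose rho := Num.min rho1 1.
have rho0 : 0 < rho by rewrite lt_min rho10 ltr01.
apply: filterS2 (near_div_lt (3 * (2 * r)) rho0) (near_div_lt (5 * n%:R * (2 * r)) (@ltr01 R)) => k.
move=> [k0 h3'] [_ h5'].
have h3 : 3 * mesh k < rho by rewrite /mesh mulrA.
have h5 : 5 * n%:R * mesh k < 1 by rewrite /mesh mulrA.
have e0 := mesh_gt0 k0.
have [q hq] := exists_center k0 r0 cx.
have [g hg] := exists_grid_form (ltn0Sn (Num.truncn (2 / mesh k))) l0 l1.
exists (q, (i0, g)) => //=.
set c := center r q; have cc : cube n r c by exact: center_cube.
have /andP[s0 se] := step_gt0 e0 cc; set h := step (mesh k) c in s0 se *.
pose S1 := 1 + sum_norms (step_norms F c h) w.
have S1ge : 1 <= S1 by rewrite lerDl; apply: sumr_ge0.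
have rho_1 (y : 'rV[R]_n) : `|y - x| < rho -> `|y - x| < 1 /\ `|y - x| < rho1.
  by rewrite lt_min => /andP[].
have dF i y : `|y - x| < rho -> differentiable (fcomp F i w) y.
  by move=> /rho_1[yx _]; have [+ _ _ _] := hC i; apply; exact: hU.
have ddF i j y : `|y - x| < rho -> differentiable (pd j (fcomp F i w)) y.
  by move=> /rho_1[yx _]; have [_ + _ _] := hC i; apply; exact: hU.
have n2 i j l y : `|y - x| < rho -> `|pd j (pd l (fcomp F i w)) y - pd j (pd l (fcomp F i w)) x| <= 2^-1.
  by move=> /rho_1[_ yx]; exact: (near1 (i, (j, l)) y yx).
have S1a i j : 1 + `|fd j h (fcomp F i w) c| <= S1.
  rewrite lerD2l; apply: (@sum_norms_ge _ [::] _ _ (fun p => fd1 F c h p.1 p.2) (i, j)).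
  by rewrite mem_enum.
have S2a i (j l : 'I_n) : (j <= l)%N -> 1 + `|fd j h (fd l h (fcomp F i w)) c| <= S1.
  move=> jl; rewrite lerD2l /step_norms -[X in _ ++ X]cats0.
  apply: (@sum_norms_ge _ _ [::] _ (fun p => fd2 F c h p.1.1 p.1.2 p.2) (i, j, l)).
  by rewrite mem_enum inE.
have Fx0 i : fcomp F i w x = 0 by rewrite /fcomp Fx mxE.
have lg i : `|grid_form i0 g i - lam i| <= mesh k.
  by apply: le_trans (hg i) _; exact: fineness_mesh.
have cr j : predC1 j0 j -> \sum_i lam i * pd j (fcomp F i w) x = 0 by exact: crit.
have [hA hB] := @taylor_critical R n m (fun i => fcomp F i w) lam (grid_form i0 g) x c (mesh k) h S1 rho
  (predC1 j0) s0 se S1ge hq h3 (ltW h5) dF ddF n2 S1a S2a Fx0 l1 lg cr.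
rewrite /cell_event /near_critical /small_all /constraints /= all_cat !all_map.
by apply/andP; split; apply/allP => i /=; [move=> _; exact: hA|rewrite mem_enum; exact: hB].
Qed.

(** The count is a supremum over finite sets of components, so it suffices to separate finitely many
    of them at a time; an infinite count is covered as well. The shift [k0] leaves room to start
    where the probability bounds are valid. *)
Lemma Ncomp_le_cells (w : T) : (forall i, C3minus (cube n (r + 1)) (fcomp F i w)) ->
  forall k0, (Ncomp r (F w) <= limn_einf (fun k => \sum_(q : cell (k0 + k)) (\1_(cell_event q) w)%:E))%E.
Proof.
move=> hC k0; apply: ub_ereal_sup => _ [A [finA AS] <-].
have /choice[x hx] S : exists x, A S -> S x /\
    \forall k \near \oo, exists2 q : cell k, `|center r q.1 - x| <= mesh k & cell_event q w.
  have [/AS/(component_cell hC)[x Sx hx]|nA] := pselect (A S); last by exists 0.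
  by exists x.
pose s : seq (set 'rV[R]_n) := fset_set A.
have sA S : S \in s -> A S.
  by move=> h; have : S \in fset_set A by []; rewrite in_fset_set// => /set_mem.
have As S : A S -> S \in s.
  by move=> h; have : S \in fset_set A by rewrite in_fset_set//; exact: mem_set.
have near1 := near_seq (fun S sS => (hx S (sA S sS)).2).
(* Sharing a cell would put two of the chosen points within twice the mesh of each other. *)
have near2 : \forall k \near \oo, forall S, S \in s -> forall S', S' \in s -> S <> S' ->
    (0 < k)%N /\ (2 * (2 * r)) / k%:R < `|x S - x S'|.
  apply: near_seq => S sS; apply: near_seq => S' sS'.
  have [->|SS'] := pselect (S = S'); first exact: nearW.
  have x0 : 0 < `|x S - x S'|.
    rewrite normr_gt0 subr_eq0; apply/eqP => xE; apply: SS'.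
    have [h1 _] := hx S (sA _ sS); have [h2 _] := hx S' (sA _ sS').
    by apply: (inner_components_inj (AS _ (sA _ sS)) (AS _ (sA _ sS')) h1); rewrite xE.
  by apply: filterS (near_div_lt (2 * (2 * r)) x0) => k h.
have near3 : \forall k \near \oo, (0 < k)%N by exists 1%N.
have [N _ hN] : \forall k \near \oo, (\sum_(S \in A) (1%:E : \bar R) <= \sum_(q : cell k) (\1_(cell_event q) w)%:E)%E.
  apply: filterS3 near1 near2 near3 => k h1 h2 k_gt0.
  have qd : cell k.
    have k1 : (0 < (fineness k).+1)%N by [].
    exact: ([ffun=> Ordinal k_gt0], (ord0, [ffun=> ord0])).
  have /choice[q hq] S : exists q : cell k, A S -> `|center r q.1 - x S| <= mesh k /\ cell_event q w.
    have [/As/h1[q q1 q2]|nA] := pselect (A S); last by exists qd.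
    by exists q.
  apply: (@sum1_le_indic _ _ _ _ A (fun q : cell k => cell_event q) w q finA).
    move=> S S' /set_mem AS1 /set_mem AS2 qE; apply: contrapT => SS'.
    have [_] := h2 S (As _ AS1) S' (As _ AS2) SS'.
    have [d1 _] := hq S AS1; have [d2 _] := hq S' AS2.
    rewrite -qE in d2; apply/negP; rewrite -leNgt -mulrA -/(mesh k).
    rewrite -[x S](subrK (center r (q S).1)) -addrA.
    apply: le_trans (ler_normD _ _) _; rewrite distrC in d1.
    by rewrite mulr_natl mulr2n lerD.
  by move=> S /hq[].
by apply: (@limn_einf_ge _ _ _ N) => k Nk; apply: hN => /=; apply: leq_trans Nk _; exact: leq_addl.
Qed.

End covering.

(** * Expected number of cells and the final bound *)

Section expected_count.
Context {d : measure_display} {T : measurableType d} {R : realType} {n m' : nat}.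
Notation m := m'.+1.
Variables (P : probability T R) (r M k1 : R) (F : T -> 'rV[R]_n -> 'rV[R]_m) (j0 : 'I_n).
Hypothesis r0 : 0 < r.
Hypothesis k10 : 0 < k1.
Hypothesis GF : centered_gaussian_field P (cube n (r + 1)) F.

(** The bound of [exists_good_step], with the absolute value to be nonnegative for every real
    [M]. *)
Definition variance_cst : R := 2 * `|M| + 2.

Definition cell_cst : R := (@step_norms_size n m).+1%:R.

Definition density_cst : R :=
  cell_cst * (`|ball_cst (m + n.-1) (k1 / 4) (4 * variance_cst)| *
    (cell_cst * @critical_cst R n m') ^+ (m + n.-1)).

Lemma good_stepW c h k v v' : v <= v' -> good_step P r F c h k v -> good_step P r F c h k v'.
Proof.
move=> vv [g1 g2 g3]; split => // [i j|i j l jl].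
  by have [? /le_trans h1] := g1 i j; split => //; exact: h1.
by have [? /le_trans h1] := g2 i j l jl; split => //; exact: h1.
Qed.

Variable step : R -> 'rV[R]_n -> R.
Hypothesis stepP : forall e c, 0 < e -> cube n r c ->
  0 < step e c <= e /\ good_step P r F c (step e c) (k1 / 4) variance_cst.

Lemma variance_cst_ge0 : 0 <= variance_cst.
Proof. by rewrite addr_ge0// mulr_ge0. Qed.

Lemma critical_cst_gt0 : 0 < @critical_cst R n m'.
Proof.
have : (0 : R) <= n%:R by []; have : (0 : R) < m%:R by rewrite ltr0n.
rewrite /critical_cst; set a := m%:R; set b := n%:R => a0 b0.
by rewrite ltr_wpDl ?mulr_ge0// mulr_gt0// ltr_wpDl// mulr_ge0.
Qed.

Lemma cell_in_cube k (q : @cell R n m' r k) : cube n (r + 1) (center r q.1).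
Proof.
apply: cube_shift (center_cube q.1 r0) _; by rewrite subrr normr0.
Qed.

Lemma measurable_cell_event k (q : @cell R n m' r k) : (0 < k)%N -> measurable (cell_event F j0 step q).
Proof.
move=> k_gt0; have [_ g] := stepP (mesh_gt0 r0 k_gt0) (center_cube q.1 r0).
exact: (measurable_near_critical GF j0 _ (cell_in_cube q) g).
Qed.

Lemma prob_cell_event k (q : @cell R n m' r k) : (0 < k)%N ->
  (m + n.-1)%:R * ((1 + variance_cst / (k1 / 4)) * (cell_cst * (@critical_cst R n m' * mesh r k))) <= 2^-1 ->
  (P (cell_event F j0 step q) <= (density_cst * mesh r k ^+ (m + n.-1))%:E)%E.
Proof.
move=> k_gt0 ht; have e0 := mesh_gt0 r0 k_gt0.
have [_ g] := stepP e0 (center_cube q.1 r0).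
have k40 : 0 < k1 / 4 by rewrite divr_gt0.
have t0 : 0 < @critical_cst R n m' * mesh r k by rewrite mulr_gt0// critical_cst_gt0.
have := prob_near_critical GF j0 (cell_in_cube q) k40 variance_cst_ge0 (grid_form_id q.2.1 q.2.2) g t0 ht.
move=> /le_trans; apply; rewrite lee_fin /density_cst -/cell_cst; set B := ball_cst _ _ _.
have -> : cell_cst * (`|B| * (cell_cst * @critical_cst R n m') ^+ (m + n.-1)) * mesh r k ^+ (m + n.-1) =
    cell_cst * (`|B| * (cell_cst * (@critical_cst R n m' * mesh r k)) ^+ (m + n.-1)).
  by rewrite (mulrA cell_cst (@critical_cst R n m') (mesh r k)) (exprMn _ (cell_cst * @critical_cst R n m')) !mulrA.
apply: ler_wpM2l => //; apply: ler_wpM2r; last exact: ler_norm.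
by apply: exprn_ge0; apply: mulr_ge0 => //; exact: ltW.
Qed.

Lemma card_cell k : #|{: @cell R n m' r k}| = (k ^ n * (m * (fineness r k).+1 ^ m'))%N.
Proof. by rewrite !card_prod !card_ffun !card_ord. Qed.

(** The exponent m + n - 1 splits as n + m': the n powers of the mesh cancel the [k ^ n] cubes
    exactly, leaving (2r)^n, and the other m' cancel the grid of forms up to 4^m'. *)
Lemma expected_cells k : (0 < k)%N -> mesh r k <= 1 ->
  (m + n.-1)%:R * ((1 + variance_cst / (k1 / 4)) * (cell_cst * (@critical_cst R n m' * mesh r k))) <= 2^-1 ->
  (0 < n)%N ->
  (\int[P]_w (\sum_(q : @cell R n m' r k) (\1_(cell_event F j0 step q) w)%:E) <=
    (m%:R * 4 ^+ m' * density_cst * cube_vol n r)%:E)%E.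
Proof.
move=> k_gt0 e1 ht n0; have e0 := mesh_gt0 r0 k_gt0.
rewrite ge0_integral_sum//; last first.
  by move=> q; apply/measurable_EFinP; apply: measurable_indic; exact: measurable_cell_event.
apply: (@le_trans _ _ (\sum_(q : @cell R n m' r k) (density_cst * mesh r k ^+ (m + n.-1))%:E)%E).
  apply: lee_sum => q _; rewrite integral_indic//; last exact: measurable_cell_event.
  by rewrite setIT; exact: prob_cell_event.
rewrite sumEFin lee_fin sumr_const card_cell -[leLHS]mulr_natl.
have kE : k%:R * mesh r k = r *+ 2.
  by rewrite /mesh mulrC divfK ?mulr_natl// pnatr_eq0 -lt0n.
(* The number of grid points per entry is at most 2/mesh + 2, and the mesh is at most 1. *)
have fE : (fineness r k).+1%:R * mesh r k <= 4.
  have : (Num.truncn (2 / mesh r k))%:R <= 2 / mesh r k.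
    by rewrite truncn_le divr_ge0// ltW.
  rewrite ler_pdivlMr// /fineness -!natr1 !mulrDl !mul1r; lra.
have mE : (m + n.-1 = n + m')%N by rewrite -(prednK n0) /= addSnnS addnC.
rewrite !natrM !natrX mE exprD.
have D0 : 0 <= density_cst.
  by rewrite /density_cst !mulr_ge0// exprn_ge0// mulr_ge0// ltW// critical_cst_gt0.
have -> : k%:R ^+ n * (m%:R * (fineness r k).+1%:R ^+ m') * (density_cst * (mesh r k ^+ n * mesh r k ^+ m')) =
   (m%:R * density_cst * (k%:R * mesh r k) ^+ n) * ((fineness r k).+1%:R * mesh r k) ^+ m'.
  by rewrite !exprMn; ring.
have -> : m%:R * 4 ^+ m' * density_cst * cube_vol n r = (m%:R * density_cst * (k%:R * mesh r k) ^+ n) * 4 ^+ m'.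
  by rewrite kE /cube_vol; ring.
apply: ler_wpM2l.
  apply: mulr_ge0; first exact: mulr_ge0.
  by apply: exprn_ge0; apply: mulr_ge0 => //; exact: ltW.
by rewrite lerXn2r ?nnegrE// mulr_ge0// ltW.
Qed.

End expected_count.

Unset Implicit Arguments.

Theorem theorem2p1 (R : realType) (n m : nat) (hm : (1 <= m)%N) (hnm : (m < n)%N)
    (M k1 : R) (hk1 : 0 < k1) :
  exists2 D1 : R, 0 < D1 &
  forall (r : R), 0 < r ->
  forall (d : measure_display) (T : measurableType d) (P : probability T R)
         (F : T -> 'rV[R]_n -> 'rV[R]_m),
    {ae P, forall w, {in cube n (r + 1), continuous (F w)}} ->
    centered_gaussian_field P (cube n (r + 1)) F ->
    assumption_A1 P r k1 F ->
    assumption_A2 P r M F ->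
    (\int[P]_w Ncomp r (F w) <= (D1 * cube_vol n r)%:E)%E.
Proof.
case: m hm hnm => // m' _ hnm.
have n0 : (0 < n)%N by exact: leq_ltn_trans hnm.
have D0 : 0 <= @density_cst R n m' M k1.
  rewrite /density_cst !mulr_ge0// exprn_ge0// mulr_ge0// ltW//; exact: critical_cst_gt0.
(* The first term is only known to be nonnegative; adding 1 makes the constant positive. *)
exists (m'.+1%:R * 4 ^+ m' * @density_cst R n m' M k1 + 1).
  by apply: ltr_wpDl => //; apply: mulr_ge0 => //; apply: mulr_ge0 => //; exact: exprn_ge0.
move=> r r0 d T P F _ GF A1 A2.
have /choice[step' stepP'] (p : R * 'rV[R]_n) : exists h, 0 < p.1 -> cube n r p.2 ->
    0 < h <= p.1 /\ good_step P r F p.2 h (k1 / 4) (variance_cst M).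
  have [e0|] := pselect (0 < p.1); last by exists 0.
  have [c0|] := pselect (cube n r p.2); last by exists 0.
  have [h he g] := exists_good_step GF A1 A2 c0 e0.
  exists h => _ _; split => //; apply: good_stepW g.
  by rewrite /variance_cst lerD2r ler_pM2l// ler_norm.
pose step e c := step' (e, c).
have stepP e c : 0 < e -> cube n r c ->
    0 < step e c <= e /\ good_step P r F c (step e c) (k1 / 4) (variance_cst M) by exact: stepP' (e, c).
have step0 e c (e0 : 0 < e) (hc : cube n r c) := (stepP e c e0 hc).1.
pose j0 : 'I_n := Ordinal n0.
(* The smallness condition of the ball estimate becomes [a / k < 1/2]. It depends on [r], but only
   fixes where the sequence of subdivisions starts; the constant is unaffected. *)
pose a : R := (m'.+1 + n.-1)%:R * ((1 + variance_cst M / (k1 / 4)) * (@cell_cst R n m' * (@critical_cst R n m' * (2 * r)))).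
have h2 : (0 : R) < 2^-1 by rewrite invr_gt0.
have [k0 _ hk0] := filterI (near_div_lt (2 * r) (@ltr01 R)) (near_div_lt a h2).
apply: (@le_trans _ _ (m'.+1%:R * 4 ^+ m' * @density_cst R n m' M k1 * cube_vol n r)%:E); last first.
  by rewrite lee_fin mulrDl mul1r lerDl /cube_vol exprn_ge0// mulrn_wge0// ltW.
apply: (@integral_le_fatou _ _ _ P (fun w => Ncomp r (F w))
  (fun k w => (\sum_(q : @cell R n m' r (k0 + k)) (\1_(cell_event F j0 step q) w)%:E)%E)).
- by move=> w; apply: esum_ge0.
- move=> k; have [[k_gt0 _] _] := hk0 (k0 + k)%N (leq_addr _ _).
  apply: emeasurable_sum => q; apply/measurable_EFinP; apply: measurable_indic.
  exact: (measurable_cell_event j0 r0 GF stepP).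
- by move=> k w; apply: sume_ge0 => q _; rewrite lee_fin.
- have [hC _] := A2.
  have : {ae P, forall w, forall i, (fun i w => C3minus (cube n (r + 1)) (fcomp F i w)) i w}.
    by apply: filter_forall => i; exact: hC.
  by apply: filterS => w hw; exact: (Ncomp_le_cells j0 r0 step0 hw).
move=> k; have [[k_gt0 e1] [_ ht]] := hk0 (k0 + k)%N (leq_addr _ _).
apply: (expected_cells j0 r0 hk1 GF stepP) => //; first exact: ltW.
apply: ltW; apply: le_lt_trans ht; rewrite /a /mesh; set x := (k0 + k)%:R.
by rewrite -!mulrA.
Qed.
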